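(* Let $n\ge 1$, $m=\binom n2$, $\lambda=(n,n-1,\ldots,1)$, and $a_i=2i-n-1$ for $1\le i\le n$. With the notation of the context, consider the composition $$\Phi:\ V(a_1,\ldots,a_n)\longrightarrow \mathbb{C}[S_n],\qquad \Phi(x)=\pi\bigl(\mathrm{Rect}_n^{m+n}\cdot \eta(x)\cdot (\mathrm{Rect}_n^{m+n})^*\bigr),$$ where $\mathrm{Rect}_n^{m+n}$ acts on the left and $(\mathrm{Rect}_n^{m+n})^*$ acts on the right on $\mathbb{C}[S_{m+n}]$. Then $\Phi$ is a well-defined linear isomorphism (a change of basis) taking the weight basis $\{v_\sigma\}_{\sigma\in S_n}$ of $V(a_1,\ldots,a_n)$ to the weight basis $\{v_{T,T'}\}$ of $\mathbb{C}[S_n]$ (weight vectors being taken up to nonzero scalar), and its action is given explicitly by $$v_\sigma\ \longmapsto\ v_{\sigma T_0,\ \sigma^{-1}T_0}\ \longmapsto\ v_{P(\sigma),Q(\sigma)},$$ that is, $\eta(v_\sigma)=v_{\sigma T_0,\sigma^{-1}T_0}$ and $\Phi(v_\sigma)$ is a nonzero scalar multiple of $v_{P(\sigma),Q(\sigma)}$ for every $\sigma\in S_n$, where $(P(\sigma),Q(\sigma))$ is the pair of standard tableaux assigned to $\sigma$ by the Robinson-Schensted-Knuth correspondence.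
   Context: All algebras are over $\mathbb{C}$. $\sigma_i=(i\ i+1)$. **Tableaux.** Boxes of Young diagrams are indexed $(i,j)$ = (row, column), rows numbered top to bottom. A standard tableau with $N$ boxes is filled with $1,\ldots,N$ once each, increasing along rows to the right and down columns. The content of box $(i,j)$ is $j-i$; $\mathrm{cont}(b(T,i))$ is the content of the box of $T$ containing $i$. For a standard tableau $A$, $A|_n$ is the subtableau consisting of the boxes with entries $1,\ldots,n$. **RSK.** For $\sigma\in S_n$ write $\sigma=w_1\cdots w_n$ with $w_i=\sigma(i)$. Insert $w_1,\ldots,w_n$ successively, starting from the empty tableau: to insert a number into an increasing row, put it at the end if it is larger than all entries, otherwise replace the smallest entry larger than it and insert the replaced (bumped) entry into the next row. $P(\sigma)$ is the final tableau; $Q(\sigma)$ has $i$ in the box added at the $i$-th insertion. **Degenerate affine Hecke algebra.** $H_n$ is generated by $\mathbb{C}[S_n]$ and commuting elements $Y_1,\ldots,Y_n$ with $\sigma_iY_i\sigma_i+\sigma_i=Y_{i+1}$ and $\sigma_jY_k=Y_k\sigma_j$ for $j\ne k-1,k$. $V(a_1,\ldots,a_n)=H_n\otimes_{\mathbb{C}[Y_1,\ldots,Y_n]}\mathbb{C}v$, where $Y_iv=a_iv$. Put $\varphi_i=\sigma_i(Y_i-Y_{i+1})+1$; for $\sigma\in S_n$ with a reduced expression $\sigma=\sigma_{i_1}\cdots\sigma_{i_k}$ put $\varphi_\sigma=\varphi_{i_1}\cdots\varphi_{i_k}$ (independent of the reduced expression) and $v_\sigma=\varphi_\sigma v$. For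 distinct $a_i$, $\{v_\sigma\}$ is a basis of common eigenvectors of the $Y_i$ (the weight basis). **Weight basis of $\mathbb{C}[S_N]$.** The Jucys-Murphy elements are $X_1=0$, $X_i=(1\ i)+\cdots+(i-1\ i)$. $\mathbb{C}[S_N]$ has a basis $\{v_{T,T^*}\}$, unique up to scaling each vector, indexed by pairs of standard tableaux of the same shape with $N$ boxes, such that $X_i\cdot v_{T,T^*}=\mathrm{cont}(b(T,i))\,v_{T,T^*}$ and $v_{T,T^*}\cdot X_i=\mathrm{cont}(b(T^*,i))\,v_{T,T^*}$ for all $i$. Fix such bases for $N=m+n$ and $N=n$. **Normalized intertwiners.** For $1\le i<N$ define a linear operator $\tilde\varphi_i$ on any left $S_N$-module by its action on common eigenvectors $u$ of the $X_j$: with $d$ the eigenvalue of $X_i$ minus that of $X_{i+1}$ on $u$, put $\tilde\varphi_iu=\frac{d\,\sigma_iu+u}{(d+1)(d-1)}$ if $d\ne\pm1$, and $\tilde\varphi_iu=-\frac12u$ if $d=\pm1$. (This is $\frac{\sigma_i(X_i-X_{i+1})+1}{(X_i-X_{i+1}+1)(X_i-X_{i+1}-1)}$ with common zeros cancelled.) Define $\tilde\varphi_i^*$, acting on the right in right $S_N$-modules, in the mirror-image way: on a common right eigenvector $u$ of the $X_j$, with $d$ the right eigenvalue of $X_i$ minus that of $X_{i+1}$, $u\cdot\tilde\varphi_i^*=\frac{d\,u\sigma_i+u}{(d+1)(d-1)}$ if $d\neq\pm1$ and $-\frac12u$ if $d=\pm1$. **Slide and rectification operators** on $\mathbb{C}[S_{m+n}]$: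 for $1\le k\le m$, $\mathrm{jdt}_{(k,k+n)}=\tilde\varphi_{k+n-1}\tilde\varphi_{k+n-2}\cdots\tilde\varphi_{k+1}\tilde\varphi_k$ and $\mathrm{Rect}_n^{m+n}=\mathrm{jdt}_{(1,1+n)}\circ\mathrm{jdt}_{(2,2+n)}\circ\cdots\circ\mathrm{jdt}_{(m,m+n)}$, acting on the left (so $\mathrm{jdt}_{(m,m+n)}$ acts first). On the right, $\mathrm{jdt}^*_{(k,k+n)}=\tilde\varphi^*_k\tilde\varphi^*_{k+1}\cdots\tilde\varphi^*_{k+n-1}$ (with $\tilde\varphi_k^*$ acting first) and $(\mathrm{Rect}_n^{m+n})^*$ is the product $\mathrm{jdt}^*_{(m,m+n)}\mathrm{jdt}^*_{(m-1,m-1+n)}\cdots\mathrm{jdt}^*_{(1,1+n)}$, with the leftmost factor acting first. **The embedding $\eta$.** Let $\mu=(n-1,n-2,\ldots,1)$, and let $T'$ be the standard tableau of shape $\mu$ filled row by row from the top ($1,\ldots,n-1$ in row 1, $n,\ldots,2n-3$ in row 2, etc.). $T_0$ is the standard tableau of shape $\lambda$ extending $T'$ with $m+j$ in column $j$ of $\lambda/\mu$, i.e. in box $(n+1-j,j)$, $1\le j\le n$. For $\tau\in S_n$, $\tau T_0$ is obtained from $T_0$ by replacing each entry $m+j$ by $m+\tau(j)$, $1\le j\le n$ (it is again standard). $\eta:V(a_1,\ldots,a_n)\to\mathbb{C}[S_{m+n}]$ is the linear map with $\eta(v_\sigma)=v_{\sigma T_0,\sigma^{-1}T_0}$. **Forgetting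 the outer boxes.** After rectification only the action of the subgroup $S_n\subset S_{m+n}$ on the letters $1,\ldots,n$ is considered, i.e. only the left and right weights of $X_1,\ldots,X_n$. Formally, let $D\subset\mathbb{C}[S_{m+n}]$ be the span of those $v_{A,B}$, with $A,B$ standard of shape $\lambda$, for which $A|_n$ and $B|_n$ have the same shape, and let $\pi:D\to\mathbb{C}[S_n]$ be the linear map $v_{A,B}\mapsto v_{A|_n,B|_n}$. That $\Phi$ is well defined means in particular that $\mathrm{Rect}_n^{m+n}\cdot\eta(x)\cdot(\mathrm{Rect}_n^{m+n})^*\in D$ for all $x$. *)

(* Defs.v *)
From HB Require Import structures.
From mathcomp Require Import all_boot all_order all_algebra all_fingroup.
From mathcomp Require Import generic_quotient ring_quotient.
From mathcomp Require Import boolp classical_sets reals.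
From mathcomp Require Import complex.
From mathcomp Require Import monalg.

Set Implicit Arguments.
Unset Strict Implicit.
Unset Printing Implicit Defensive.

Import GRing.Theory.
Local Open Scope ring_scope.
Local Open Scope quotient_scope.

(* Letters, entries of tableaux and indices of generators are numbered from 1,
   as naturals; the letter [k] of S_N is the ordinal [k - 1] of ['I_N]. *)

Definition letter (N k : nat) : option 'I_N :=
  if k is k'.+1 then insub k' else None.

(* The product of S_N is the composition of functions, whereas the product of
   MathComp is [(s * t)%g x = t (s x)]. *)
Definition pcomp (N : nat) (s t : 'S_N) : 'S_N := (t * s)%g.

Lemma pcompE N (s t : 'S_N) x : pcomp s t x = s (t x).
Proof. by rewrite permM. Qed.

Definition transp (N i j : nat) : 'S_N :=
  if (letter N i, letter N j) is (Some a, Some b) then tperm a b else 1%g.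

Definition simple_transp (N i : nat) : 'S_N := transp N i i.+1.

Definition word_perm (N : nat) (w : seq nat) : 'S_N :=
  foldr (fun i s => pcomp (simple_transp N i) s) 1%g w.

Definition is_word_of (N : nat) (s : 'S_N) (w : seq nat) : Prop :=
  all (fun i => 0 < i < N)%N w /\ word_perm N w = s.

Definition reduced_word (N : nat) (s : 'S_N) (w : seq nat) : Prop :=
  is_word_of s w /\ forall w', is_word_of s w' -> (size w <= size w')%N.

(* Reduced expressions exist, so the default value is irrelevant. *)
Definition some_reduced_word (N : nat) (s : 'S_N) : seq nat :=
  xget [::] [set w | reduced_word s w]%classic.

(* The rows from top to bottom. *)
Definition tableau := seq (seq nat).

(* For consecutive rows: the lower one is not longer, and the entries increase
   down each column. *)
Definition row_above (r1 r2 : seq nat) : bool :=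
  (size r2 <= size r1)%N &&
  all (fun j => nth 0 r1 j < nth 0 r2 j)%N (iota 0 (size r2)).

Definition standard (N : nat) (T : tableau) : bool :=
  [&& perm_eq (flatten T) (iota 1 N), [::] \notin T,
      all (sorted ltn) T & sorted row_above T].

Definition content (T : tableau) (k : nat) : int :=
  let r := find (fun row => k \in row) T in
  (index k (nth [::] T r))%:Z - r%:Z.

Definition restrict (n : nat) (T : tableau) : tableau :=
  [seq row <- [seq [seq k <- row | (k <= n)%N] | row <- T] | row != [::]].

(* All the standard tableaux, by [mem_std_tableaux]. *)
Definition std_tableaux (N : nat) : seq tableau :=
  undup [seq T <- [seq reshape (map (@nat_of_ord _) (val sh)) w
                  | sh <- enum {: N.-bseq 'I_N.+1}, w <- permutations (iota 1 N)]
        | standard N T].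

Lemma mem_std_tableaux N T : (T \in std_tableaux N) = standard N T.
Proof.
rewrite mem_undup mem_filter; apply: andb_idr => /and4P[permT nilT _ _].
have szT : sumn (shape T) = N.
  by rewrite -size_flatten (perm_size permT) size_iota.
have leT r : r \in T -> (size r <= N)%N.
  move=> rT; rewrite -szT /shape; elim: T rT {permT nilT szT} => //= r' T IH.
  rewrite inE => /predU1P[-> | /IH le_r]; first exact: leq_addr.
  exact: leq_trans le_r (leq_addl _ _).
have lenT : (size T <= N)%N.
  rewrite -szT /shape; elim: T nilT {permT szT leT} => //= r T IH.
  rewrite inE negb_or => /andP[r0 /IH le_T]; rewrite -add1n leq_add //.
  by case: r r0.
have szb : (size (map (@inord N) (shape T)) <= N)%N by rewrite !size_map.
apply/allpairsP; exists (Bseq szb, flatten T); split => /=.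
- by rewrite mem_enum.
- by rewrite mem_permutations.
rewrite -map_comp -[LHS]flattenK; congr reshape; rewrite /shape -map_comp.
by apply/eq_in_map => r rT /=; rewrite inordK // ltnS leT.
Qed.

Definition std_pair (N : nat) (T T' : tableau) : bool :=
  [&& standard N T, standard N T' & shape T == shape T'].

Definition std_pairs (N : nat) : seq (tableau * tableau) :=
  [seq p <- [seq (T, T') | T <- std_tableaux N, T' <- std_tableaux N]
  | shape p.1 == shape p.2].

Lemma mem_std_pairs N T T' : ((T, T') \in std_pairs N) = std_pair N T T'.
Proof.
rewrite mem_filter /std_pair /= andbA andbC; congr (_ && _).
apply/allpairsP/andP => [[[A B] [/= hA hB [-> ->]]]|[hT hT']].
  by rewrite -!mem_std_tableaux.
by exists (T, T'); rewrite !mem_std_tableaux.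
Qed.

(* In an increasing row, the smallest entry larger than [x] is the first one. *)
Fixpoint insert (x : nat) (T : tableau) : tableau :=
  if T is row :: T' then
    let p := find (fun y => x < y)%N row in
    if (p < size row)%N then set_nth 0%N row p x :: insert (nth 0%N row p) T'
    else rcons row x :: T'
  else [:: [:: x]].

Definition add_box (r k : nat) (Q : tableau) : tableau :=
  set_nth [::] Q r (rcons (nth [::] Q r) k).

(* The row of the box of [P'] that is not in [P]. *)
Definition new_row (P P' : tableau) : nat :=
  find (fun r => size (nth [::] P r) < size (nth [::] P' r))%N
       (iota 0 (size P')).

Definition rsk_step (PQ : tableau * tableau) (iw : nat * nat) :
    tableau * tableau :=
  let P' := insert iw.2 PQ.1 in
  (P', add_box (new_row PQ.1 P') iw.1 PQ.2).

Definition one_line (n : nat) (s : 'S_n) : seq nat :=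
  [seq (s i).+1 | i <- enum 'I_n].

Definition rsk (n : nat) (s : 'S_n) : tableau * tableau :=
  foldl rsk_step ([::], [::]) (zip (iota 1 n) (one_line s)).

Definition rskP (n : nat) (s : 'S_n) : tableau := (rsk s).1.
Definition rskQ (n : nat) (s : 'S_n) : tableau := (rsk s).2.

Definition staircase (n : nat) : seq nat := rev (iota 1 n).

Definition inner_tableau (n : nat) : tableau :=
  reshape (staircase n.-1) (iota 1 'C(n, 2)).

(* Counting rows from 0, row [r] ends with the box in column [n - r], which
   contains m + (n - r), where m = 'C(n, 2). *)
Definition T0 (n : nat) : tableau :=
  [seq rcons (nth [::] (inner_tableau n) r) ('C(n, 2) + (n - r))%N
  | r <- iota 0 n].

Definition perm_entry (n : nat) (s : 'S_n) (k : nat) : nat :=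
  if letter n (k - 'C(n, 2)) is Some j then ('C(n, 2) + (s j).+1)%N else k.

Definition perm_T0 (n : nat) (s : 'S_n) : tableau :=
  [seq [seq perm_entry s k | k <- row] | row <- T0 n].

Section QuotientModule.
Variables (R : pzRingType) (V : lmodType R) (I : zmodClosed V).
Hypothesis scaleI : GRing.scaler_closed (I : {pred V}).
Local Notation Q := (Quotient.quot I).

Definition quot_scale (c : R) (x : Q) : Q := \pi_Q (c *: repr x).

Lemma pi_scale c x : quot_scale c (\pi_Q x) = \pi_Q (c *: x).
Proof.
apply/eqP; rewrite -Quotient.idealrBE -scalerBr scaleI //.
by rewrite Quotient.idealrBE reprK.
Qed.

Lemma quot_scaleA a b x :
  quot_scale a (quot_scale b x) = quot_scale (a * b) x.
Proof. by elim/quotW: x => x; rewrite (pi_scale b) !pi_scale scalerA. Qed.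

Lemma quot_scale1 : left_id 1 quot_scale.
Proof. by elim/quotW => x; rewrite pi_scale scale1r. Qed.

Lemma quot_scaleDr : right_distributive quot_scale +%R.
Proof.
move=> c; elim/quotW => x; elim/quotW => y.
by rewrite -raddfD !pi_scale -raddfD -scalerDr.
Qed.

Lemma quot_scaleDl x : {morph quot_scale^~ x : a b / a + b}.
Proof.
by move=> a b; elim/quotW: x => x; rewrite !pi_scale -raddfD -scalerDl.
Qed.

End QuotientModule.

Section DegenerateAffineHecke.
Variables (C : fieldType) (n : nat).

(* The generators are the elements of S_n and Y_1, ..., Y_n; [inr i] is
   Y_(i + 1). *)
Local Notation F := {malg C[{fmonom ('S_n + 'I_n)%type}]}.

Definition free_perm (s : 'S_n) : F := << fmu (inl s) >>.
Definition free_Y (i : 'I_n) : F := << fmu (inr i) >>.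

Inductive hecke_relator : F -> Prop :=
| RelOne : hecke_relator (free_perm 1%g - 1)
| RelMul s t :
    hecke_relator (free_perm s * free_perm t - free_perm (pcomp s t))
| RelYY i j : hecke_relator (free_Y i * free_Y j - free_Y j * free_Y i)
| RelCross (i j : 'I_n) : j = i.+1 :> nat ->
    hecke_relator (free_perm (tperm i j) * free_Y i * free_perm (tperm i j)
                   + free_perm (tperm i j) - free_Y j)
| RelFar (i j k : 'I_n) : j = i.+1 :> nat -> k != i -> k != j ->
    hecke_relator (free_perm (tperm i j) * free_Y k
                   - free_Y k * free_perm (tperm i j)).

Inductive in_hecke_ideal : F -> Prop :=
| IdealRel r : hecke_relator r -> in_hecke_ideal r
| Ideal0 : in_hecke_ideal 0
| IdealD x y : in_hecke_ideal x -> in_hecke_ideal y -> in_hecke_ideal (x + y)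
| IdealMl a x : in_hecke_ideal x -> in_hecke_ideal (a * x)
| IdealMr a x : in_hecke_ideal x -> in_hecke_ideal (x * a).

Definition hecke_ideal : {pred F} := fun x => `[< in_hecke_ideal x >].

Lemma hecke_ideal_submod : submod_closed hecke_ideal.
Proof.
split=> [|c x y /asboolP hx /asboolP hy]; apply/asboolP; first exact: Ideal0.
by apply: IdealD => //; rewrite -mul_malgC; apply: IdealMl.
Qed.

HB.instance Definition _ :=
  GRing.isSubmodClosed.Build C F hecke_ideal hecke_ideal_submod.

Lemma hecke_ideal_scale : GRing.scaler_closed hecke_ideal.
Proof. by move=> c x; apply: rpredZ. Qed.

Definition hecke : Type := Quotient.quot hecke_ideal.
HB.instance Definition _ := GRing.Zmodule.on hecke.
HB.instance Definition _ := GRing.Zmodule_isLmodule.Build C hecke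
  (quot_scaleA hecke_ideal_scale) (quot_scale1 hecke_ideal_scale)
  (quot_scaleDr hecke_ideal_scale) (quot_scaleDl hecke_ideal_scale).
Local Notation H := hecke.
Definition hecke_class (x : F) : H := \pi_(Quotient.quot hecke_ideal) x.

Lemma hecke_classP x y : reflect (in_hecke_ideal (x - y))
  (hecke_class x == hecke_class y).
Proof. by rewrite -Quotient.idealrBE; apply: asboolP. Qed.

Lemma hecke_classK x : hecke_class (repr x) = x.
Proof. exact: reprK. Qed.

Lemma hecke_classD : {morph hecke_class : x y / x + y}.
Proof. by move=> x y; rewrite /hecke_class raddfD. Qed.

Lemma hecke_classZ c : {morph hecke_class : x / c *: x}.
Proof. by move=> x; apply/esym/(pi_scale hecke_ideal_scale). Qed.

Definition hecke_one : H := hecke_class 1.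
Definition hecke_mul (x y : H) : H := hecke_class (repr x * repr y).

Lemma hecke_classM x y :
  hecke_mul (hecke_class x) (hecke_class y) = hecke_class (x * y).
Proof.
apply/eqP/hecke_classP; set x' := repr _; set y' := repr _.
have -> : x' * y' - x * y = x' * (y' - y) + (x' - x) * y.
  by rewrite mulrBr mulrBl addrA subrK.
apply: IdealD; [apply: IdealMl | apply: IdealMr].
  by apply/hecke_classP; rewrite hecke_classK.
by apply/hecke_classP; rewrite hecke_classK.
Qed.

Lemma hecke_mulA : associative hecke_mul.
Proof.
move=> x y z; rewrite -(hecke_classK x) -(hecke_classK y) -(hecke_classK z).
by rewrite !hecke_classM mulrA.
Qed.

Lemma hecke_mul1 : left_id hecke_one hecke_mul.
Proof. by move=> x; rewrite -(hecke_classK x) hecke_classM mul1r. Qed.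

Lemma hecke_mulr1 : right_id hecke_one hecke_mul.
Proof. by move=> x; rewrite -(hecke_classK x) hecke_classM mulr1. Qed.

Lemma hecke_mulDl : left_distributive hecke_mul +%R.
Proof.
move=> x y z; rewrite -(hecke_classK x) -(hecke_classK y) -(hecke_classK z).
by rewrite -hecke_classD !hecke_classM mulrDl hecke_classD.
Qed.

Lemma hecke_mulDr : right_distributive hecke_mul +%R.
Proof.
move=> x y z; rewrite -(hecke_classK x) -(hecke_classK y) -(hecke_classK z).
by rewrite -hecke_classD !hecke_classM mulrDr hecke_classD.
Qed.

(* The character s |-> 1, Y_i |-> i - 1 shows that the algebra is not trivial. *)
Definition triv_letter (g : ('S_n + 'I_n)%type) : C :=
  if g is inr i then (i : nat)%:R else 1.
Definition triv_word (w : {fmonom ('S_n + 'I_n)%type}) : C :=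
  \prod_(g <- (w : seq _)) triv_letter g.

Lemma triv_word_morph : mmorphism triv_word.
Proof.
split=> [x y|]; rewrite /triv_word; last by rewrite fm1 big_nil.
by rewrite fmM big_cat.
Qed.
HB.instance Definition _ := isMultiplicative.Build _ _ triv_word triv_word_morph.

Definition triv (x : F) : C := mmap (@idfun C) triv_word x.

Lemma trivB : {morph triv : x y / x - y}. Proof. exact: mmapB. Qed.
Lemma trivD : {morph triv : x y / x + y}. Proof. exact: mmapD. Qed.
Lemma triv0 : triv 0 = 0. Proof. exact: mmap0. Qed.
Lemma triv1 : triv 1 = 1. Proof. exact: mmap1. Qed.
Lemma trivM : {morph triv : x y / x * y}.
Proof. by move=> x y; apply: rmorphM. Qed.

Lemma triv_comm x y : triv (x * y - y * x) = 0.
Proof. by rewrite trivB !trivM mulrC subrr. Qed.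
Lemma triv_mulB x y z : triv (x * y - z) = triv x * triv y - triv z.
Proof. by rewrite trivB trivM. Qed.
Lemma triv_cross x y z :
  triv (x * y * x + x - z) = triv x * triv y * triv x + triv x - triv z.
Proof. by rewrite trivB trivD !trivM. Qed.

Lemma triv_gen g : triv << fmu g >> = triv_letter g.
Proof. by rewrite /triv mmapU mul1r /triv_word fmuE big_seq1. Qed.

Lemma triv_perm s : triv (free_perm s) = 1. Proof. exact: triv_gen. Qed.
Lemma triv_Y i : triv (free_Y i) = (i : nat)%:R. Proof. exact: triv_gen. Qed.

Lemma triv_ideal x : in_hecke_ideal x -> triv x = 0.
Proof.
elim=> {x} [x|| x y _ hx _ hy|a x _ hx|a x _ hx].
- case=> [|s t|i j|i j ij|i j k _ _ _].
  + by rewrite trivB triv_perm triv1 subrr.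
  + by rewrite triv_mulB !triv_perm mulr1 subrr.
  + exact: triv_comm.
  + by rewrite triv_cross !triv_perm !triv_Y mul1r mulr1 ij -natr1 subrr.
  + exact: triv_comm.
- exact: triv0.
- by rewrite trivD hx hy addr0.
- by rewrite trivM hx mulr0.
- by rewrite trivM hx mul0r.
Qed.

Lemma hecke_one_neq0 : hecke_one != 0.
Proof.
apply/negP; have -> : (0 : H) = hecke_class 0 by rewrite /hecke_class raddf0.
move/hecke_classP/triv_ideal/eqP.
by rewrite subr0 triv1 oner_eq0.
Qed.

HB.instance Definition _ := GRing.Zmodule_isNzRing.Build H
  hecke_mulA hecke_mul1 hecke_mulr1 hecke_mulDl hecke_mulDr hecke_one_neq0.

Lemma hecke_class_mul : {morph hecke_class : x y / x * y}.
Proof. by move=> x y; apply/esym/hecke_classM. Qed.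

Lemma hecke_scaleAl c (x y : H) : c *: (x * y) = (c *: x) * y.
Proof.
rewrite -(hecke_classK x) -(hecke_classK y); move: (repr x) (repr y) => u v.
rewrite -(hecke_classZ c u) -(hecke_class_mul u v) -(hecke_class_mul (c *: u) v).
by rewrite -(hecke_classZ c (u * v)) scalerAl.
Qed.
HB.instance Definition _ := GRing.Lmodule_isLalgebra.Build C H hecke_scaleAl.

Lemma free_scaleAr c (x y : F) : c *: (x * y) = x * (c *: y).
Proof.
apply/malgP => k; rewrite mcoeffZ !(@mcoeffMlw _ _ (msupp x) (msupp y)) //.
  rewrite mulr_sumr; apply: eq_bigr => k1 _; rewrite mulr_sumr.
  by apply: eq_bigr => k2 _; rewrite mcoeffZ mulrnAr mulrCA.
exact: msuppZ_le.
Qed.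

Lemma hecke_scaleAr c (x y : H) : c *: (x * y) = x * (c *: y).
Proof.
rewrite -(hecke_classK x) -(hecke_classK y); move: (repr x) (repr y) => u v.
rewrite -(hecke_classZ c v) -(hecke_class_mul u v) -(hecke_class_mul u (c *: v)).
by rewrite -(hecke_classZ c (u * v)) free_scaleAr.
Qed.
HB.instance Definition _ := GRing.Lalgebra_isAlgebra.Build C H hecke_scaleAr.

Definition hecke_perm (s : 'S_n) : H := hecke_class (free_perm s).
Definition hecke_Y (k : nat) : H :=
  if letter n k is Some i then hecke_class (free_Y i) else 0.

Definition hecke_phi (i : nat) : H :=
  hecke_perm (simple_transp n i) * (hecke_Y i - hecke_Y i.+1) + 1.

Definition hecke_phi_perm (s : 'S_n) : H :=
  \prod_(i <- some_reduced_word s) hecke_phi i.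

(* V(a_1, ..., a_n): the tensor product of H, over C[Y_1, ..., Y_n], with the
   character Y_i |-> a_i is the quotient of H by the left ideal generated by
   the Y_i - a_i. *)

Variable a : nat -> C.

Inductive in_weight_ideal : H -> Prop :=
| WIdealGen k : (1 <= k <= n)%N -> in_weight_ideal (hecke_Y k - (a k)%:A)
| WIdeal0 : in_weight_ideal 0
| WIdealD x y :
    in_weight_ideal x -> in_weight_ideal y -> in_weight_ideal (x + y)
| WIdealMl h x : in_weight_ideal x -> in_weight_ideal (h * x).

Definition weight_ideal : {pred H} := fun x => `[< in_weight_ideal x >].

Lemma weight_ideal_submod : submod_closed weight_ideal.
Proof.
split=> [|c x y /asboolP hx /asboolP hy]; apply/asboolP; first exact: WIdeal0.
by apply: WIdealD => //; rewrite -mulr_algl; apply: WIdealMl.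
Qed.

HB.instance Definition _ :=
  GRing.isSubmodClosed.Build C H weight_ideal weight_ideal_submod.

Lemma weight_ideal_scale : GRing.scaler_closed weight_ideal.
Proof. by move=> c x; apply: rpredZ. Qed.

Definition ind_module : Type := Quotient.quot weight_ideal.
HB.instance Definition _ := GRing.Zmodule.on ind_module.
HB.instance Definition _ := GRing.Zmodule_isLmodule.Build C ind_module
  (quot_scaleA weight_ideal_scale) (quot_scale1 weight_ideal_scale)
  (quot_scaleDr weight_ideal_scale) (quot_scaleDl weight_ideal_scale).

Definition ind_class (x : H) : ind_module := \pi_(Quotient.quot weight_ideal) x.

Definition ind_act (h : H) (x : ind_module) : ind_module :=
  ind_class (h * repr x).

Lemma ind_actE h x : ind_act h (ind_class x) = ind_class (h * x).
Proof.
apply/eqP; rewrite -Quotient.idealrBE -mulrBr; apply/asboolP/WIdealMl/asboolP.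
rewrite -[X in is_true X]/(_ \in weight_ideal).
by rewrite Quotient.idealrBE reprK.
Qed.

Definition ind_vector : ind_module := ind_class 1.

Lemma ind_weight k :
  (1 <= k <= n)%N -> ind_act (hecke_Y k) ind_vector = a k *: ind_vector.
Proof.
move=> hk; rewrite ind_actE mulr1 -[RHS](esym (pi_scale weight_ideal_scale _ _)).
apply/eqP; rewrite -Quotient.idealrBE; apply/asboolP; exact: WIdealGen.
Qed.

Definition ind_basis (s : 'S_n) : ind_module :=
  ind_act (hecke_phi_perm s) ind_vector.

End DegenerateAffineHecke.

Section GroupAlgebra.
Variables (C : fieldType) (N : nat).

Definition gralg : Type := {ffun 'S_N -> C^o}.
HB.instance Definition _ := Vector.copy gralg {ffun 'S_N -> C^o}.

Definition gperm (s : 'S_N) : gralg := [ffun t => (t == s)%:R].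

Definition gralg_mul (x y : gralg) : gralg :=
  [ffun g => \sum_(p : 'S_N * 'S_N | pcomp p.1 p.2 == g) x p.1 * y p.2].

Lemma gralg_mulE x y g :
  gralg_mul x y g = \sum_s x s * y (pcomp s^-1%g g).
Proof.
rewrite ffunE (reindex_onto (fun s => (s, pcomp s^-1%g g)) fst) /=.
  apply: eq_bigl => s; rewrite /pcomp mulgKV !eqxx //.
by move=> [s t] /= /eqP <-; rewrite /pcomp mulgK.
Qed.

Lemma gralg_mulA : associative gralg_mul.
Proof.
move=> x y z; apply/ffunP => g; rewrite !gralg_mulE.
under eq_bigr do rewrite gralg_mulE mulr_sumr.
under [RHS]eq_bigr do rewrite gralg_mulE mulr_suml.
rewrite [RHS]exchange_big /=; apply: eq_bigr => s _.
rewrite [RHS](reindex_inj (mulIg s)) /=; apply: eq_bigr => t _.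
by rewrite /pcomp mulgK invMg mulrA mulgA.
Qed.

Lemma gralg_mul1 : left_id (gperm 1%g) gralg_mul.
Proof.
move=> x; apply/ffunP => g; rewrite gralg_mulE (bigD1 1%g) //= big1.
  by rewrite ffunE eqxx mul1r addr0 /pcomp invg1 mulg1.
by move=> s s1; rewrite ffunE (negPf s1) mul0r.
Qed.

Lemma gralg_mulr1 : right_id (gperm 1%g) gralg_mul.
Proof.
move=> x; apply/ffunP => g; rewrite gralg_mulE (bigD1 g) //= big1.
  by rewrite ffunE /pcomp mulgV eqxx mulr1 addr0.
move=> s sg; rewrite ffunE /pcomp -eq_mulgV1 eq_sym (negPf sg).
by rewrite mulr0.
Qed.

Lemma gralg_mulDl : left_distributive gralg_mul +%R.
Proof.
move=> x y z; apply/ffunP => g; rewrite [RHS]ffunE !gralg_mulE -big_split /=.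
by apply: eq_bigr => s _; rewrite ffunE mulrDl.
Qed.

Lemma gralg_mulDr : right_distributive gralg_mul +%R.
Proof.
move=> x y z; apply/ffunP => g; rewrite [RHS]ffunE !gralg_mulE -big_split /=.
by apply: eq_bigr => s _; rewrite [X in _ * X]ffunE mulrDr.
Qed.

Lemma gperm1_neq0 : gperm 1%g != 0.
Proof. by apply/eqP => /ffunP/(_ 1%g)/eqP; rewrite !ffunE eqxx oner_eq0. Qed.

HB.instance Definition _ := GRing.Zmodule_isNzRing.Build gralg
  gralg_mulA gralg_mul1 gralg_mulr1 gralg_mulDl gralg_mulDr gperm1_neq0.

Lemma gralg_scaleAl c (x y : gralg) : c *: (x * y) = (c *: x) * y.
Proof.
apply/ffunP => g; rewrite ffunE !gralg_mulE scaler_sumr.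
by apply: eq_bigr => s _; rewrite ffunE scalerAl.
Qed.
HB.instance Definition _ :=
  GRing.Lmodule_isLalgebra.Build C gralg gralg_scaleAl.

Lemma gralg_scaleAr c (x y : gralg) : c *: (x * y) = x * (c *: y).
Proof.
apply/ffunP => g; rewrite ffunE !gralg_mulE scaler_sumr.
by apply: eq_bigr => s _; rewrite [X in _ = _ * X]ffunE scalerAr.
Qed.
HB.instance Definition _ := GRing.Lalgebra_isAlgebra.Build C gralg gralg_scaleAr.

Lemma gpermM s t : gperm (pcomp s t) = gperm s * gperm t.
Proof.
apply/ffunP => g; rewrite gralg_mulE (bigD1 s) //= big1 => [|u us].
  by rewrite !ffunE eqxx mul1r addr0 /pcomp (canF_eq (mulgK s^-1%g)) invgK.
by rewrite ffunE (negPf us) mul0r.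
Qed.

Definition jucys_murphy (k : nat) : gralg :=
  \sum_(1 <= j < k) gperm (transp N j k).

(* [v T T'] matters only for T, T' standard of the same shape. *)
Definition weight_basis (v : tableau -> tableau -> gralg) : Prop :=
  basis_of fullv [seq v p.1 p.2 | p <- std_pairs N] /\
  forall T T', std_pair N T T' -> forall k, (1 <= k <= N)%N ->
    jucys_murphy k * v T T' = (content T k)%:~R *: v T T' /\
    v T T' * jucys_murphy k = (content T' k)%:~R *: v T T'.

(* A module is given by the action [act] of C[S_N] on [U]; mirror images are
   obtained by letting [act] be the multiplication on the right. *)

Section Intertwiners.
Variables (U : vectType C) (act : gralg -> U -> U).

Definition is_intertwiner (i : nat) (f : 'End(U)) : Prop :=
  forall (x : nat -> C) (u : U),
    (forall k, (1 <= k <= N)%N -> act (jucys_murphy k) u = x k *: u) ->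
    let d := x i - x i.+1 in
    f u = if (d == 1) || (d == -1) then - 2^-1 *: u
          else ((d + 1) * (d - 1))^-1 *:
               (d *: act (gperm (simple_transp N i)) u + u).

Definition intertwiner (i : nat) : 'End(U) :=
  xget 0 [set f | is_intertwiner i f]%classic.

(* phi_k acts first, phi_(k + n - 1) last. *)
Definition jdt (n k : nat) (u : U) : U :=
  foldl (fun w i => intertwiner i w) u (iota k n).

(* jdt_(m, m + n) acts first, jdt_(1, 1 + n) last. *)
Definition rect (m n : nat) (u : U) : U :=
  foldl (fun w k => jdt n k w) u (rev (iota 1 m)).

End Intertwiners.

Definition left_act (x u : gralg) : gralg := x * u.
Definition right_act (x u : gralg) : gralg := u * x.

End GroupAlgebra.

Section Phi.
Variables (C : fieldType) (n : nat).
Local Notation m := 'C(n, 2).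
Local Notation CSN := (gralg C (m + n)).
Local Notation CSn := (gralg C n).

Variable vN : tableau -> tableau -> CSN.
Variable vn : tableau -> tableau -> CSn.

Definition weights (i : nat) : C := (2 * i)%:R - n%:R - 1.

Definition V : Type := ind_module n weights.
HB.instance Definition _ := GRing.Lmodule.on V.

Definition v_ (s : 'S_n) : V := ind_basis weights s.

Definition eta : V -> CSN :=
  xget (fun=> 0) [set f : V -> CSN | linear f /\
    forall s, f (v_ s) = vN (perm_T0 s) (perm_T0 s^-1%g)]%classic.

Definition rectify (u : CSN) : CSN :=
  rect (@right_act C (m + n)) m n (rect (@left_act C (m + n)) m n u).

Definition D_pairs : seq (tableau * tableau) :=
  [seq p <- std_pairs (m + n) | (shape p.1 == staircase n) &&
    (shape (restrict n p.1) == shape (restrict n p.2))].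

Definition D : {vspace CSN} := <<[seq vN p.1 p.2 | p <- D_pairs]>>%VS.

(* [vsproj D u] is [u] as an element of [D], for u in D. *)
Definition forget : 'Hom(subvs_of D, CSn) :=
  xget 0 [set f : 'Hom(subvs_of D, CSn) | forall A B, (A, B) \in D_pairs ->
    f (vsproj D (vN A B)) = vn (restrict n A) (restrict n B)]%classic.

Definition Phi (x : V) : CSn := forget (vsproj D (rectify (eta x))).

End Phi.

(* Main.v *)
From HB Require Import structures.
Require Import Defs.
From mathcomp Require Import all_boot all_order all_algebra all_fingroup zify.

Set Implicit Arguments.
Unset Strict Implicit.
Unset Printing Implicit Defensive.

(** The proof turns rectification into combinatorics of words and then
    recognizes row insertion in them.

    A standard tableau is encoded by its column word, the sequence of the
    columns of its entries 1, 2, ..., N, with columns counted from 0.  It is a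
    lattice word: in every prefix the heights, that is the multiplicities of
    the letters, weakly decrease.  A lattice word is determined by its contents
    ([word_content_inj]), so joint weights on both sides determine a weight
    vector of the group algebra up to a scalar.  An intertwiner phi maps an
    eigenvector to one with two consecutive weights exchanged, and phi phi is
    the scalar 1 - d^2, where d is the difference of the two weights; hence the
    image is a nonzero multiple of one basis vector as soon as d is not 1 or
    -1.  These exceptional values occur exactly when the boxes of i and i + 1
    are adjacent, and then phi-tilde is a scalar.  On column words, phi-tilde_i
    is therefore [exchange]: it swaps the letters i and i + 1 unless the
    boxes are adjacent ([intertwiner_basis]).  The two sides do not interact, so
    [rectify] acts on a pair of words by [rect_word] on each of them
    ([rectify_basis]).

    The column word of sigma T0 is that of the inner staircase, whose row with
    k boxes reads 0 1 ... k-1, followed by the one-line notation of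
    sigma^-1 ([column_word_perm_T0]).  Rectification slides the rows of
    the staircase through the outer letters, the bottom row first.  The heart of
    the proof is that sliding the row with k boxes inserts sigma(k + 1) into the
    insertion tableau of sigma(1) ... sigma(k): if s is the column word before
    the insertion and s' the one after it, then the outer word, once the letters
    of the row down to column c have been slid, is min(s, max(c, s'))
    ([slid]).  This is checked one exchange at a time
    ([slide_square]); what the check uses of row insertion is collected in the
    record [bumping].  After all rows, the first n letters form the column word
    of P(sigma), so that the first tableau restricts to P(sigma); by the
    symmetry of rectification the second one restricts to P(sigma^-1).

    That Q(sigma) = P(sigma^-1) follows from the symmetry of growth: the shape
    of the entries at most b in the insertion tableau of the first k letters
    is invariant under exchanging sigma, k with sigma^-1, b
    ([growth_symmetric]).  The remaining letters of the rectified word depend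
    on Q(sigma) alone ([rect_word_perm_T0]).  As [exchange] is an involution on
    lattice words, sigma can be recovered from P(sigma) and Q(sigma)
    ([rsk_inj]), and counting with the dimension of the group algebra shows that
    every pair of tableaux occurs ([rsk_surj]).

    It remains to see that the v_sigma form a basis of V, so that eta exists.
    Moving the Y_i to the right shows that V is spanned by the n! vectors sigma
    v ([perm_span_surj]).  On the other hand V maps to the group algebra of
    S_(m+n), where S_n permutes the last n letters, Y_i acts as X_(m+i), and v
    goes to the weight vector of (T0, T0), whose last n contents are the a_i
    ([ind_image]).  The v_sigma go to nonzero vectors with distinct joint
    weights, because 1 - (a_p - a_q)^2 never vanishes ([phi_word_image]); hence
    they are independent, and n! independent vectors in a space spanned by n!
    vectors form a basis ([transfer_span], [transfer_linear]). *)

(** * Lattice words and the exchange of consecutive letters *)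

Definition height (w : seq nat) (j : nat) : nat := count_mem j w.
Arguments height : simpl never.

Lemma height0 j : height [::] j = 0. Proof. by []. Qed.

Lemma height_cat w w' j : height (w ++ w') j = height w j + height w' j.
Proof. exact: count_cat. Qed.

Lemma height_cons x w j : height (x :: w) j = (x == j) + height w j.
Proof. by []. Qed.

Lemma height_rcons x w j : height (rcons w x) j = height w j + (x == j).
Proof. by rewrite -cats1 height_cat height_cons height0 addn0. Qed.

Definition heightE := (height0, height_cat, height_cons, height_rcons).

(** The letters h and v of two consecutive entries, after a prefix with
    heights f, are the columns of two adjacent boxes: one below the other, or
    side by side in the same row. *)
Definition frozen (f : nat -> nat) (h v : nat) : bool :=
  (h == v) || ((v == h.+1) && (f h == f v)).

(** The action of the intertwiner phi-tilde_i on the column word of a standard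
    tableau; positions in a word are counted from 0, entries from 1. *)
Definition exchange (i : nat) (w : seq nat) : seq nat :=
  if drop i.-1 w is h :: v :: g then
    if frozen (height (take i.-1 w)) h v then w
    else take i.-1 w ++ v :: h :: g
  else w.

(** These are the column words of standard tableaux: at every stage the
    columns form a Young diagram. *)
Definition lattice (w : seq nat) : Prop :=
  forall k j, height (take k w) j.+1 <= height (take k w) j.

Lemma exchange_cat f h v g :
  exchange (size f).+1 (f ++ h :: v :: g) =
  f ++ (if frozen (height f) h v then h :: v :: g else v :: h :: g).
Proof. by rewrite /exchange /= drop_size_cat // take_size_cat //; case: ifP. Qed.

Lemma exchange_cases i w :
  exchange i w = w \/
  exists f h v g, [/\ size f = i.-1, w = f ++ h :: v :: g,
    ~~ frozen (height f) h v & exchange i w = f ++ v :: h :: g].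
Proof.
rewrite /exchange; case E: (drop i.-1 w) => [|h [|v g]]; try by left.
case: ifPn => fr; [by left | right; exists (take i.-1 w), h, v, g].
rewrite -E cat_take_drop; split=> //; rewrite size_take.
by case: ltnP => // le; rewrite drop_oversize in E.
Qed.

Lemma size_exchange i w : size (exchange i w) = size w.
Proof.
case: (exchange_cases i w) => [-> // | [f [h [v [g [_ -> _ ->]]]]]].
by rewrite !size_cat.
Qed.

(** Exchanging h and h + 1 at equal heights is the only exchange that would
    leave the lattice words, and it is frozen. *)
Lemma lattice_exchange i w : lattice w -> lattice (exchange i w).
Proof.
move=> lw; case: (exchange_cases i w) => [-> // | ].
move=> [f [h [v [g [_ ew nfr ->]]]]] k j.
have [le|lt] := leqP k (size f).
  by rewrite takel_cat // -(takel_cat (h :: v :: g) le) -ew; apply: lw.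
have := lw (size f) j; have := lw (size f).+2 j; have := lw k j.
rewrite ew !take_cat ltnNge (ltnW lt) /= ltnn subnn take0 cats0.
rewrite ltnNge leqW //= subSn // subSnn /= take0 !heightE /=.
case Ek : (k - size f) => [|[|k']] /=; [lia| |by rewrite /= !heightE; lia].
rewrite /= ?take0 !heightE => _; move: nfr; rewrite /frozen.
by have [->|] := eqVneq h j; have [->|] := eqVneq v j.+1; lia.
Qed.

(** Rectification loses no information, which is how a permutation is
    recovered from its rectified word: in a lattice word h + 1 followed by h,
    exchanged, never gives a frozen pair. *)
Lemma exchangeK i w : lattice w -> exchange i (exchange i w) = w.
Proof.
move=> lw; case: (exchange_cases i w) => [E|]; first by rewrite !E.
move=> [f [h [v [g [sf ew nfr ->]]]]].
have E : (i.-1).+1 = i \/ i = 0 by lia.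
have -> : exchange i (f ++ v :: h :: g) = exchange (size f).+1 (f ++ v :: h :: g).
  by rewrite /exchange sf.
rewrite exchange_cat ew ifN //.
have := lw (size f).+1 v; rewrite ew take_cat ltnNge leqW //= subSnn /= ?take0.
rewrite !heightE /=; move: nfr; rewrite /frozen.
by have [->|] := eqVneq h v.+1; lia.
Qed.

Definition jdt_word (n k : nat) (w : seq nat) : seq nat :=
  foldl (fun w i => exchange i w) w (iota k n).

Definition rect_word (m n : nat) (w : seq nat) : seq nat :=
  foldl (fun w k => jdt_word n k w) w (rev (iota 1 m)).

Lemma foldl_inj (A B : Type) (P : A -> Prop) (f : A -> B -> A) :
  (forall b a, P a -> P (f a b)) ->
  (forall b a a', P a -> P a' -> f a b = f a' b -> a = a') ->
  forall s a a', P a -> P a' -> foldl f a s = foldl f a' s -> a = a'.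
Proof.
move=> Pf inj; elim=> [|b s IH] a a' //= Pa Pa' E.
by apply: (inj b) => //; apply: IH => //; apply: Pf.
Qed.

Lemma foldl_inv (A B : Type) (P : A -> Prop) (f : A -> B -> A) :
  (forall b a, P a -> P (f a b)) -> forall s a, P a -> P (foldl f a s).
Proof. by move=> Pf; elim=> [|b s IH] a //= Pa; apply/IH/Pf. Qed.

Lemma rect_word_inj m n w w' :
  lattice w -> lattice w' -> rect_word m n w = rect_word m n w' -> w = w'.
Proof.
apply: foldl_inj => [k|k] => [w1|w1 w2].
  by apply: foldl_inv => i w2; apply: lattice_exchange.
apply: foldl_inj => [i|i] => [w3|w3 w4]; first exact: lattice_exchange.
by move=> l3 l4 E; rewrite -(exchangeK i l3) E exchangeK.
Qed.

(** The effect of one exchange on a moving letter h that meets v: when nothing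
    is frozen, v' = v comes out on the left and h' = h moves on; a frozen pair
    stays, so the letter that moves on is v. *)
Definition square (f : nat -> nat) (h v v' h' : nat) : Prop :=
  if frozen f h v then v' = h /\ h' = v else v' = v /\ h' = h.

(** To compute a slide it is enough to guess the values h b of the moving
    letter and the outcome v', and to check every exchange on its own. *)
Lemma jdt_word_squares n pre post (h v v' : nat -> nat) :
  (forall b, b < n ->
     square (height (pre ++ mkseq v' b)) (h b) (v b) (v' b) (h b.+1)) ->
  jdt_word n (size pre).+1 (pre ++ h 0 :: mkseq v n ++ post) =
  pre ++ mkseq v' n ++ h n :: post.
Proof.
elim: n post => [|n IH] post sq //.
rewrite /jdt_word -addn1 iotaD foldl_cat /= -/(jdt_word _ _ _) !addn1.
have mkS (f : nat -> nat) : mkseq f n.+1 = mkseq f n ++ [:: f n].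
  by rewrite /mkseq -addn1 iotaD map_cat.
rewrite !mkS -!catA IH; last by move=> b lt; apply: sq; apply: leqW.
rewrite catA /= addSn.
have -> : size pre + n = size (pre ++ mkseq v' n) by rewrite size_cat size_mkseq.
rewrite exchange_cat -!catA /=.
by have := sq n (leqnn _); rewrite /square; case: ifP => _ [-> ->].
Qed.

(** * Sliding the rows of the staircase *)

Lemma mkseqS (T : Type) (f : nat -> T) b : mkseq f b.+1 = rcons (mkseq f b) (f b).
Proof. by rewrite /mkseq -addn1 iotaD map_cat cats1. Qed.

Lemma height_mkseqS s b j :
  height (mkseq s b.+1) j = height (mkseq s b) j + (s b == j).
Proof. by rewrite mkseqS height_rcons. Qed.

Lemma height_iota0 c j : height (iota 0 c) j = (j < c).
Proof. by rewrite /height count_uniq_mem ?iota_uniq // mem_iota. Qed.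

(** What sliding a row of k boxes uses about the insertion of one entry: s and
    s' are the column words before and after, in which the entries inserted
    later keep letters that exceed k. The letter k of s marks the position x
    of the new entry, and q b is the column of the box gained by the
    subtableau of the first b entries. An entry b > x sitting in that box is
    displaced to the leftmost column of the same height, which is then the new
    value of q; any other entry stays. *)
Record bumping (n k x : nat) (s s' q : nat -> nat) : Prop := Bumping {
  bump_new : x < n /\ s x = k;
  bump_newE : forall b, b < n -> s b = k -> b = x;
  bump_col : forall b, b < n -> 0 < s b < k ->
    height (mkseq s b) (s b) < height (mkseq s b) (s b).-1;
  bump_outer : forall b, b < n -> s b = k.+1 -> height (mkseq s b) k.+1 = 0;
  bump_before : forall b, b < x -> s' b = s b;
  bump_at : s' x = q x.+1 /\ q x.+1 <= k;
  bump_at_col : forall j, j <= k -> (height (mkseq s x) j == 0) = (q x.+1 <= j);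
  bump_skip : forall b, x < b < n -> s b <> q b -> s' b = s b /\ q b.+1 = q b;
  bump_hit : forall b, x < b < n -> s b = q b -> s' b = q b.+1 /\ q b.+1 <= q b;
  bump_hit_lt : forall b j, x < b < n -> s b = q b -> j < q b.+1 ->
    height (mkseq s b.+1) (q b) < height (mkseq s b.+1) j;
  bump_hit_eq : forall b j, x < b < n -> s b = q b -> q b.+1 <= j <= q b ->
    height (mkseq s b.+1) j = height (mkseq s b.+1) (q b)
}.

Section RowSlide.
Variables (n k x : nat) (s s' q : nat -> nat).
Hypothesis bmp : bumping n k x s s' q.

(** The letter of entry b once the letters of the inner row from column c on
    have been slid past it: an entry follows the moving row to the left until
    it reaches its final column s' b. *)
Definition slid (c b : nat) : nat := minn (s b) (maxn c (s' b)).
(** The value of the inner letter c when it arrives at entry b: it has been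
    caught in a frozen pair iff the box gained so far lies weakly to the left
    of column c. *)
Definition hole (c b : nat) : nat := c + ((x < b) && (q b <= c)).

Lemma bump_le b : x < b <= n -> q b <= k.
Proof.
elim: b => [|b IH] //; rewrite ltnS leq_eqVlt => /andP[/predU1P[<-|lt] ltn].
  by case: (bump_at bmp).
have le : q b <= k by apply: IH; lia.
have B : x < b < n by lia.
have [E|/eqP E] := eqVneq (s b) (q b).
  by case: (bump_hit bmp B E) => _; lia.
by case: (bump_skip bmp B E) => _ ->.
Qed.

(** Among the first b entries, the word slid to column c differs from s by a
    single box, moved from column k to column max c (q b). *)
Lemma height_slid c b j : c <= k -> b <= n ->
  height (mkseq (slid c) b) j + ((x < b) && (k == j)) =
  height (mkseq s b) j + ((x < b) && (maxn c (q b) == j)).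
Proof.
move=> lec; elim: b => [|b IH] // ltn; have {}IH := IH (ltnW ltn).
rewrite !height_mkseqS; have Es : slid c b = minn (s b) (maxn c (s' b)) by [].
case: (ltngtP b x) => [lt|gt|Eb].
- by have := bump_before bmp lt; lia.
- have B : x < b < n by lia.
  have le : q b <= k by apply: bump_le; lia.
  have nk : s b <> k by move=> /(bump_newE bmp ltn); lia.
  have [E|/eqP E] := eqVneq (s b) (q b).
    have [E' le'] := bump_hit bmp B E.
    move: IH; rewrite gt ltnS (ltnW gt) /= Es E E'.
    have [leQ|/ltnW leQ] := leqP (q b) c.
      by rewrite (maxn_idPl (leq_trans le' leQ)) (minn_idPl leQ); lia.
    have -> : minn (q b) (maxn c (q b.+1)) = maxn c (q b.+1) by lia.
    by lia.
  by have [? ->] := bump_skip bmp B E; lia.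
- by subst b; have [? ?] := bump_at bmp; have [? ?] := bump_new bmp; lia.
Qed.

Lemma square_swap f h v : ~ (v = h.+1 /\ f h = f v) -> square f h v v h.
Proof.
move=> nE; rewrite /square /frozen; case: ifP => // /orP[/eqP-> //|].
by case/andP=> /eqP ? /eqP ?; case: nE.
Qed.

Lemma square_stay (f : nat -> nat) h : f h = f h.+1 -> square f h h.+1 h h.+1.
Proof. by move=> E; rewrite /square /frozen E !eqxx orbT. Qed.

(** Below x nothing has changed; x or a displaced entry moves from column c +
    1 to c exactly when c lies between its new and its old column, and then
    the columns c and c + 1 have equal heights, so that the pair is frozen; in
    all the other cases some strict inequality of heights excludes this. *)
Lemma slide_square (pre : seq nat) c b :
  (forall j, j <= k -> height pre j = height pre k) ->
  (forall b, b < n -> s b = k.+1 -> height pre k.+1 < height pre k) ->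
  c < k -> b < n ->
  square (height ((pre ++ iota 0 c) ++ mkseq (slid c) b))
    (hole c b) (slid c.+1 b) (slid c b) (hole c b.+1).
Proof.
move=> prek prek1 ltc ltb; set w := _ ++ mkseq _ _.
have fE j : height w j + ((x < b) && (k == j)) = height pre j + (j < c) +
    (height (mkseq s b) j + ((x < b) && (maxn c (q b) == j))).
  by rewrite -(height_slid j (ltnW ltc) (ltnW ltb)) !height_cat height_iota0 addnA.
have pc := prek c (ltnW ltc); have pc1 := prek c.+1 ltc.
have fc := fE c; have fc1 := fE c.+1.
have [ltxn sx] := bump_new bmp.
have col := bump_col bmp ltb.
case: (ltngtP b x) => [lt|gt|Eb].
- have nk : s b <> k by move=> /(bump_newE bmp ltb); lia.
  have E := bump_before bmp lt.
  have -> : slid c.+1 b = s b by rewrite /slid; lia.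
  have -> : slid c b = s b by rewrite /slid; lia.
  have -> : hole c b = c by rewrite /hole; lia.
  have -> : hole c b.+1 = c by rewrite /hole; lia.
  by apply: square_swap => -[Es]; rewrite Es /= in col *; lia.
- have B : x < b < n by lia.
  have le : q b <= k by apply: bump_le; lia.
  have nk : s b <> k by move=> /(bump_newE bmp ltb); lia.
  have [E|/eqP E] := eqVneq (s b) (q b).
    (* a displaced entry: c is weakly to the right of its old column, between
       the old and the new one, or to the left of the new one *)
    have [Es' leq'] := bump_hit bmp B E.
    have hlt j := @bump_hit_lt _ _ _ _ _ _ bmp b j B E.
    have heq j := @bump_hit_eq _ _ _ _ _ _ bmp b j B E.
    have [leQ|ltQ] := leqP (q b) c.
      have -> : slid c.+1 b = s b by rewrite /slid; lia.
      have -> : slid c b = s b by rewrite /slid; lia.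
      have -> : hole c b = c.+1 by rewrite /hole; lia.
      have -> : hole c b.+1 = c.+1 by rewrite /hole; lia.
      by apply: square_swap => -[Es]; lia.
    have [le'|lt'] := leqP (q b.+1) c.
      have -> : slid c.+1 b = c.+1 by rewrite /slid; lia.
      have -> : slid c b = c by rewrite /slid; lia.
      have -> : hole c b = c by rewrite /hole; lia.
      have -> : hole c b.+1 = c.+1 by rewrite /hole; lia.
      apply: square_stay.
      have := heq c; have := heq c.+1; rewrite !(height_mkseqS s b c.+1).
      by rewrite (height_mkseqS s b c); lia.
    have -> : slid c.+1 b = q b.+1 by rewrite /slid; lia.
    have -> : slid c b = q b.+1 by rewrite /slid; lia.
    have -> : hole c b = c by rewrite /hole; lia.
    have -> : hole c b.+1 = c by rewrite /hole; lia.
    apply: square_swap => -[Eq]; rewrite Eq.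
    have := hlt c; have := heq c.+1; rewrite !(height_mkseqS s b c.+1).
    by rewrite (height_mkseqS s b c); lia.
  have [Es' Eq'] := bump_skip bmp B E.
  have -> : slid c.+1 b = s b by rewrite /slid; lia.
  have -> : slid c b = s b by rewrite /slid; lia.
  have -> : hole c b.+1 = hole c b by rewrite /hole Eq'; lia.
  apply: square_swap => -[].
  have [leQ|ltQ] := leqP (q b) c.
    have -> : hole c b = c.+1 by rewrite /hole; lia.
    (* the letter c + 2 may be k + 1, whose column is lower in the rows above *)
    move=> Es; rewrite Es; have fc2 := fE c.+2.
    have [Ek|nEk] := eqVneq c.+1 k.
      have hk : 0 < height (mkseq s b) k.
        by rewrite -has_count has_pred1 -sx map_f // mem_iota.
      rewrite -Ek in prek1 hk; have := prek1 _ ltb Es.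
      have := bump_outer bmp ltb; rewrite -Ek Es => /(_ erefl).
      by lia.
    by rewrite Es /= in col; have := prek c.+2; lia.
  have -> : hole c b = c by rewrite /hole; lia.
  by move=> Es; rewrite Es /= in col *; lia.
- (* the new entry moves left to the first column without smaller entries *)
  subst b; have [E' le] := bump_at bmp.
  have := bump_at_col bmp (ltnW ltc); have := bump_at_col bmp ltc.
  have -> : hole c x = c by rewrite /hole; lia.
  have [leQ|ltQ] := leqP (q x.+1) c.
    have -> : slid c.+1 x = c.+1 by rewrite /slid; lia.
    have -> : slid c x = c by rewrite /slid; lia.
    have -> : hole c x.+1 = c.+1 by rewrite /hole; lia.
    by move=> z1 z2; apply: square_stay; lia.
  have -> : slid c.+1 x = q x.+1 by rewrite /slid; lia.
  have -> : slid c x = q x.+1 by rewrite /slid; lia.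
  have -> : hole c x.+1 = c by rewrite /hole; lia.
  by move=> z1 z2; apply: square_swap => -[Eq]; rewrite Eq in z1 z2 *; lia.
Qed.

End RowSlide.

(** The last letter of the row slides first: it changes the outer word from
    slid (c + 1) to slid c, and arrives behind it as hole c n. *)
Lemma slide_row n k x s s' q (pre post : seq nat) c :
  bumping n k x s s' q ->
  (forall j, j <= k -> height pre j = height pre k) ->
  (forall b, b < n -> s b = k.+1 -> height pre k.+1 < height pre k) ->
  c <= k ->
  foldl (fun w i => jdt_word n i w)
    (pre ++ iota 0 c ++ mkseq (slid s s' c) n ++ post)
    (rev (iota (size pre).+1 c)) =
  pre ++ mkseq (slid s s' 0) n ++ mkseq (fun c' => hole x q c' n) c ++ post.
Proof.
move=> bmp prek prek1; elim: c post => [|c IH] post ltc; first by [].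
have sq := @slide_square _ _ _ _ _ _ bmp pre c _ prek prek1 ltc.
have := jdt_word_squares post sq.
rewrite size_cat size_iota {1}/hole addn0 -!catA => E.
have iotaSr a : iota a c.+1 = iota a c ++ [:: a + c] by rewrite -addn1 iotaD.
rewrite !iotaSr rev_cat foldl_cat [foldl _ _ (rev [:: _])]/= add0n -catA addSn.
rewrite E IH ?(ltnW ltc) //.
by rewrite mkseqS -cats1 -catA.
Qed.

Lemma slid_full n k x s s' q :
  bumping n k x s s' q -> forall b, b < n -> slid s s' k b = s b.
Proof.
move=> bmp b ltb; rewrite /slid; have [ltx Ex] := bump_new bmp.
have [lt|gt|Eb] := ltngtP b x; last by subst b; lia.
  by rewrite (bump_before bmp lt); lia.
have B : x < b < n by rewrite gt.
have le : q b <= k by apply: (bump_le bmp); lia.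
have [E|/eqP E] := eqVneq (s b) (q b); first by lia.
by have [-> _] := bump_skip bmp B E; lia.
Qed.

Lemma slid_0 n k x s s' q :
  bumping n k x s s' q -> forall b, b < n -> slid s s' 0 b = s' b.
Proof.
move=> bmp b ltb; rewrite /slid max0n; have [ltx Ex] := bump_new bmp.
have [lt|gt|Eb] := ltngtP b x.
- by rewrite (bump_before bmp lt) minnn.
- have B : x < b < n by rewrite gt.
  have [E|/eqP E] := eqVneq (s b) (q b).
    by have [-> le] := bump_hit bmp B E; lia.
  by have [-> _] := bump_skip bmp B E; rewrite minnn.
- by subst b; have [-> le] := bump_at bmp; lia.
Qed.

(** The column word of a staircase filled row by row. *)
Fixpoint stair_word (k : nat) : seq nat :=
  if k is k'.+1 then iota 0 k ++ stair_word k' else [::].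

(** The letters that an inner row of k boxes leaves behind, if its slide adds
    a box in column r to the outer tableau: they only depend on r. *)
Definition vacated (r k : nat) : seq nat := mkseq (fun c => c + (r <= c)) k.

Fixpoint vacated_word (r : nat -> nat) (k : nat) : seq nat :=
  if k is k'.+1 then vacated (r k) k ++ vacated_word r k' else [::].

Lemma eq_mkseq_in (T : Type) (f g : nat -> T) n :
  (forall b, b < n -> f b = g b) -> mkseq f n = mkseq g n.
Proof. by move=> E; apply/eq_in_map => b; rewrite mem_iota => /E. Qed.

(** The rows are slid from the bottom one, which has one box; the row with k
    boxes performs the step from s k to s (k + 1). The hypotheses on pre hold
    for the rows above it: they all cover the columns up to k, and the one
    just above does not reach column k + 1. *)
Lemma slide_rows n (x : nat -> nat) (s q : nat -> nat -> nat) pre post k :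
  (forall k, k < n -> bumping n k (x k) (s k) (s k.+1) (q k)) -> k < n ->
  (forall j, j <= k -> height pre j = height pre k) ->
  (forall b, b < n -> s k b = k.+1 -> height pre k.+1 < height pre k) ->
  foldl (fun w i => jdt_word n i w) (pre ++ stair_word k ++ mkseq (s 0) n ++ post)
    (rev (iota (size pre).+1 (size (stair_word k)))) =
  pre ++ mkseq (s k.+1) n ++ vacated_word (fun k => q k n) k ++ post.
Proof.
move=> bmp; elim: k pre post => [|k IH] pre post ltk prek prek1.
  have b0 := bmp 0 ltk.
  by rewrite -(eq_mkseq_in (slid_full b0)) (eq_mkseq_in (slid_0 b0)).
rewrite -[stair_word k.+1]/(iota 0 k.+1 ++ stair_word k).
rewrite -[vacated_word _ _]/(vacated (q k.+1 n) k.+1 ++ vacated_word _ k) -!catA catA.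
have -> : rev (iota (size pre).+1 (size (iota 0 k.+1 ++ stair_word k))) =
    rev (iota (size (pre ++ iota 0 k.+1)).+1 (size (stair_word k))) ++
    rev (iota (size pre).+1 k.+1).
  by rewrite size_cat size_iota iotaD rev_cat size_cat size_iota addSn.
rewrite foldl_cat IH; first last.
- move=> b _ _; rewrite !height_cat !height_iota0 ltnn ltnSn.
  by have := prek k; lia.
- move=> j lej; rewrite !height_cat !height_iota0 (prek j (leqW lej)).
  by rewrite (prek k) // ltnS lej ltnSn.
- exact: ltnW.
have bk := bmp _ ltk.
rewrite -catA -(eq_mkseq_in (slid_full bk)) (slide_row _ bk) //.
rewrite (eq_mkseq_in (slid_0 bk)); congr (_ ++ (_ ++ (_ ++ _))).
apply: eq_mkseq_in => c _; rewrite /hole; have [-> _] := bump_new bk.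
by [].
Qed.

Lemma rect_word_staircase n (x : nat -> nat) (s q : nat -> nat -> nat) :
  (forall k, k < n -> bumping n k (x k) (s k) (s k.+1) (q k)) ->
  (forall k b, k < n -> b < n -> s k b < n) -> 0 < n ->
  rect_word (size (stair_word n.-1)) n (stair_word n.-1 ++ mkseq (s 0) n) =
  mkseq (s n) n ++ vacated_word (fun k => q k n) n.-1.
Proof.
move=> bmp sn n0; have := @slide_rows n x s q [::] [::] n.-1 bmp.
rewrite !cats0 prednK //; apply=> // b ltb E.
by have := sn n.-1 b; rewrite E prednK // ltnn; lia.
Qed.

(** * Row insertion and bounded column heights *)

Lemma row_aboveP r1 r2 :
  reflect (size r2 <= size r1 /\ forall j, j < size r2 -> nth 0 r1 j < nth 0 r2 j)
          (row_above r1 r2).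
Proof.
apply: (iffP andP) => -[le lt]; split=> //.
  by move=> j ltj; apply: (allP lt); rewrite mem_iota.
by apply/allP => j; rewrite mem_iota => /andP[_ /lt].
Qed.

Lemma row_above_trans : transitive row_above.
Proof.
move=> r2 r1 r3 /row_aboveP[le12 lt12] /row_aboveP[le23 lt23].
apply/row_aboveP; split=> [|j ltj]; first exact: leq_trans le12.
by apply: ltn_trans (lt23 j ltj); apply: lt12; apply: leq_trans le23.
Qed.

(** Standardness without the requirement that the entries be 1, ..., N: this
    is what the tail of a tableau and the intermediate insertion tableaux
    satisfy. *)
Definition tab (T : tableau) : bool :=
  [&& uniq (flatten T), [::] \notin T, all (sorted ltn) T & sorted row_above T].

Lemma standard_tab N T : standard N T -> tab T.
Proof.
case/and4P=> permT nilT sortT colT; apply/and4P; split=> //.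
by rewrite (perm_uniq permT) iota_uniq.
Qed.

Lemma tab_cons row T : tab (row :: T) ->
  [/\ row != [::], sorted ltn row, all (row_above row) T,
      forall z, z \in row -> z \notin flatten T & tab T].
Proof.
rewrite /tab /= cat_uniq inE negb_or => /and4P[/and3P[u1 dis u2]].
move=> /andP[r0 nilT] /andP[srow sT] pT; split=> //.
- by rewrite eq_sym.
- exact: order_path_min row_above_trans pT.
- by move=> z zr; apply: contra dis => zT; apply/hasP; exists z.
- by rewrite u2 nilT sT (path_sorted pT).
Qed.

Definition entry_col (T : tableau) (k : nat) : nat :=
  index k (nth [::] T (find (fun row => k \in row) T)).

Lemma entry_col_cons row T k :
  entry_col (row :: T) k = if k \in row then index k row else entry_col T k.
Proof. by rewrite /entry_col /=; case: ifP. Qed.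

Definition column_height (b : nat) (T : tableau) (j : nat) : nat :=
  count (fun row => (j < size row) && (nth 0 row j <= b)) T.

Arguments column_height : simpl never.

Lemma column_height_cons b row T j : column_height b (row :: T) j =
  ((j < size row) && (nth 0 row j <= b)) + column_height b T j.
Proof. by []. Qed.

Definition bump_pos (x : nat) (row : seq nat) : nat :=
  find (fun y => x < y) row.

(** The column of the box gained by the subtableau of entries at most b when x
    is inserted: an entry larger than b that gets bumped is no longer seen. *)
Fixpoint new_col (b x : nat) (T : tableau) : nat :=
  if T is row :: T' then
    let p := bump_pos x row in
    if (p < size row) && (nth 0 row p <= b) then new_col b (nth 0 row p) T'
    else p
  else 0.

Lemma insert_cons x row T : insert x (row :: T) =
  if bump_pos x row < size row
  then set_nth 0 row (bump_pos x row) x :: insert (nth 0 row (bump_pos x row)) T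
  else rcons row x :: T.
Proof. by []. Qed.

Lemma sorted_row_nth row i j : sorted ltn row -> i < j -> j < size row ->
  nth 0 row i < nth 0 row j.
Proof.
by move=> srow ij ltj; apply: (sorted_ltn_nth ltn_trans) => //; rewrite inE; lia.
Qed.

Lemma sorted_row_leq row i j : sorted ltn row -> i <= j -> j < size row ->
  nth 0 row i <= nth 0 row j.
Proof.
move=> srow; rewrite leq_eqVlt => /predU1P[->//|lt] ltj.
by rewrite ltnW // sorted_row_nth.
Qed.

Lemma sorted_row_uniq row : sorted ltn row -> uniq row.
Proof. exact: (sorted_uniq ltn_trans ltnn). Qed.

Lemma bump_pos_le x row : bump_pos x row <= size row.
Proof. exact: find_size. Qed.

Lemma bump_pos_lt x row i : x \notin row -> i < bump_pos x row -> nth 0 row i < x.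
Proof.
move=> xr lti; have := before_find 0 lti; have lt := leq_trans lti (bump_pos_le x row).
have : nth 0 row i != x by apply: contraNneq xr => <-; rewrite mem_nth.
by lia.
Qed.

Lemma bump_pos_gt x row : bump_pos x row < size row -> x < nth 0 row (bump_pos x row).
Proof. by move=> lt; apply: (@nth_find _ _ (fun y => x < y)); rewrite has_find. Qed.

Lemma bump_pos_ge x row i :
  sorted ltn row -> bump_pos x row <= i -> i < size row -> x < nth 0 row i.
Proof.
move=> srow le lt; apply: leq_trans (bump_pos_gt _) (sorted_row_leq _ le _) => //.
exact: leq_ltn_trans lt.
Qed.

Lemma sorted_rowP row :
  reflect (forall i, i.+1 < size row -> nth 0 row i < nth 0 row i.+1)
          (sorted ltn row).
Proof. exact: sortedP. Qed.

Lemma size_set_row row p x : p < size row -> size (set_nth 0 row p x) = size row.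
Proof. by move=> lt; rewrite size_set_nth; apply/maxn_idPr. Qed.

Lemma sorted_replace x row : sorted ltn row -> x \notin row ->
  bump_pos x row < size row -> sorted ltn (set_nth 0 row (bump_pos x row) x).
Proof.
move=> srow xr lt; apply/sorted_rowP => i; rewrite size_set_row // => lti.
rewrite !nth_set_nth /=; case: eqP => [E|_]; case: eqP => [E'|_].
- by lia.
- by apply: (bump_pos_ge srow) => //; lia.
- by apply: bump_pos_lt => //; lia.
- by apply: sorted_row_nth.
Qed.

Lemma sorted_append x row : sorted ltn row -> x \notin row ->
  size row <= bump_pos x row -> sorted ltn (rcons row x).
Proof.
move=> srow xr le; apply/sorted_rowP => i; rewrite size_rcons ltnS => lti.
rewrite !nth_rcons lti; case: (ltngtP i.+1 (size row)) => [lti1|gt|E].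
- exact: sorted_row_nth.
- by lia.
- by apply: bump_pos_lt => //; lia.
Qed.

Lemma perm_set_nth row p x : p < size row ->
  perm_eq (nth 0 row p :: set_nth 0 row p x) (x :: row).
Proof.
move=> lt; rewrite set_nthE lt.
have E : row = take p row ++ nth 0 row p :: drop p.+1 row.
  by rewrite -drop_nth // cat_take_drop.
apply: (@perm_trans _ (x :: (take p row ++ nth 0 row p :: drop p.+1 row))).
  by apply/seq.permP => a; rewrite /= !count_cat /=; lia.
by rewrite -E.
Qed.

Lemma perm_insert x T : perm_eq (flatten (insert x T)) (x :: flatten T).
Proof.
elim: T x => [|row T IH] x //; rewrite insert_cons; case: ifP => lt /=.
  have /seq.permP E1 := perm_set_nth x lt.
  have /seq.permP E2 := IH (nth 0 row (bump_pos x row)).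
  apply/seq.permP => a; rewrite /= !count_cat E2 /=.
  by have := E1 a => /=; lia.
by rewrite -cat_cons perm_cat2r perm_rcons.
Qed.

Lemma uniq_insert x T :
  uniq (flatten (insert x T)) = (x \notin flatten T) && uniq (flatten T).
Proof. exact: perm_uniq (perm_insert x T). Qed.

Lemma head_insert x T :
  head [::] (insert x T) =
  let row := head [::] T in
  if bump_pos x row < size row then set_nth 0 row (bump_pos x row) x
  else rcons row x.
Proof. by case: T => [|row T] //; rewrite insert_cons /=; case: ifP. Qed.

Lemma path_row_above row T :
  path row_above row T = row_above row (head [::] T) && sorted row_above T.
Proof. by case: T => [|r T] //=; rewrite andbT /row_above. Qed.

Lemma row_above_nil row : row_above row [::].
Proof. by rewrite /row_above. Qed.

Lemma all_row_above_head row T : all (row_above row) T -> row_above row (head [::] T).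
Proof. by case: T => [_|r T /andP[]] //; exact: row_above_nil. Qed.

(** Bumping paths move weakly to the left. *)
Lemma bump_pos_below row r p : row_above row r -> p < size row ->
  bump_pos (nth 0 row p) r <= p.
Proof.
move=> /row_aboveP[le lt] ltp; rewrite leqNgt; apply/negP => ltb.
have ltr : p < size r by apply: leq_trans ltb (bump_pos_le _ _).
by have := before_find 0 ltb; rewrite lt.
Qed.

Lemma tab_insert x T : tab T -> x \notin flatten T -> tab (insert x T).
Proof.
elim: T x => [|row T IH] x tT; first by [].
have [r0 srow above dis tT'] := tab_cons tT.
rewrite /= mem_cat negb_or => /andP[xr xT].
have uI : uniq (flatten (insert x (row :: T))).
  rewrite uniq_insert; case/and4P: tT => -> _ _ _.
  by rewrite /= mem_cat negb_or xr xT.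
have h2 := all_row_above_head above; have /row_aboveP[le2 lt2] := h2.
move: uI; rewrite insert_cons; case: ifPn => [lt|]; last rewrite -leqNgt => le.
- move=> uI; set p := bump_pos x row in lt uI *; set y := nth 0 row p.
  have yT : y \notin flatten T by apply: dis; rewrite mem_nth.
  have /and4P[_ nilI sI cI] := IH y tT' yT.
  apply/and4P; split=> //=.
  + rewrite inE negb_or nilI andbT; apply: contraNneq r0 => E.
    by rewrite -size_eq0 -(size_set_row x lt) -E.
  + by rewrite sorted_replace.
  rewrite path_row_above cI andbT head_insert /=.
  have lep := bump_pos_below h2 lt; rewrite -/y in lep.
  have row'le j : nth 0 (set_nth 0 row p x) j <= nth 0 row j.
    rewrite nth_set_nth /=; case: eqP => // ->; exact/ltnW/bump_pos_gt.
  have row'lt : nth 0 (set_nth 0 row p x) (bump_pos y (head [::] T)) < y.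
    rewrite nth_set_nth /=; case: eqP => [_|ne]; first exact: bump_pos_gt.
    by apply: sorted_row_nth => //; rewrite ltn_neqAle lep andbT; apply/eqP.
  case: ifPn => [lt'|]; last rewrite -leqNgt => le'; apply/row_aboveP.
    rewrite !size_set_row //; split=> // j ltj; rewrite [X in _ < X]nth_set_nth /=.
    by case: eqP => [->//|_]; apply: leq_ltn_trans (row'le _) (lt2 _ _).
  rewrite size_rcons size_set_row //.
  split=> [|j]; first exact: leq_ltn_trans (leq_trans le' lep) lt.
  rewrite ltnS leq_eqVlt nth_rcons => /predU1P[->|ltj].
    rewrite ltnn eqxx; suff /eqP-> : size (head [::] T) == bump_pos y (head [::] T) by [].
    by rewrite eqn_leq le' bump_pos_le.
  by rewrite ltj; apply: leq_ltn_trans (row'le _) (lt2 _ _).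
- move=> uI; case/and4P: tT' => _ nilT sT cT; apply/and4P; split=> //=.
  + by rewrite inE negb_or nilT andbT; case: (row).
  + by rewrite sorted_append.
  rewrite path_row_above cT andbT; apply/row_aboveP; rewrite size_rcons; split.
    exact: leqW.
  by move=> j ltj; rewrite nth_rcons (leq_trans ltj le2) lt2.
Qed.

Lemma column_height_above b row T j :
  all (row_above row) T -> (j < size row -> b <= nth 0 row j) ->
  column_height b T j = 0.
Proof.
move=> /allP above bj; apply/eqP; rewrite -leqn0 leqNgt -has_count.
apply/hasP => -[r /above/row_aboveP[le lt] /andP[ltj leb]].
have := leq_trans (lt j ltj) leb; rewrite ltnNge bj //.
exact: leq_trans ltj le.
Qed.

(** In the first row the entries at most b come first. *)
Lemma column_height_eq0 b T j : tab T ->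
  (column_height b T j == 0) = (bump_pos b (head [::] T) <= j).
Proof.
case: T => [|row T] // tT; have [r0 srow above dis tT'] := tab_cons tT.
rewrite column_height_cons addn_eq0 /=; have [le|lt] := leqP (bump_pos b row) j.
  have E : j < size row -> b < nth 0 row j by apply: bump_pos_ge.
  rewrite (column_height_above above) => [|/E/ltnW //]; rewrite andbT eqb0.
  by apply/negP => /andP[/E]; rewrite ltnNge => /negP.
rewrite (leq_trans lt (bump_pos_le _ _)) /=.
by have /= := before_find 0 lt; rewrite ltnNge => /negbFE ->.
Qed.

Lemma column_heightS b T j : tab T -> column_height b.+1 T j =
  column_height b T j + ((b.+1 \in flatten T) && (entry_col T b.+1 == j)).
Proof.
elim: T => [|row T IH] // tT; have [r0 srow above dis tT'] := tab_cons tT.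
rewrite !column_height_cons IH // entry_col_cons /= mem_cat.
have -> : (j < size row) && (nth 0 row j <= b.+1) =
    (j < size row) && (nth 0 row j <= b) +
    ((b.+1 \in row) && (index b.+1 row == j)) :> nat.
  have [ltj|lej] := ltnP j (size row); last first.
    rewrite /=; case: (boolP (b.+1 \in row)) => //=; rewrite -index_mem => ltb.
    by rewrite ltn_eqF // (leq_trans ltb lej).
  rewrite /= leq_eqVlt ltnS; have [E|ne] := eqVneq (nth 0 row j) b.+1.
    by rewrite [in X in X <= b]E ltnn -E mem_nth // index_uniq ?eqxx ?sorted_row_uniq.
  suff -> : (b.+1 \in row) && (index b.+1 row == j) = false by rewrite addn0.
  by apply/andP => -[br /eqP E]; rewrite -E nth_index ?eqxx in ne.
case: (boolP (b.+1 \in row)) => [/dis/negPf -> |_]; first by rewrite addn0 addnAC.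
by rewrite addn0 addnA.
Qed.

Lemma new_col_bump b x T : b <= x -> new_col b x T = bump_pos x (head [::] T).
Proof.
case: T => [|row T] //= le; case: ifP => // /andP[/bump_pos_gt lt le'].
by have := leq_trans lt (leq_trans le' le); rewrite ltnn.
Qed.

Lemma new_col_notin b x T : b.+1 \notin flatten T -> new_col b.+1 x T = new_col b x T.
Proof.
elim: T x => [|row T IH] x //=; rewrite mem_cat negb_or => /andP[br /IH E].
rewrite E; case: (ltnP (bump_pos x row) (size row)) => //= lt.
rewrite leq_eqVlt ltnS; case: eqP => // Eb.
by rewrite -Eb mem_nth in br.
Qed.

Lemma new_col_le b x T : tab T -> new_col b x T <= bump_pos x (head [::] T).
Proof.
elim: T x => [|row T IH] x // tT; have [r0 srow above dis tT'] := tab_cons tT.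
rewrite /=; case: ifP => // /andP[lt _]; apply: leq_trans (IH _ tT') _.
exact: bump_pos_below (all_row_above_head above) lt.
Qed.

Lemma column_height_insert b x T j : tab T -> x \notin flatten T ->
  column_height b (insert x T) j =
  column_height b T j + ((x <= b) && (new_col b x T == j)).
Proof.
elim: T x => [|row T IH] x.
  move=> _ _; rewrite /column_height /= addn0 add0n.
  by case: j => [|j] /=; rewrite ?andbT ?andbF.
move=> tT; have [r0 srow above dis tT'] := tab_cons tT.
rewrite /= mem_cat negb_or -/(bump_pos x row) => /andP[xr xT].
case: ifPn => [lt|]; last rewrite -leqNgt => le; rewrite !column_height_cons /=.
  have yT : nth 0 row (bump_pos x row) \notin flatten T by apply: dis; rewrite mem_nth.
  rewrite IH // size_set_row // nth_set_nth /=.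
  have [->|nej] := eqVneq j (bump_pos x row).
    rewrite lt /=; have xy := bump_pos_gt lt.
    case: (leqP (nth 0 row (bump_pos x row)) b) => [le|_] /=.
      by rewrite (ltnW (leq_trans xy le)) /= addnA.
    by rewrite eqxx andbT addn0 addnC.
  rewrite addnA; congr (_ + _).
  case: (leqP (nth 0 row (bump_pos x row)) b) => [le|_] /=.
    by rewrite (ltnW (leq_trans (bump_pos_gt lt) le)).
  by rewrite [_ == j]eq_sym (negPf nej) andbF.
have E : bump_pos x row = size row by apply/eqP; rewrite eqn_leq le bump_pos_le.
rewrite E size_rcons nth_rcons addnAC; congr (_ + _); rewrite ltnS leq_eqVlt.
have [->|nej] := eqVneq j (size row); first by rewrite ltnn /= andbT.
by rewrite andbF addn0 /=; case: ltnP.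
Qed.

Lemma col_insert_new x T : tab T -> x \notin flatten T ->
  entry_col (insert x T) x = bump_pos x (head [::] T).
Proof.
case: T => [|row T]; first by rewrite entry_col_cons inE eqxx /= eqxx.
move=> tT; have [r0 srow above dis tT'] := tab_cons tT.
rewrite /= mem_cat negb_or -/(bump_pos x row) => /andP[xr xT].
case: ifPn => [lt|]; last rewrite -leqNgt => le; rewrite entry_col_cons.
  have E : nth 0 (set_nth 0 row (bump_pos x row) x) (bump_pos x row) = x.
    by rewrite nth_set_nth /= eqxx.
  have lt' : bump_pos x row < size (set_nth 0 row (bump_pos x row) x).
    by rewrite size_set_row.
  have -> : x \in set_nth 0 row (bump_pos x row) x by rewrite -[X in X \in _]E mem_nth.
  rewrite -[X in index X _]E index_uniq //.
  exact/sorted_row_uniq/sorted_replace.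
rewrite mem_rcons inE eqxx -cats1 index_cat (negPf xr) /= eqxx addn0.
by apply/eqP; rewrite eqn_leq le bump_pos_le.
Qed.

Lemma index_replace row p x z : uniq row -> p < size row -> x \notin row ->
  z != x -> z != nth 0 row p ->
  (z \in set_nth 0 row p x) = (z \in row) /\
  (z \in row -> index z (set_nth 0 row p x) = index z row).
Proof.
move=> urow lt xr zx zy; rewrite set_nthE lt.
have E : row = take p row ++ nth 0 row p :: drop p.+1 row.
  by rewrite -drop_nth // cat_take_drop.
split=> [|zr].
  by rewrite [in RHS]E !mem_cat !inE (negPf zx) (negPf zy).
rewrite [in RHS]E !index_cat /= [x == z]eq_sym (negPf zx).
by rewrite [_ == z]eq_sym (negPf zy).
Qed.

(** Bumped entries only get larger, so the bumping path never meets an entry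
    below the inserted one. *)
Lemma col_insert_lt x z T : tab T -> x \notin flatten T ->
  z \in flatten T -> z < x -> entry_col (insert x T) z = entry_col T z.
Proof.
elim: T x => [|row T IH] x //.
move=> tT; have [r0 srow above dis tT'] := tab_cons tT.
rewrite /= !mem_cat negb_or -/(bump_pos x row) => /andP[xr xT] zT lt.
have zx : z != x by rewrite neq_ltn lt.
case: ifPn => [ltp|]; last rewrite -leqNgt => le; rewrite !entry_col_cons.
  have xy := bump_pos_gt ltp; set y := nth 0 row _ in xy *.
  have zy : z != y by rewrite neq_ltn (ltn_trans lt xy).
  have yT : y \notin flatten T by apply: dis; rewrite mem_nth.
  have [-> Ei] := index_replace (sorted_row_uniq srow) ltp xr zx zy.
  move: zT; case: (boolP (z \in row)) => [/Ei //|_ /= zT].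
  by rewrite IH // (ltn_trans lt xy).
rewrite mem_rcons inE (negPf zx) /= -cats1 index_cat.
by case: (boolP (z \in row)).
Qed.

Lemma col_nth_lt row T z : all (row_above row) T -> z \in flatten T ->
  z \notin row -> entry_col T z < size row /\ nth 0 row (entry_col T z) < z.
Proof.
elim: T => [|r T IH] //= /andP[/row_aboveP[le lt] above] zT zr.
rewrite entry_col_cons; move: zT; rewrite mem_cat; case: (boolP (z \in r)) => [zr' _|_ /= zT].
  have lti : index z r < size r by rewrite index_mem.
  split; first exact: leq_trans lti le.
  by rewrite -[X in _ < X](nth_index 0 zr') lt.
exact: IH.
Qed.

Lemma bump_pos_index x z row : x \notin row -> z \in row -> x < z ->
  bump_pos x row <= index z row.
Proof.
move=> xr zr xz; rewrite leqNgt; apply/negP => /(bump_pos_lt xr).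
by rewrite nth_index // ltnNge ltnW.
Qed.

(** The entry b + 1 moves iff it sits in the box gained by the smaller
    entries. It is then the last entry bumped among those at most b + 1, and
    it goes to the next row: to the leftmost column whose height equals that
    of the column it leaves. *)
Lemma col_insert_gt x b T : tab T -> x \notin flatten T ->
  b.+1 \in flatten T -> x < b.+1 ->
  if entry_col T b.+1 == new_col b x T then
    [/\ entry_col (insert x T) b.+1 = new_col b.+1 x T,
        new_col b.+1 x T <= new_col b x T,
        forall j, j < new_col b.+1 x T ->
          column_height b.+1 T (new_col b x T) < column_height b.+1 T j &
        forall j, new_col b.+1 x T <= j <= new_col b x T ->
          column_height b.+1 T j = column_height b.+1 T (new_col b x T)]
  else entry_col (insert x T) b.+1 = entry_col T b.+1 /\
    new_col b.+1 x T = new_col b x T.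
Proof.
elim: T x => [|row T IH] x //.
move=> tT; have [r0 srow above dis tT'] := tab_cons tT.
have urow := sorted_row_uniq srow; have head_above := all_row_above_head above.
rewrite /= !mem_cat negb_or -/(bump_pos x row) => /andP[xr xT] zT xz.
have zx : b.+1 != x by rewrite neq_ltn xz orbT.
case: (ltnP (bump_pos x row) (size row)) => [ltp|le]; rewrite !entry_col_cons /=;
  last first.
  (* [x] is appended to the first row *)
  have zr : b.+1 \notin row.
    apply/negP => zr; have := leq_trans le (bump_pos_index xr zr xz).
    by rewrite leqNgt index_mem zr.
  rewrite (negPf zr) /= in zT *; rewrite mem_rcons inE (negPf zx) (negPf zr) /=.
  have [ltc _] := col_nth_lt above zT zr.
  by rewrite (ltn_eqF (leq_trans ltc le)).
have yT : nth 0 row (bump_pos x row) \notin flatten T by apply: dis; rewrite mem_nth.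
have xy := bump_pos_gt ltp; have belowy := bump_pos_below head_above ltp.
move: ltp xy yT belowy; move Ep: (bump_pos x row) => p ltp.
move Ey: (nth 0 row p) => y xy yT belowy /=.
have [Ezy|zy] := eqVneq y b.+1.
  (* [b + 1] is bumped out of the first row and inserted below *)
  have zr : b.+1 \in row by rewrite -Ezy -Ey mem_nth.
  have Ei : index b.+1 row = p by rewrite -Ezy -Ey index_uniq.
  have zr' : b.+1 \notin set_nth 0 row p x.
    have srow' : uniq (x :: row) by rewrite /= xr.
    rewrite -(perm_uniq (perm_set_nth x ltp)) Ey Ezy in srow'.
    by case/andP: srow'.
  rewrite zr Ei (negPf zr') Ezy leqnn ltnn eqxx.
  have zT' : b.+1 \notin flatten T by exact: dis.
  rewrite new_col_bump // col_insert_new //; rewrite Ezy in belowy.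
  have h0 : column_height b.+1 T p = 0.
    by apply: column_height_above above _ => _; rewrite Ey Ezy.
  have row1 j : j <= p -> column_height b.+1 (row :: T) j = (column_height b.+1 T j).+1.
    move=> lej; rewrite column_height_cons (leq_ltn_trans lej ltp) /=.
    by rewrite -Ezy -Ey (sorted_row_leq srow lej ltp).
  have hz j := column_height_eq0 b.+1 j tT'.
  split=> // [j ltj|j /andP[le1 le2]].
    rewrite !row1 // ?h0; last exact: leq_trans (ltnW ltj) belowy.
    by rewrite ltnS lt0n hz -ltnNge.
  by rewrite !row1 // h0; congr _.+1; apply/eqP; rewrite hz.
have zy' : b.+1 != nth 0 row p by rewrite Ey eq_sym.
have [Er Ei] := index_replace urow ltp xr zx zy'.
rewrite Er; case: (boolP (b.+1 \in row)) => [zr|zr].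
  (* [b + 1] is farther right in the first row *)
  have := bump_pos_index xr zr xz; rewrite Ep leq_eqVlt => /predU1P[E|lti].
    by case/eqP: zy'; rewrite E nth_index.
  have leyb : y <= b.
    by rewrite -ltnS -Ey -(nth_index 0 zr); apply: sorted_row_nth => //; rewrite index_mem.
  rewrite leyb (leqW leyb) Ei // new_col_notin ?dis //.
  have := leq_trans (new_col_le b y tT') belowy.
  by case: eqP => // <-; rewrite leqNgt lti.
rewrite (negPf zr) /= in zT *; move: zy; rewrite neq_ltn => /orP[lty|gty].
  (* the bumped entry is smaller than [b + 1], which lies in a lower row *)
  have leyb : y <= b by [].
  rewrite leyb (leqW leyb); have := IH y tT' yT zT lty.
  have le := leq_trans (new_col_le b y tT') belowy.
  have row1 i : i <= p -> (i < size row) && (nth 0 row i <= b.+1).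
    move=> lei; rewrite (leq_ltn_trans lei ltp).
    by rewrite (leq_trans (sorted_row_leq srow lei ltp)) // Ey ltnW.
  case: eqP => // _ [-> le' hlt heq]; split=> // [j ltj|j /andP[le1 le2]].
  - rewrite !column_height_cons !row1 ?ltn_add2l ?hlt //.
    exact: leq_trans (ltnW ltj) (leq_trans le' le).
  - rewrite !column_height_cons !row1 ?heq ?le1 //.
    exact: leq_trans le2 le.
(* the bumped entry is larger than [b + 1]: only larger entries move *)
have ngt : (y <= b.+1) = false by rewrite leqNgt gty.
have ngt' : (y <= b) = false by rewrite leqNgt (ltnW gty).
rewrite ngt ngt' col_insert_lt //; case: eqP => // Ec.
by have [_] := col_nth_lt above zT zr; rewrite Ec Ey ltnNge (ltnW gty).
Qed.

Lemma column_height_anti b T j j' : tab T -> j <= j' ->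
  column_height b T j' <= column_height b T j.
Proof.
move=> + lej; elim: T => [|row T IH] // tT.
have [r0 srow above dis tT'] := tab_cons tT.
rewrite !column_height_cons leq_add ?IH //.
case: ltnP => //= ltj'; rewrite (leq_ltn_trans lej ltj') /=.
by case: (leqP _ b) => //= /(leq_trans (sorted_row_leq srow lej ltj')) ->.
Qed.

(** The box to the left of b + 1 holds a smaller entry. *)
Lemma column_height_col b T : tab T -> b.+1 \in flatten T -> 0 < entry_col T b.+1 ->
  column_height b T (entry_col T b.+1) < column_height b T (entry_col T b.+1).-1.
Proof.
elim: T => [|row T IH] //.
move=> tT; have [r0 srow above dis tT'] := tab_cons tT.
rewrite /= mem_cat entry_col_cons !column_height_cons.
case: (boolP (b.+1 \in row)) => [zr _|zr /= zT] c0.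
  have lti : index b.+1 row < size row by rewrite index_mem.
  rewrite lti (leq_ltn_trans (leq_pred _) lti) nth_index // ltnn.
  have : nth 0 row (index b.+1 row).-1 < b.+1.
    by rewrite -[X in _ < X](nth_index 0 zr) sorted_row_nth // prednK.
  by rewrite ltnS => -> /=; rewrite add0n add1n ltnS column_height_anti // leq_pred.
rewrite -addnS leq_add ?IH //.
case: ltnP => //= ltj'; rewrite (leq_ltn_trans (leq_pred _) ltj') /=.
case: (leqP _ b) => //= le.
by rewrite (leq_trans (sorted_row_leq srow (leq_pred _) ltj') le).
Qed.

(** * Inserting the prefixes of a permutation *)

Fixpoint insertion_tab (w : nat -> nat) (k : nat) : tableau :=
  if k is k'.+1 then insert (w k').+1 (insertion_tab w k') else [::].

Definition mutual_inverses (n : nat) (w w' : nat -> nat) : Prop :=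
  (forall j, j < n -> w j < n /\ w' (w j) = j) /\
  (forall b, b < n -> w' b < n /\ w (w' b) = b).

Lemma mutual_inverses_sym n w w' : mutual_inverses n w w' -> mutual_inverses n w' w.
Proof. by case. Qed.

Lemma size_head_flatten (T : tableau) : size (head [::] T) <= size (flatten T).
Proof. by case: T => [|r T] //=; rewrite size_cat leq_addr. Qed.

Lemma entry_col_lt T z : z \in flatten T -> entry_col T z < size (flatten T).
Proof.
elim: T => [|r T IH] //=; rewrite mem_cat entry_col_cons size_cat.
case: (boolP (z \in r)) => [zr _|_ /= /IH lt]; last exact: leq_trans lt (leq_addl _ _).
by apply: leq_trans (leq_addr _ _); rewrite index_mem.
Qed.

Lemma column_height0 T j : all (ltn 0) (flatten T) -> column_height 0 T j = 0.
Proof.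
elim: T => [|r T IH] //=; rewrite all_cat column_height_cons => /andP[ar /IH ->].
rewrite addn0; case: ltnP => //= lt.
by have := allP ar _ (mem_nth 0 lt); case: (nth _ _ _).
Qed.

Section Insertion.
Variables (n : nat) (w w' : nat -> nat).
Hypothesis inv : mutual_inverses n w w'.
Local Notation P := (insertion_tab w).

Lemma perm_insertion_tab k :
  perm_eq (flatten (P k)) (mkseq (fun j => (w j).+1) k).
Proof.
elim: k => [|k IH] //; rewrite mkseqS perm_sym perm_rcons perm_sym.
apply: perm_trans (perm_insert _ _) _.
by rewrite perm_cons.
Qed.

Lemma size_insertion_tab k : size (flatten (P k)) = k.
Proof. by rewrite (perm_size (perm_insertion_tab k)) size_mkseq. Qed.

Lemma mem_insertion_tab k b : k <= n -> b < n ->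
  (b.+1 \in flatten (P k)) = (w' b < k).
Proof.
move=> lek ltb; rewrite (perm_mem (perm_insertion_tab k)).
have [_ E] := inv.2 b ltb.
apply/mapP/idP => [[j]|lt]; last by exists (w' b); rewrite ?E // mem_iota.
rewrite mem_iota => /andP[_ ltj] [Ej]; move: ltj; rewrite Ej add0n => ltj.
by have [_ ->] := inv.1 j (leq_trans ltj lek).
Qed.

Lemma letter_notin k : k < n -> (w k).+1 \notin flatten (P k).
Proof.
move=> ltk; have [ltw E] := inv.1 k ltk.
by rewrite mem_insertion_tab ?E ?ltnn // ltnW.
Qed.

Lemma tab_insertion_tab k : k <= n -> tab (P k).
Proof.
elim: k => [|k IH] // ltk.
by rewrite /= tab_insert ?letter_notin ?IH // ltnW.
Qed.

(** The outer word after k insertions. A value that has been inserted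
    contributes its column, and a value still to be inserted keeps the letter
    w' b it has in the one-line notation of the inverse, which is at least
    k. *)
Definition insertion_word (k b : nat) : nat :=
  if w' b < k then entry_col (P k) b.+1 else w' b.

Definition insertion_col (k b : nat) : nat := new_col b (w k).+1 (P k).

Lemma insertion_col_le k b : k < n -> insertion_col k b <= k.
Proof.
move=> ltk; apply: leq_trans (new_col_le _ _ (tab_insertion_tab (ltnW ltk))) _.
apply: leq_trans (bump_pos_le _ _) _.
by rewrite -[X in _ <= X](size_insertion_tab k) size_head_flatten.
Qed.

Lemma entry_col_insertion k b : k <= n -> b < n -> w' b < k ->
  entry_col (P k) b.+1 < k.
Proof.
move=> lek ltb lt; rewrite -[X in _ < X](size_insertion_tab k) entry_col_lt //.
by rewrite mem_insertion_tab.
Qed.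

Lemma insertion_word_lt k b : k <= n -> b < n -> insertion_word k b < n.
Proof.
move=> lek ltb; rewrite /insertion_word; case: ifP => [lt|_].
  exact: leq_trans (entry_col_insertion lek ltb lt) lek.
by case: (inv.2 b ltb).
Qed.

Lemma insertion_height k b j : k <= n -> b <= n -> j < k ->
  height (mkseq (insertion_word k) b) j = column_height b (P k) j.
Proof.
move=> lek + ltj; elim: b => [|b IH] ltb.
  rewrite column_height0 //; apply/allP => z.
  by rewrite (perm_mem (perm_insertion_tab k)) => /mapP[i _ ->].
rewrite height_mkseqS column_heightS ?tab_insertion_tab // IH ?(ltnW ltb) //.
rewrite mem_insertion_tab // /insertion_word; congr (_ + _).
case: (ltnP (w' b) k) => //= le; first by rewrite gtn_eqF // (leq_trans ltj).
Qed.

(** These letters belong to values that are still to be inserted, and w' is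
    injective. *)
Lemma height_outer k b j : k <= n -> b <= n -> k <= j ->
  height (mkseq (insertion_word k) b) j = ((j < n) && (w j < b)).
Proof.
move=> lek + lej; elim: b => [|b IH] ltb; first by rewrite andbF.
rewrite height_mkseqS IH ?(ltnW ltb) // /insertion_word.
have [lt E] := inv.2 b ltb.
have -> : (if w' b < k then entry_col (P k) b.+1 else w' b) == j = (w' b == j).
  case: ifP => // lt'; have lt2 := entry_col_insertion lek ltb lt'.
  by rewrite !ltn_eqF // ?(leq_trans lt2) // (leq_trans lt').
rewrite (ltnS (w j)) (leq_eqVlt (w j)); have [<-|ne] := eqVneq (w' b) j.
  by rewrite E ltnn eqxx lt.
case: (ltnP j n) => //= ltj; have [_ Ej] := inv.1 j ltj.
by case: eqP => [Eb|_] /=; [rewrite -Eb Ej eqxx in ne | rewrite addn0].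
Qed.

(** This connects row insertion to sliding. An entry that is not yet inserted
    has a letter at least k, and only the one to be inserted now has the
    letter k; as the gained column is at most k, none of them is displaced. *)
Lemma bumping_insertion k : k < n ->
  bumping n k (w k) (insertion_word k) (insertion_word k.+1) (insertion_col k).
Proof.
move=> ltk; have lek := ltnW ltk; have tP := tab_insertion_tab lek.
have xP := letter_notin ltk; have [ltwk wk] := inv.1 k ltk.
have E' b : insertion_word k.+1 b =
  if w' b < k.+1 then entry_col (insert (w k).+1 (P k)) b.+1 else w' b by [].
have mP b := @mem_insertion_tab k b lek.
have wkE b : b < n -> w' b = k -> b = w k.
  by move=> ltb <-; case: (inv.2 b ltb).
have skip b : b < n -> ~ (w' b = k) -> k <= w' b ->
    insertion_word k.+1 b = insertion_word k b.
  by move=> ltb nE le; rewrite /insertion_word; do 2!case: ifP; lia.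
have out b : b < n -> k <= w' b -> insertion_word k b = w' b.
  by move=> ltb E; rewrite /insertion_word ltnNge E.
have inn b : b < n -> w' b < k -> insertion_word k b = entry_col (P k) b.+1.
  by move=> ltb E; rewrite /insertion_word E.
have inlt b : b < n -> w' b < k -> insertion_word k b < k.
  by move=> ltb lt; rewrite inn // entry_col_insertion.
have hit b : w k < b < n -> insertion_word k b = insertion_col k b -> w' b < k.
  move=> /andP[lt ltb] E; rewrite ltnNge; apply/negP => le.
  have := insertion_col_le b ltk; rewrite -E out //.
  rewrite leq_eqVlt ltnNge le orbF => /eqP/(wkE _ ltb) Eb.
  by rewrite Eb ltnn in lt.
have gt b : w k < b < n -> w' b < k -> b.+1 \in flatten (P k) /\ (w k).+1 < b.+1.
  by move=> /andP[lt ltb] lt'; rewrite mP // lt'.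
split.
- by rewrite out ?wk.
- move=> b ltb; case: (ltnP (w' b) k) => [lt|le]; first by have := inlt b ltb lt; lia.
  by rewrite out //; apply: wkE.
- move=> b ltb /andP[b0 lts]; case: (ltnP (w' b) k) => [lt|le]; last first.
    by move: lts; rewrite out // ltnNge le.
  rewrite !insertion_height ?(leq_ltn_trans (leq_pred _)) ?(ltnW ltb) //.
  by rewrite inn // column_height_col ?mP // -inn.
- move=> b ltb; case: (ltnP (w' b) k) => [lt|le].
    by have := inlt b ltb lt; lia.
  rewrite out // => Eb; rewrite height_outer ?(ltnW ltb) // -Eb.
  by have [_ ->] := inv.2 b ltb; rewrite ltnn andbF.
- move=> b lt; have ltb := ltn_trans lt ltwk.
  case: (ltnP (w' b) k) => [lt'|le]; last first.
    by apply: skip => // /(wkE _ ltb) Eb; rewrite Eb ltnn in lt.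
  have bP : b.+1 \in flatten (P k) by rewrite mP.
  by rewrite inn // E' (leqW lt'); apply: col_insert_lt.
- split; last exact: insertion_col_le.
  rewrite E' wk ltnSn col_insert_new // /insertion_col new_col_bump //.
- move=> j; rewrite leq_eqVlt /insertion_col new_col_bump // => /predU1P[->|ltj].
    rewrite height_outer // ?(ltnW ltwk) // ltnn andbF eqxx.
    have := insertion_col_le (w k).+1 ltk; rewrite /insertion_col new_col_bump //.
  rewrite insertion_height ?(ltnW ltwk) // -column_height_eq0 //.
  by rewrite column_heightS // (negPf xP) addn0.
- move=> b B nE; have /andP[lt ltb] := B; case: (ltnP (w' b) k) => [lt'|le].
    have [bP xb] := gt b B lt'; have := col_insert_gt tP xP bP xb.
    rewrite -inn // -/(insertion_col k b); case: eqP => // _.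
    by rewrite E' (leqW lt').
  split; first by apply: skip => // /(wkE _ ltb) Eb; rewrite Eb ltnn in lt.
  by apply: new_col_notin; rewrite mP // -leqNgt.
- move=> b B Eb; have lt' := hit b B Eb; have /andP[lt ltb] := B.
  have [bP xb] := gt b B lt'; have := col_insert_gt tP xP bP xb.
  by rewrite -inn // -/(insertion_col k b) Eb eqxx E' (leqW lt') => -[].
- move=> b j B Eb ltj; have lt' := hit b B Eb; have /andP[lt ltb] := B.
  have [bP xb] := gt b B lt'; have := col_insert_gt tP xP bP xb.
  have ltq : insertion_col k b < k by rewrite -Eb inlt.
  rewrite -inn // -/(insertion_col k b) Eb eqxx => -[_ le' hlt _].
  by rewrite !insertion_height ?hlt // (leq_trans ltj) // (leq_trans le') // ltnW.
- move=> b j B Eb /andP[lej1 lej2]; have lt' := hit b B Eb; have /andP[lt ltb] := B.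
  have [bP xb] := gt b B lt'; have := col_insert_gt tP xP bP xb.
  have ltq : insertion_col k b < k by rewrite -Eb inlt.
  rewrite -inn // -/(insertion_col k b) Eb eqxx => -[_ le' _ heq].
  by rewrite !insertion_height ?heq ?lej1 // (leq_ltn_trans lej2).
Qed.

Lemma rect_word_insertion : 0 < n ->
  rect_word (size (stair_word n.-1)) n (stair_word n.-1 ++ mkseq w' n) =
  mkseq (fun b => entry_col (P n) b.+1) n ++
  vacated_word (fun k => insertion_col k n) n.-1.
Proof.
move=> n0; have := rect_word_staircase bumping_insertion _ n0.
have -> : mkseq (insertion_word 0) n = mkseq w' n by [].
move=> -> => [|k b ltk]; last by apply: insertion_word_lt; apply: ltnW.
congr (_ ++ _); apply: eq_mkseq_in => b ltb; rewrite /insertion_word.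
by have [-> _] := inv.2 b ltb.
Qed.

Lemma growth_letter k b j : k < n -> b <= n ->
  column_height b (P k.+1) j = column_height b (P k) j +
  ((w k < b) && (insertion_col k b == j)).
Proof.
move=> ltk leb; rewrite column_height_insert ?letter_notin //.
exact/tab_insertion_tab/ltnW.
Qed.

Lemma growth_value k b j : k <= n -> b < n ->
  column_height b.+1 (P k) j = column_height b (P k) j +
  ((w' b < k) && (entry_col (P k) b.+1 == j)).
Proof.
by move=> lek ltb; rewrite column_heightS ?tab_insertion_tab // mem_insertion_tab.
Qed.

End Insertion.

(** * Symmetry of the growth of shapes *)

(** Used to read off the column of a new box from two descriptions of the same
    heights. *)
Lemma eq_indicator (f : nat -> nat) a b :
  (forall j, f j + (a == j) = f j + (b == j)) -> a = b.
Proof. by move=> /(_ a)/addnI; rewrite eqxx; case: eqP. Qed.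

Lemma column_height_insertion0 w k j : column_height 0 (insertion_tab w k) j = 0.
Proof.
apply: column_height0; apply/allP => z.
by rewrite (perm_mem (perm_insertion_tab w k)) => /mapP[i _ ->].
Qed.

Section Symmetry.
Variables (n : nat) (w w' : nat -> nat).
Hypothesis inv : mutual_inverses n w w'.
Let inv' := mutual_inverses_sym inv.
Local Notation D := (fun w k b j => column_height b (insertion_tab w k) j).

(** The four shapes at (k, b), (k + 1, b), (k, b + 1) and (k + 1, b + 1) obey
    a local rule in which the two directions play the same role: if the two
    middle shapes gain different boxes, the last one gains both; if they gain
    the same box, the last one also gains a box in the leftmost column of the
    same height; and if w k = b the new entry is the largest and ends the
    first row. *)
Lemma growth_symmetric k b j : k <= n -> b <= n ->
  column_height b (insertion_tab w k) j = column_height k (insertion_tab w' b) j.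
Proof.
elim: k b j => [|k IHk] b j lek; first by rewrite column_height_insertion0.
elim: b j => [|b IHb] j leb; first by rewrite column_height_insertion0.
have ltk : k < n := lek; have ltb : b < n := leb.
have [_ wb] := inv.2 b ltb; have [_ wk] := inv.1 k ltk.
have leb' := ltnW ltb; have lek' := ltnW ltk.
have A i := IHk b.+1 i lek' leb; have B i := IHb i leb'; have C i := IHk b i lek' leb'.
have tP := tab_insertion_tab inv lek'; have tP' := tab_insertion_tab inv' leb'.
have GA i := growth_value inv i lek' ltb; have GB i := growth_letter inv i ltk leb'.
have GA' i := growth_letter inv' i ltb lek'; have GB' i := growth_value inv' i leb' ltk.
rewrite (growth_letter inv _ ltk) // (growth_letter inv' _ ltb) // -B.
have mP : (b.+1 \in flatten (insertion_tab w k)) = (w' b < k) by apply: (mem_insertion_tab inv).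
have mP' : (k.+1 \in flatten (insertion_tab w' b)) = (w k < b) by apply: (mem_insertion_tab inv').
have no x y : y < x -> (x < y) = false /\ (x < y.+1) = false by lia.
case: (ltngtP (w k) b) => [lt|gt|E]; case: (ltngtP (w' b) k) => [lt'|gt'|E'].
- have Es : entry_col (insertion_tab w k) b.+1 = insertion_col w' b k.
    by apply: (@eq_indicator (column_height b (insertion_tab w k))) => i;
      have := GA i; rewrite A GA' C lt' /= => <-.
  have Eq : insertion_col w k b = entry_col (insertion_tab w' b) k.+1.
    by apply: (@eq_indicator (column_height b (insertion_tab w k))) => i;
      have := GB i; rewrite B GB' C lt /= => <-.
  have bP : b.+1 \in flatten (insertion_tab w k) by rewrite mP.
  have kP : k.+1 \in flatten (insertion_tab w' b) by rewrite mP'.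
  have := col_insert_gt tP (letter_notin inv ltk) bP lt.
  have := col_insert_gt tP' (letter_notin inv' ltb) kP lt'.
  rewrite -/(insertion_col w k b) -/(insertion_col w' b k) (leqW lt) (leqW lt') -Es Eq.
  rewrite eq_sym -/(insertion_col w k b.+1) -/(insertion_col w' b k.+1).
  case: eqP => [E|_] /=; last first.
    by move=> [_ ->] [_ ->]; rewrite GA GB lt lt' /= Eq addnAC.
  (* same box: both new columns are the leftmost one of the same height *)
  have AB i : column_height b.+1 (insertion_tab w k) i =
              column_height k.+1 (insertion_tab w' b) i.
    by rewrite GA GB' C lt lt' /= -Eq in E *; rewrite E.
  move=> [_ le1 lt1 eq1] [_ le2 lt2 eq2].
  rewrite (GA j) GB lt lt' Eq E; congr (_ + (_ == j)); apply/eqP; rewrite eqn_leq.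
  apply/andP; split; rewrite leqNgt; apply/negP => l.
    by have := lt2 _ l; rewrite !AB -E eq1 ?leqnn ?le1 // ltnn.
  by have := lt1 _ l; rewrite -!AB E eq2 ?leqnn ?le2 // ltnn.
- have [n1 n2] := no _ _ gt'; rewrite GA GB lt (leqW lt) n1 n2 /= !addn0.
  by rewrite /insertion_col new_col_notin // mP -leqNgt ltnW.
- by rewrite -E' wb ltnn in lt.
- have [n1 n2] := no _ _ gt; rewrite A GA' GB n1 n2 lt' (leqW lt') /= !addn0 C.
  by rewrite /insertion_col new_col_notin // mP' -leqNgt ltnW.
- by have [n1 n2] := no _ _ gt; have [n3 n4] := no _ _ gt'; rewrite GA GB n1 n2 n3 n4.
- by rewrite -E' wb ltnn in gt.
- by rewrite -E wk ltnn in lt'.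
- by rewrite -E wk ltnn in gt'.
- (* the largest entry is inserted last, at the end of the first row *)
  rewrite E E' !ltnSn /= GA GB E E' !ltnn /= !addn0; congr (_ + (_ == j)).
  rewrite /insertion_col E E' !new_col_bump //.
  have h i := column_height_eq0 b.+1 i tP; have h' i := column_height_eq0 k.+1 i tP'.
  set p := bump_pos _ _ in h *; set p' := bump_pos _ _ in h' *.
  have hh i : (p <= i) = (p' <= i) by rewrite -h -h' A -B GA' GB E E' !ltnn !addn0 C.
  by apply/eqP; rewrite eqn_leq hh leqnn -hh leqnn.
Qed.

(** By symmetry, the column gained at step k is the column of k + 1 in the
    insertion tableau of the inverse; this is Q(sigma) = P(sigma^-1) in terms
    of columns. *)
Lemma insertion_col_inverse k : k < n ->
  insertion_col w k n = entry_col (insertion_tab w' n) k.+1.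
Proof.
move=> ltk; have [ltw _] := inv.1 k ltk; have lek := ltnW ltk.
apply: (@eq_indicator (column_height n (insertion_tab w k))) => i.
have := growth_letter inv i ltk (leqnn n); rewrite ltw andTb => <-.
rewrite !growth_symmetric // (growth_value inv' _ _ ltk) //.
by rewrite ltw.
Qed.

Lemma eq_vacated_word r r' k : (forall i, i <= k -> r i = r' i) ->
  vacated_word r k = vacated_word r' k.
Proof.
elim: k => [|k IH] //= E; rewrite /vacated E // IH // => i lei.
by apply/E/leqW.
Qed.

Lemma rect_word_permutation : 0 < n ->
  rect_word (size (stair_word n.-1)) n (stair_word n.-1 ++ mkseq w' n) =
  mkseq (fun b => entry_col (insertion_tab w n) b.+1) n ++
  vacated_word (fun k => entry_col (insertion_tab w' n) k.+1) n.-1.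
Proof.
move=> n0; rewrite (rect_word_insertion inv n0); congr (_ ++ _).
by apply: eq_vacated_word => k lek; rewrite insertion_col_inverse //; lia.
Qed.

End Symmetry.

(** * Standard tableaux as lattice words *)

Definition column_word (N : nat) (T : tableau) : seq nat :=
  mkseq (fun b => entry_col T b.+1) N.

Definition entry_row (T : tableau) (z : nat) : nat :=
  find (fun row => z \in row) T.

Lemma entry_row_cons row T z :
  entry_row (row :: T) z = if z \in row then 0 else (entry_row T z).+1.
Proof. by []. Qed.

Lemma mem_standard N T z : standard N T -> (z \in flatten T) = (0 < z <= N).
Proof. by case/and4P=> /perm_mem -> _ _ _; rewrite mem_iota add1n ltnS. Qed.

Lemma size_column_word N T : size (column_word N T) = N.
Proof. exact: size_mkseq. Qed.

Lemma nth_column_word N T b : b < N -> nth 0 (column_word N T) b = entry_col T b.+1.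
Proof. exact: nth_mkseq. Qed.

Lemma take_mkseq (T : Type) (f : nat -> T) n k :
  k <= n -> take k (mkseq f n) = mkseq f k.
Proof. by move=> lekn; rewrite /mkseq -map_take take_iota (minn_idPl lekn). Qed.

Lemma height_column_word N T b j : standard N T -> b <= N ->
  height (take b (column_word N T)) j = column_height b T j.
Proof.
move=> sT leb; rewrite take_mkseq //.
elim: b leb => [|b IH] ltb.
  by rewrite column_height0 //; apply/allP => z; rewrite (mem_standard _ sT) => /andP[].
rewrite height_mkseqS IH ?(ltnW ltb) // column_heightS ?(standard_tab sT) //.
by rewrite (mem_standard _ sT) ltb.
Qed.

Lemma lattice_column_word N T : standard N T -> lattice (column_word N T).
Proof.
move=> sT k j; have [le|lt] := leqP k N.
  by rewrite !height_column_word // column_height_anti // (standard_tab sT).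
rewrite take_oversize ?size_column_word ?(ltnW lt) //.
have := height_column_word _ sT (leqnn N).
rewrite take_oversize ?size_column_word // => E.
by rewrite !E column_height_anti // (standard_tab sT).
Qed.

(** The entries above b + 1 in its column are exactly the smaller ones of that
    column; this makes rows, and so contents, readable from the column
    word. *)
Lemma entry_row_height b T : tab T -> b.+1 \in flatten T ->
  entry_row T b.+1 = column_height b T (entry_col T b.+1).
Proof.
elim: T => [|row T IH] //.
move=> tT; have [r0 srow above dis tT'] := tab_cons tT.
rewrite entry_row_cons entry_col_cons column_height_cons [flatten _]/= mem_cat.
case: (boolP (b.+1 \in row)) => [zr _|zr /= zT].
  rewrite nth_index // ltnn andbF (column_height_above above) // => _.
  by rewrite nth_index.
have [lt lt'] := col_nth_lt above zT zr.
by rewrite lt -ltnS lt' IH.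
Qed.

Lemma contentE T z : content T z = ((entry_col T z)%:Z - (entry_row T z)%:Z)%R.
Proof. by []. Qed.

Definition word_content (w : seq nat) (b : nat) : int :=
  ((nth 0%N w b)%:Z - (height (take b w) (nth 0%N w b))%:Z)%R.

Lemma content_column_word N T b : standard N T -> b < N ->
  content T b.+1 = word_content (column_word N T) b.
Proof.
move=> sT ltb; rewrite contentE entry_row_height ?(standard_tab sT) //.
  by rewrite /word_content nth_column_word // height_column_word // ltnW.
by rewrite (mem_standard _ sT).
Qed.

Lemma entry_rowP T z : tab T -> forall r,
  (z \in nth [::] T r) = (z \in flatten T) && (entry_row T z == r).
Proof.
elim: T => [|row T IH] tT r; first by rewrite nth_nil.
have [r0 srow above dis tT'] := tab_cons tT.
rewrite entry_row_cons [flatten _]/= mem_cat; case: r => [|r] /=.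
  by case: (boolP (z \in row)) => //= zr; rewrite andbF.
rewrite IH //; case: (boolP (z \in row)) => //= zr.
by rewrite (negPf (dis _ zr)).
Qed.

Lemma standard_rows_inj N T T' : standard N T -> standard N T' ->
  (forall z, 0 < z <= N -> entry_row T z = entry_row T' z) -> T = T'.
Proof.
move=> sT sT' E.
have rows r : nth [::] T r = nth [::] T' r.
  have srt (U : tableau) : standard N U -> sorted ltn (nth [::] U r).
    case/and4P=> _ _ sU _; case: (ltnP r (size U)) => [lt|le].
      by apply: (allP sU); apply: mem_nth.
    by rewrite nth_default.
  apply: (irr_sorted_eq ltn_trans ltnn); rewrite ?srt // => z.
  rewrite !entry_rowP ?(standard_tab sT) ?(standard_tab sT') //.
  rewrite (mem_standard _ sT) (mem_standard _ sT').
  by case: (boolP (0 < z <= N)) => //= zN; rewrite E.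
have szle (U U' : tableau) : standard N U' -> (forall r, nth [::] U r = nth [::] U' r) ->
    size U' <= size U.
  case/and4P=> _ nilU _ _ EU; rewrite leqNgt; apply/negP => lt.
  by have := mem_nth [::] lt; rewrite -EU nth_default // (negPf nilU).
apply: (@eq_from_nth _ [::]) => [|r _]; last exact: rows.
by apply/eqP; rewrite eqn_leq !szle.
Qed.

Lemma column_word_inj N T T' : standard N T -> standard N T' ->
  column_word N T = column_word N T' -> T = T'.
Proof.
move=> sT sT' E; apply: (standard_rows_inj sT sT') => -[|b] // ltb.
have zT : b.+1 \in flatten T by rewrite (mem_standard _ sT).
have zT' : b.+1 \in flatten T' by rewrite (mem_standard _ sT').
rewrite !entry_row_height ?(standard_tab sT) ?(standard_tab sT') //.
rewrite -(nth_column_word T ltb) -(nth_column_word T' ltb).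
by rewrite -!(@height_column_word N) ?E // ltnW.
Qed.

Lemma lattice_anti w k i j : lattice w -> i <= j ->
  height (take k w) j <= height (take k w) i.
Proof.
move=> lw; elim: j => [|j IH]; first by rewrite leqn0 => /eqP->.
by rewrite leq_eqVlt => /predU1P[->//|/IH]; apply: leq_trans; apply: lw.
Qed.

(** After a common prefix, the next letters are the columns of two addable
    boxes on the same diagonal, and a Young diagram has at most one of
    these. *)
Lemma word_content_inj w w' : lattice w -> lattice w' -> size w = size w' ->
  (forall b, b < size w -> word_content w b = word_content w' b) -> w = w'.
Proof.
move=> lw lw' sz E.
suff tk b : b <= size w -> take b w = take b w'.
  by rewrite -(take_size w) tk // sz take_size.
elim: b => [|b IH] ltb; first by rewrite !take0.
have Eb := IH (ltnW ltb); rewrite !(take_nth 0) -?sz // Eb; congr rcons.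
have := E b ltb; rewrite /word_content Eb => C.
have := @lattice_anti _ b (nth 0 w b) (nth 0 w' b) lw'.
have := @lattice_anti _ b (nth 0 w' b) (nth 0 w b) lw'.
by lia.
Qed.

(** * Contents after an exchange *)

Section WordContents.
Variables (w : seq nat) (k : nat).
Hypotheses (lw : lattice w) (ltk : k.+1 < size w).

Let f := take k w.
Let h := nth 0 w k.
Let v := nth 0 w k.+1.

Lemma word_cut : w = f ++ h :: v :: drop k.+2 w.
Proof. by rewrite -!drop_nth ?(ltnW ltk) // cat_take_drop. Qed.

Lemma size_word_cut : size f = k.
Proof. by rewrite size_takel // ltnW // ltnW. Qed.

Lemma word_content_here : word_content w k = (h%:Z - (height f h)%:Z)%R.
Proof. by []. Qed.

Lemma word_content_next :
  word_content w k.+1 = (v%:Z - (height f v + (h == v))%:Z)%R.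
Proof. by rewrite /word_content (take_nth 0) ?(ltnW ltk) // height_rcons. Qed.

(** Two boxes added in succession are both corners when they are added, so
    they are adjacent as soon as their diagonals are. *)
Lemma frozen_content : frozen (height f) h v =
  ((word_content w k - word_content w k.+1 == 1) ||
   (word_content w k - word_content w k.+1 == -1))%R.
Proof.
rewrite word_content_here word_content_next /frozen.
have := @lattice_anti w k h v lw.
have := @lattice_anti w k v h lw.
have := @lattice_anti w k.+1 v h lw.
rewrite (take_nth 0) ?(ltnW ltk) // -/f -/h !height_rcons eqxx.
by move=> l1 l2 l3; lia.
Qed.

Lemma exchange_frozen : frozen (height f) h v -> exchange k.+1 w = w.
Proof.
move=> fr; have := exchange_cat f h v (drop k.+2 w).
by rewrite -word_cut size_word_cut fr -word_cut.
Qed.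

Hypothesis nfr : ~~ frozen (height f) h v.

Lemma exchange_free : exchange k.+1 w = f ++ v :: h :: drop k.+2 w.
Proof.
by have := exchange_cat f h v (drop k.+2 w); rewrite -word_cut size_word_cut (negPf nfr).
Qed.

(** An exchange moves two non-adjacent boxes, which keep their contents. *)
Lemma word_content_exchange j : word_content (exchange k.+1 w) j =
  word_content w (if j == k then k.+1 else if j == k.+1 then k else j).
Proof.
have hv : h != v by apply: contra nfr => E; rewrite /frozen E.
rewrite exchange_free; set w' := f ++ _; have szf := size_word_cut.
have nk : nth 0 w' k = v by rewrite nth_cat szf ltnn subnn.
have nk1 : nth 0 w' k.+1 = h by rewrite nth_cat szf ltnNge leqnSn subSnn.
have tk : take k w' = f by rewrite -szf take_size_cat.
have tk1 : take k.+1 w' = rcons f v.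
  by rewrite take_cat szf ltnNge leqnSn subSnn /= ?take0 cats1.
case: eqP => [->|nejk].
  by rewrite word_content_next /word_content nk tk (negPf hv) addn0.
case: eqP => [->|nejk1].
  by rewrite word_content_here /word_content nk1 tk1 height_rcons eq_sym (negPf hv) addn0.
rewrite /word_content [in RHS]word_cut; have [lt|ge] := ltnP j k.
  rewrite !nth_cat szf lt !take_cat szf lt; congr (_ - (height _ _)%:Z)%R.
have {ge nejk nejk1} [i ->] : exists i, j = k.+2 + i by exists (j - k.+2); lia.
have nthE (a b : nat) : nth 0 (f ++ a :: b :: drop k.+2 w) (k.+2 + i) = nth 0 (drop k.+2 w) i.
  by rewrite nth_cat szf ifF; [have -> : k.+2 + i - k = i.+2 by lia | lia].
have takeE (a b : nat) : take (k.+2 + i) (f ++ a :: b :: drop k.+2 w) =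
    f ++ a :: b :: take i (drop k.+2 w).
  by rewrite take_cat szf ifF; [have -> : k.+2 + i - k = i.+2 by lia | lia].
rewrite /w' !nthE !takeE !heightE; congr (_ - _%:Z)%R; lia.
Qed.

End WordContents.

(** * Restricting a tableau and adding a box *)

(** The entries at most n form an initial segment of each row. *)
Lemma filter_sorted_row n row : sorted ltn row ->
  [seq k <- row | k <= n] = take (bump_pos n row) row.
Proof.
elim: row => [|k row IH] //= srow; have srow' := path_sorted srow.
rewrite /bump_pos /= -/(bump_pos n row) IH // leqNgt; case: ltnP => //= ltk.
rewrite -IH //; apply/eqP; rewrite -size_eq0 size_filter -leqn0 leqNgt -has_count.
apply/hasP => -[i irow]; have := allP (order_path_min ltn_trans srow) i irow.
by move=> lt le; have := leq_trans ltk (leq_trans (ltnW lt) le); rewrite ltnn.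
Qed.

Lemma row_above_filter n r1 r2 : sorted ltn r1 -> sorted ltn r2 ->
  row_above r1 r2 ->
  row_above [seq k <- r1 | k <= n] [seq k <- r2 | k <= n].
Proof.
move=> s1 s2 /row_aboveP[le lt]; rewrite !filter_sorted_row //.
have pos : bump_pos n r2 <= bump_pos n r1.
  rewrite leqNgt; apply/negP => gt.
  have lt2 := leq_trans gt (bump_pos_le n r2).
  have := before_find 0 gt; have := bump_pos_gt (leq_trans lt2 le).
  by move=> l1 l2; rewrite (ltn_trans l1 (lt _ lt2)) in l2.
apply/row_aboveP; rewrite !size_takel ?bump_pos_le //; split=> // j ltj.
rewrite !nth_take ?(leq_trans ltj) //; apply: lt.
exact: leq_trans ltj (bump_pos_le _ _).
Qed.

Lemma flatten_filter_nil (T : tableau) :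
  flatten [seq row <- T | row != [::]] = flatten T.
Proof. by elim: T => [|[|k row] T IH] //=; rewrite IH. Qed.

Lemma flatten_restrict n T : flatten (restrict n T) = [seq k <- flatten T | k <= n].
Proof.
rewrite /restrict flatten_filter_nil.
by elim: T => [|row T IH] //=; rewrite filter_cat IH.
Qed.

Lemma standard_restrict n N T : n <= N -> standard N T -> standard n (restrict n T).
Proof.
move=> len sT; case/and4P: (sT) => permT nilT srtT colT; apply/and4P; split.
- rewrite flatten_restrict; apply: (perm_trans (perm_filter _ permT)).
  have <- : [seq k <- iota 1 N | k <= n] = iota 1 n; last exact: perm_refl.
  rewrite -(subnKC len) iotaD filter_cat.
  have /all_filterP-> : all (fun k => k <= n) (iota 1 n).
    by apply/allP => k; rewrite mem_iota; lia.
  rewrite (_ : filter _ _ = [::]) ?cats0 //; apply/eqP; rewrite -size_eq0 size_filter.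
  rewrite -leqn0 leqNgt -has_count; apply/hasP => -[k].
  by rewrite mem_iota; lia.
- by rewrite mem_filter eqxx.
- apply/allP => row; rewrite mem_filter => /andP[_ /mapP[r rT ->]].
  by apply: sorted_filter; [exact: ltn_trans | exact: (allP srtT)].
- apply: sorted_filter; first exact: row_above_trans.
  apply: (homo_sorted_in (P := sorted ltn)) colT => //.
  by move=> r1 r2 s1 s2; apply: row_above_filter.
Qed.

Lemma entry_col_restrict n T z : all (sorted ltn) T -> z <= n ->
  entry_col (restrict n T) z = entry_col T z.
Proof.
move=> + lez; elim: T => [|row T IH] // /andP[srow srtT].
have {}IH := IH srtT; rewrite entry_col_cons -IH /restrict /=.
have mz : (z \in [seq k <- row | k <= n]) = (z \in row) by rewrite mem_filter lez.
case: ifP => [ne|/eqP E]; last first.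
  by move: mz; rewrite E => <-.
rewrite entry_col_cons mz; case: ifP => // zr; rewrite zr filter_sorted_row // in mz *.
by rewrite -[in RHS](cat_take_drop (bump_pos n row) row) index_cat mz.
Qed.

Lemma column_word_restrict n N T : n <= N -> standard N T ->
  column_word n (restrict n T) = take n (column_word N T).
Proof.
move=> len sT; rewrite take_mkseq //; apply: eq_mkseq_in => b ltb.
by apply: entry_col_restrict => //; case/and4P: sT.
Qed.

Lemma entry_col_nth T r c : tab T -> c < size (nth [::] T r) ->
  entry_col T (nth 0 (nth [::] T r) c) = c.
Proof.
elim: T r => [|row T IH] r; first by rewrite nth_nil.
move=> tT; have [r0 srow above dis tT'] := tab_cons tT.
rewrite entry_col_cons; case: r => [|r] /= ltc.
  by rewrite mem_nth // index_uniq // sorted_row_uniq.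
rewrite ifN ?IH //; apply: contraL (mem_nth 0 ltc) => /dis zT.
apply: contra zT => zr; apply/flattenP; exists (nth [::] T r) => //.
by apply: mem_nth; rewrite ltnNge; apply/negP => le; rewrite nth_default in ltc.
Qed.

Lemma nth_add_box r k Q i : nth [::] (add_box r k Q) i =
  if i == r then rcons (nth [::] Q r) k else nth [::] Q i.
Proof. by rewrite /add_box nth_set_nth /=; case: eqP => // ->. Qed.

Lemma perm_add_box r k Q : r <= size Q ->
  perm_eq (flatten (add_box r k Q)) (k :: flatten Q).
Proof.
rewrite /add_box => ler; elim: Q r ler => [|row Q IH] [|r] //= ler.
  by rewrite -cat_cons perm_cat2r perm_rcons.
apply: (perm_trans (y := row ++ k :: flatten Q)); first by rewrite perm_cat2l IH.
by rewrite -cat1s perm_catCA.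
Qed.

Lemma standard_nth N T r : standard N T -> r.+1 < size T ->
  row_above (nth [::] T r) (nth [::] T r.+1).
Proof. by case/and4P=> _ _ _ /(sortedP [::]) cT /cT. Qed.

(** The hypothesis on r says that the new box is addable. *)
Lemma standard_add_box N r Q : standard N Q -> r <= size Q ->
  (0 < r -> size (nth [::] Q r) < size (nth [::] Q r.-1)) ->
  standard N.+1 (add_box r N.+1 Q).
Proof.
move=> sQ ler outer; case/and4P: (sQ) => permQ nilQ srtQ colQ.
have szA : size (add_box r N.+1 Q) = maxn r.+1 (size Q) by rewrite size_set_nth.
have leN i c : c < size (nth [::] Q i) -> nth 0 (nth [::] Q i) c < N.+1.
  move=> ltc; have ltn_i : i < size Q.
    by rewrite ltnNge; apply/negP => le; rewrite nth_default in ltc.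
  have : nth 0 (nth [::] Q i) c \in flatten Q.
    by apply/flattenP; exists (nth [::] Q i); rewrite mem_nth.
  by rewrite (mem_standard _ sQ) ltnS => /andP[].
apply/and4P; split.
- apply: (perm_trans (perm_add_box _ ler)).
  rewrite -{2}addn1 iotaD -cat1s perm_sym perm_catC /= add1n perm_cons perm_sym.
  exact: permQ.
- apply/negP => /(nthP [::])[i]; rewrite szA nth_add_box => lti.
  case: eqP => [_|ne]; first by case: (nth _ _ _).
  move=> E; have lt : i < size Q by lia.
  by have := mem_nth [::] lt; rewrite E (negPf nilQ).
- apply/(all_nthP [::]) => i; rewrite szA nth_add_box => lti.
  have srt : sorted ltn (nth [::] Q i).
    case: (ltnP i (size Q)) => [lt|le]; last by rewrite nth_default.
    by apply: (allP srtQ); apply: mem_nth.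
  case: eqP => [Ei|ne] //; subst i; apply/sorted_rowP => c.
  rewrite size_rcons ltnS => ltc; rewrite !nth_rcons ltc.
  case: (ltngtP c.+1 (size (nth [::] Q r))) => [lt|gt|Ec].
  + exact: sorted_row_nth.
  + by lia.
  + exact: leN.
- apply/(sortedP [::]) => i; rewrite szA => lti; rewrite !nth_add_box.
  case: (eqVneq i r) => [Ei|ne].
    subst i; rewrite ifN ?gtn_eqF //.
    have lt : r.+1 < size Q by lia.
    have /row_aboveP[le lt'] := standard_nth sQ lt.
    apply/row_aboveP; rewrite size_rcons; split; first exact: leqW.
    by move=> j ltj; rewrite nth_rcons (leq_trans ltj le) lt'.
  case: (eqVneq i.+1 r) => [Ei|ne1].
    subst r; have {}outer := outer isT; rewrite /= in outer.
    apply/row_aboveP; rewrite size_rcons; split => // j; rewrite nth_rcons ltnS.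
    rewrite leq_eqVlt => /predU1P[->|ltj]; first by rewrite ltnn eqxx leN.
    rewrite ltj; case: (ltnP i.+1 (size Q)) => [lt|le].
      by have /row_aboveP[_ ->] := standard_nth sQ lt.
    by rewrite nth_default in ltj.
  by apply: standard_nth sQ _; lia.
Qed.

Lemma entry_col_add_box N r Q z : standard N.+1 (add_box r N.+1 Q) -> standard N Q ->
  r <= size Q -> 0 < z <= N.+1 ->
  entry_col (add_box r N.+1 Q) z =
  if z == N.+1 then size (nth [::] Q r) else entry_col Q z.
Proof.
move=> sA sQ ler zN; have tA := standard_tab sA; have tQ := standard_tab sQ.
case: eqP => [->|ne].
  have := @entry_col_nth _ r (size (nth [::] Q r)) tA.
  by rewrite nth_add_box eqxx size_rcons nth_rcons ltnn eqxx => ->.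
have : z \in flatten Q by rewrite (mem_standard _ sQ); lia.
case/flattenP => row /(nthP [::])[i lti <-] /(nthP 0)[c ltc Ez].
have EQ := entry_col_nth tQ ltc; rewrite Ez in EQ; rewrite EQ.
have := @entry_col_nth _ i c tA; rewrite nth_add_box.
case: eqP => [Ei|_]; last by rewrite Ez => ->.
by subst i; rewrite size_rcons nth_rcons ltc Ez ltnS ltnW // => ->.
Qed.

(** * The recording tableau *)

(** The bound m on all the entries makes [new_col] follow the bumping path to
    its end, so that it computes the column of the new box of the whole
    tableau. *)
Lemma insert_shape m x T : tab T -> x \notin flatten T ->
  all (geq m) (x :: flatten T) ->
  exists r, [/\ r <= size T,
    forall i, size (nth [::] (insert x T) i) = size (nth [::] T i) + (i == r),
    size (insert x T) = maxn r.+1 (size T) & size (nth [::] T r) = new_col m x T].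
Proof.
elim: T x => [|row T IH] x.
  by move=> _ _ _; exists 0; split=> // -[|i] //=; rewrite !nth_nil.
move=> tT; have [r0 srow above dis tT'] := tab_cons tT.
rewrite [flatten _]/= mem_cat negb_or => /andP[xr xT] /=.
rewrite all_cat => /and3P[xm rowm Tm]; rewrite -/(bump_pos x row).
case: (ltnP (bump_pos x row) (size row)) => [lt|le] /=; last first.
  have E : bump_pos x row = size row by apply/eqP; rewrite eqn_leq le bump_pos_le.
  exists 0; rewrite maxnE subn1; split=> //.
  by case=> [|i] /=; rewrite ?size_rcons ?addn1 ?addn0.
have yrow := mem_nth 0 lt; have ym := allP rowm _ yrow.
have [|r [ler szr szI Er]] := IH (nth 0 row (bump_pos x row)) tT' (dis _ yrow).
  by apply/andP.
exists r.+1; split=> //; first by move=> [|i] /=; rewrite ?size_set_row ?addn0.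
  by rewrite szI /= maxnSS.
by rewrite Er; have -> : nth 0 row (bump_pos x row) <= m by [].
Qed.

Lemma new_row_eq P P' r : r < size P' ->
  (forall i, size (nth [::] P' i) = size (nth [::] P i) + (i == r)) ->
  new_row P P' = r.
Proof.
move=> lt sz; rewrite /new_row -(subnKC (ltnW lt)) iotaD find_cat.
rewrite ifN; last first.
  apply/hasP => -[i]; rewrite mem_iota sz => /andP[_ lti].
  by rewrite ltn_eqF // addn0 ltnn.
rewrite size_iota; case E: (size P' - r) => [|d] /=; first by lia.
by rewrite add0n sz eqxx addn1 ltnSn addn0.
Qed.

Section Recording.
Variables (n : nat) (w w' : nat -> nat).
Hypothesis inv : mutual_inverses n w w'.

Definition rsk_prefix (k : nat) : tableau * tableau :=
  foldl rsk_step ([::], [::]) (zip (iota 1 k) (mkseq (fun j => (w j).+1) k)).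

Lemma rsk_prefixS k : rsk_prefix k.+1 = rsk_step (rsk_prefix k) (k.+1, (w k).+1).
Proof.
rewrite /rsk_prefix mkseqS (_ : iota 1 k.+1 = rcons (iota 1 k) k.+1).
  by rewrite zip_rcons ?size_iota ?size_mkseq // -cats1 foldl_cat.
by rewrite -[in LHS](addn1 k) iotaD cats1 add1n.
Qed.

Lemma rsk_prefix1 k : (rsk_prefix k).1 = insertion_tab w k.
Proof. by elim: k => [|k IH] //; rewrite rsk_prefixS /= IH. Qed.

(** The induction keeps the shape of Q equal to that of P, which makes every
    new box addable to Q. *)
Lemma rsk_prefix2 k : k <= n ->
  let Q := (rsk_prefix k).2 in
  [/\ standard k Q, size Q = size (insertion_tab w k),
      forall i, size (nth [::] Q i) = size (nth [::] (insertion_tab w k) i) &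
      forall b, b < k -> entry_col Q b.+1 = insertion_col w b n].
Proof.
elim: k => [|k IH] // ltk; have [sQ szQ shQ colQ] := IH (ltnW ltk).
have tP := tab_insertion_tab inv (ltnW ltk); have xP := letter_notin inv ltk.
have tP' := tab_insertion_tab inv ltk.
have [|r [ler szr szI Er]] := @insert_shape n _ _ tP xP.
  rewrite -(perm_all _ (perm_insert _ _)); apply/allP => z.
  rewrite -/(insertion_tab w k.+1) (perm_mem (perm_insertion_tab w _)) => /mapP[j].
  by rewrite mem_iota => /andP[_ ltj] ->; have [] := inv.1 j (leq_trans ltj ltk).
rewrite rsk_prefixS /rsk_step [fst _]/= [snd _]/= rsk_prefix1 (new_row_eq _ szr); last first.
  by rewrite szI leq_maxl.
set Q := (rsk_prefix k).2 in sQ szQ shQ colQ *.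
have ler' : r <= size Q by rewrite szQ.
have sA : standard k.+1 (add_box r k.+1 Q).
  apply: standard_add_box => // r_gt0; rewrite !shQ.
  have := szr r.-1; have := szr r; rewrite eqxx ltn_eqF ?prednK // addn0 addn1.
  move=> E1 E2; rewrite -E2 -E1.
  case/and4P: tP' => _ _ _ /(sortedP [::]) /(_ r.-1); rewrite prednK //.
  rewrite -[insertion_tab w k.+1]/(insert (w k).+1 (insertion_tab w k)) szI leq_maxl.
  by case/(_ isT)/row_aboveP.
split=> //.
- by rewrite size_set_nth szQ -szI.
- by move=> i; rewrite nth_add_box -[insertion_tab w k.+1]/(insert _ _) szr -!shQ;
    case: eqP => [->|]; rewrite ?size_rcons ?addn1 ?addn0.
- move=> b ltb; rewrite (entry_col_add_box sA) //.
  rewrite eqSS; case: eqP => [->|ne]; first by rewrite shQ Er.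
  by apply: colQ; lia.
Qed.

Lemma standard_insertion : standard n (insertion_tab w n).
Proof.
have /and4P[u nil srt cl] := tab_insertion_tab inv (leqnn n); apply/and4P; split=> //.
apply: uniq_perm; rewrite ?iota_uniq // => z.
rewrite mem_iota add1n; case: z => [|b].
  rewrite (perm_mem (perm_insertion_tab w _)); apply/mapP => -[]//.
rewrite /= ltnS; have [lt|le] := ltnP b n.
  by rewrite (mem_insertion_tab inv) //; have [-> _] := inv.2 b lt.
rewrite (perm_mem (perm_insertion_tab w _)); apply/mapP => -[j].
rewrite mem_iota => /andP[_ ltj] [Eb]; have [] := inv.1 j ltj.
by rewrite -Eb [b < n]ltnNge le.
Qed.

End Recording.

Lemma recording_inverse n w w' : mutual_inverses n w w' ->
  (rsk_prefix w n).2 = insertion_tab w' n.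
Proof.
move=> inv; have [sQ _ _ colQ] := rsk_prefix2 inv (leqnn n).
apply: (column_word_inj sQ (standard_insertion (mutual_inverses_sym inv))).
apply: eq_mkseq_in => b ltb; rewrite colQ //.
exact: (insertion_col_inverse inv).
Qed.

(** A permutation as a function on naturals, which lets words be indexed
    without proofs of bounds. *)
Definition perm_nat (n : nat) (s : 'S_n) (j : nat) : nat :=
  nth 0 [seq (s i : nat) | i <- enum 'I_n] j.

Lemma perm_natE n (s : 'S_n) (i : 'I_n) : perm_nat s i = s i.
Proof. by rewrite /perm_nat (nth_map i) ?nth_ord_enum // size_enum_ord. Qed.

Lemma perm_nat_lt n (s : 'S_n) j : j < n -> perm_nat s j < n.
Proof. by move=> lt; rewrite (perm_natE s (Ordinal lt)). Qed.

Lemma perm_natK n (s t : 'S_n) : (forall i, t (s i) = i) ->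
  forall j, j < n -> perm_nat t (perm_nat s j) = j.
Proof.
by move=> K j lt; rewrite (perm_natE s (Ordinal lt)) perm_natE K.
Qed.

Lemma perm_nat_inverses n (s : 'S_n) :
  mutual_inverses n (perm_nat s) (perm_nat s^-1%g).
Proof.
split=> j ltj; rewrite perm_nat_lt //; split=> //; apply: perm_natK => // i.
  by rewrite permK.
by rewrite permKV.
Qed.

Lemma perm_nat_inj n (s t : 'S_n) : mkseq (perm_nat s) n = mkseq (perm_nat t) n -> s = t.
Proof.
move=> E; apply/permP => i; apply: val_inj; rewrite /= -!perm_natE.
by rewrite -(nth_mkseq 0 (perm_nat s) (ltn_ord i)) E nth_mkseq.
Qed.

Lemma rsk_perm n (s : 'S_n) : rsk s = rsk_prefix (perm_nat s) n.
Proof.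
rewrite /rsk /rsk_prefix; congr (foldl _ _ (zip _ _)).
apply: (@eq_from_nth _ 0); rewrite size_map size_enum_ord ?size_mkseq // => j ltj.
rewrite nth_mkseq // (nth_map (Ordinal ltj)) ?size_enum_ord //.
by rewrite -perm_natE nth_enum_ord.
Qed.

Lemma rskPE n (s : 'S_n) : rskP s = insertion_tab (perm_nat s) n.
Proof. by rewrite /rskP rsk_perm rsk_prefix1. Qed.

Lemma rskQE n (s : 'S_n) : rskQ s = rskP s^-1%g.
Proof.
rewrite /rskQ rsk_perm (recording_inverse (perm_nat_inverses s)) rskPE.
by [].
Qed.

Lemma std_pair_rsk n (s : 'S_n) : std_pair n (rskP s) (rskQ s).
Proof.
have inv := perm_nat_inverses s.
rewrite /std_pair {1}rskPE (standard_insertion inv) /=.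
have [sQ szQ shQ _] := rsk_prefix2 inv (leqnn n).
rewrite /rskQ rsk_perm sQ /= rskPE; apply/eqP.
apply: (@eq_from_nth _ 0); rewrite !size_map -?szQ // => i lti.
by rewrite !(nth_map [::]) -?szQ.
Qed.

(** * The tableaux of staircase shape *)

Fixpoint stair_rows (a k : nat) : tableau :=
  if k is k'.+1 then iota a k :: stair_rows (a + k) k' else [::].

Lemma size_stair_word k : size (stair_word k) = 'C(k.+1, 2).
Proof. by elim: k => [|k IH] //; rewrite size_cat size_iota IH [in RHS]binS bin1 addnC. Qed.

Lemma staircaseS k : staircase k.+1 = k.+1 :: staircase k.
Proof. by rewrite /staircase -(addn1 k) iotaD rev_cat add1n addn1. Qed.

Lemma reshape_staircase a k :
  reshape (staircase k) (iota a 'C(k.+1, 2)) = stair_rows a k.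
Proof.
elim: k a => [|k IH] a //; rewrite staircaseS [in LHS]binS bin1 [LHS]/= addnC iotaD.
by rewrite take_size_cat ?size_iota // drop_size_cat ?size_iota // IH.
Qed.

Lemma flatten_stair_rows a k : flatten (stair_rows a k) = iota a 'C(k.+1, 2).
Proof.
elim: k a => [|k IH] a //.
by rewrite [in RHS]binS bin1 addnC iotaD -IH.
Qed.

Lemma size_stair_rows a k : size (stair_rows a k) = k.
Proof. by elim: k a => [|k IH] a //=; rewrite IH. Qed.

Lemma nth_stair_rows a k r : exists b,
  nth [::] (stair_rows a k) r = iota b (k - r) /\
  nth [::] (stair_rows a k) r.+1 = iota (b + (k - r)) (k - r.+1).
Proof.
elim: k a r => [|k IH] a [|r].
- by exists a.
- by exists a.
- by exists a; split=> //; case: k {IH} => [|k] //=; rewrite subn1.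
- by have [b [E1 E2]] := IH (a + k.+1) r; exists b; rewrite !subSS.
Qed.

Lemma map_flatten_cols (f : nat -> nat) (L : tableau) :
  (forall r c, c < size (nth [::] L r) -> f (nth 0 (nth [::] L r) c) = c) ->
  map f (flatten L) = flatten [seq iota 0 (size row) | row <- L].
Proof.
elim: L => [|row L IH] //= E; rewrite map_cat IH => [|r c]; last exact: (E r.+1 c).
congr (_ ++ _); apply: (@eq_from_nth _ 0); rewrite size_map ?size_iota // => c ltc.
by rewrite (nth_map 0) // nth_iota // (E 0 c).
Qed.

Lemma stair_word_rows a k :
  flatten [seq iota 0 (size row) | row <- stair_rows a k] = stair_word k.
Proof. by elim: k a => [|k IH] a //=; rewrite IH size_iota. Qed.

Section StaircaseTableau.
Variables (n : nat) (s : 'S_n).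
Local Notation m := 'C(n, 2).

Definition outer_entry (r : nat) : nat := m + (perm_nat s (n - r.+1)).+1.

Hypothesis n_gt0 : 0 < n.

Lemma inner_tableauE : inner_tableau n = stair_rows 1 n.-1.
Proof. by rewrite /inner_tableau -reshape_staircase prednK. Qed.

Lemma inner_entry_le r k : k \in nth [::] (stair_rows 1 n.-1) r -> 0 < k <= m.
Proof.
move=> kr; have : k \in flatten (stair_rows 1 n.-1).
  apply/flattenP; exists (nth [::] (stair_rows 1 n.-1) r) => //.
  by apply: mem_nth; rewrite ltnNge; apply/negP => le; rewrite nth_default in kr.
by rewrite flatten_stair_rows prednK // mem_iota add1n ltnS.
Qed.

Lemma perm_T0E : perm_T0 s =
  [seq rcons (nth [::] (stair_rows 1 n.-1) r) (outer_entry r) | r <- iota 0 n].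
Proof.
rewrite /perm_T0 /T0 inner_tableauE -map_comp; apply/eq_in_map => r.
rewrite mem_iota => /andP[_ ltr] /=; rewrite map_rcons; congr rcons.
  rewrite -[RHS]map_id; apply/eq_in_map => k /inner_entry_le/andP[_ lek].
  by rewrite /perm_entry (eqP (lek : k - m == 0)).
rewrite /perm_entry addKn /outer_entry.
have lt : n - r.+1 < n by lia.
have -> : n - r = (n - r.+1).+1 by lia.
by rewrite /letter insubT /= (perm_natE s (Ordinal lt)).
Qed.

Lemma nth_perm_T0 r : r < n -> nth [::] (perm_T0 s) r =
  rcons (nth [::] (stair_rows 1 n.-1) r) (outer_entry r).
Proof. by move=> lt; rewrite perm_T0E (nth_map 0) ?size_iota // nth_iota. Qed.

Lemma size_perm_T0 : size (perm_T0 s) = n.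
Proof. by rewrite perm_T0E size_map size_iota. Qed.

Lemma size_inner_row r : size (nth [::] (stair_rows 1 n.-1) r) = n - r.+1.
Proof. by have [b [-> _]] := nth_stair_rows 1 n.-1 r; rewrite size_iota; lia. Qed.

Lemma perm_flatten_rcons (T : eqType) (f : nat -> seq T) (g : nat -> T) rs :
  perm_eq (flatten [seq rcons (f r) (g r) | r <- rs])
          (flatten [seq f r | r <- rs] ++ [seq g r | r <- rs]).
Proof.
elim: rs => [|r rs IH] //=.
rewrite -cats1 -!catA perm_cat2l perm_sym -cat1s perm_catCA perm_cat2l perm_sym.
exact: IH.
Qed.

Lemma standard_perm_T0 : standard (m + n) (perm_T0 s).
Proof.
have [inv1 inv2] := perm_nat_inverses s.
apply/and4P; split.
- rewrite perm_T0E; apply: (perm_trans (perm_flatten_rcons _ _ _)).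
  have -> : flatten [seq nth [::] (stair_rows 1 n.-1) r | r <- iota 0 n] = iota 1 m.
    have -> : iota 0 n = iota 0 n.-1 ++ [:: n.-1].
      by rewrite -{1}(prednK n_gt0) -addn1 iotaD.
    rewrite map_cat flatten_cat /= nth_default ?size_stair_rows // !cats0.
    have -> : [seq nth [::] (stair_rows 1 n.-1) r | r <- iota 0 n.-1] = stair_rows 1 n.-1.
      by rewrite -[X in iota 0 X](size_stair_rows 1 n.-1) map_nth_iota0 // take_size.
    by rewrite flatten_stair_rows prednK.
  rewrite iotaD perm_cat2l; apply: uniq_perm; rewrite ?iota_uniq //.
    rewrite map_inj_in_uniq ?iota_uniq // => r1 r2; rewrite !mem_iota /outer_entry.
    move=> l1 l2 /addnI [] E; have [|_ E1] := inv1 (n - r1.+1); first by lia.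
    have [|_ E2] := inv1 (n - r2.+1); first by lia.
    by move: E1; rewrite E E2; lia.
  move=> z; rewrite mem_iota; apply/mapP/idP => [[r]|lez].
    rewrite mem_iota => ltr ->; have [|lt _] := inv1 (n - r.+1); first by lia.
    by rewrite /outer_entry; lia.
  have [|lt E] := inv2 (z - m.+1); first by lia.
  exists (n - (perm_nat s^-1%g (z - m.+1)).+1); rewrite ?mem_iota /outer_entry; first by lia.
  rewrite (_ : n - _ = perm_nat s^-1%g (z - m.+1)) ?E; lia.
- by rewrite perm_T0E; apply/mapP => -[r _]; case: (nth _ _ _).
- rewrite perm_T0E; apply/allP => row /mapP[r _ ->]; apply/sorted_rowP => i.
  rewrite size_rcons ltnS => lti; rewrite !nth_rcons lti.
  have [b [Eb _]] := nth_stair_rows 1 n.-1 r.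
  case: (ltngtP i.+1 (size (nth [::] (stair_rows 1 n.-1) r))) => [lt|gt|Ei].
  + by move: lt; rewrite Eb size_iota => lt; rewrite !nth_iota //; lia.
  + by lia.
  + have /andP[_ le] := inner_entry_le (mem_nth 0 lti).
    by rewrite /outer_entry addnS ltnS (leq_trans le (leq_addr _ _)).
- apply/(sortedP [::]) => r; rewrite size_perm_T0 => ltr.
  rewrite !nth_perm_T0 ?(ltnW ltr) //.
  have [b [E1 E2]] := nth_stair_rows 1 n.-1 r.
  apply/row_aboveP; rewrite !size_rcons E1 E2 !size_iota; split; first by lia.
  move=> j; rewrite ltnS => lej; rewrite !nth_rcons !size_iota.
  have lt1 : j < n.-1 - r by lia.
  rewrite lt1 nth_iota //; case: (ltnP j (n.-1 - r.+1)) => [lt2|ge2]; first by rewrite nth_iota //; lia.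
  rewrite ifT; last by lia.
  (* the corner of row r, an outer entry, lies below an inner entry *)
  have := @inner_entry_le r (b + j); rewrite E1 mem_iota /outer_entry; lia.
Qed.

(** The entry m + sigma(j) sits in column j, so the outer letters read
    sigma^-1. *)
Lemma column_word_perm_T0 : column_word (m + n) (perm_T0 s) =
  stair_word n.-1 ++ mkseq (perm_nat s^-1%g) n.
Proof.
have tT := standard_tab standard_perm_T0; have [inv1 inv2] := perm_nat_inverses s.
rewrite /column_word /mkseq iotaD map_cat; congr (_ ++ _).
  have -> : [seq entry_col (perm_T0 s) b.+1 | b <- iota 0 m] =
            [seq entry_col (perm_T0 s) z | z <- iota 1 m].
    by rewrite (iotaDl 1 0) -map_comp; apply: eq_map.
  have -> : iota 1 m = flatten (stair_rows 1 n.-1) by rewrite flatten_stair_rows prednK.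
  rewrite map_flatten_cols ?stair_word_rows //.
  move=> r c ltc; have ltr : r < n by move: ltc; rewrite size_inner_row; lia.
  have := @entry_col_nth _ r c tT; rewrite nth_perm_T0 // size_rcons nth_rcons ltc.
  by rewrite ltnS (ltnW ltc) => ->.
rewrite add0n -{1}[m]addn0 iotaDl -map_comp; apply/eq_in_map => b.
rewrite mem_iota => /andP[_ ltb] /=; have [ltj Ej] := inv2 b ltb.
set j := perm_nat _ b in ltj Ej *.
have := @entry_col_nth _ (n - j.+1) j tT; have ltr : n - j.+1 < n by lia.
have Er : n - (n - j.+1).+1 = j by lia.
rewrite nth_perm_T0 // size_rcons nth_rcons size_inner_row Er ltnn eqxx.
by rewrite /outer_entry Er Ej addnS => ->.
Qed.

Lemma shape_perm_T0 : shape (perm_T0 s) = staircase n.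
Proof.
have szst : size (staircase n) = n by rewrite size_rev size_iota.
apply: (@eq_from_nth _ 0); rewrite size_map size_perm_T0 ?szst // => r ltr.
rewrite (nth_map [::]) ?size_perm_T0 // nth_perm_T0 // size_rcons size_inner_row.
rewrite nth_rev ?size_iota // nth_iota; lia.
Qed.

Lemma rect_word_perm_T0 :
  rect_word m n (column_word (m + n) (perm_T0 s)) =
  column_word n (rskP s) ++
  vacated_word (fun k => entry_col (rskQ s) k.+1) n.-1.
Proof.
rewrite column_word_perm_T0 rskQE !rskPE.
have := rect_word_permutation (perm_nat_inverses s) n_gt0.
by rewrite size_stair_word prednK.
Qed.

End StaircaseTableau.

(** The rectified word of sigma T0 is a function of P(sigma) and Q(sigma), and
    rectification is injective on lattice words. *)
Lemma rsk_inj n (s t : 'S_n) : rskP s = rskP t -> rskQ s = rskQ t -> s = t.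
Proof.
case: (posnP n) => [n0|n0 EP EQ].
  by move=> _ _; apply/permP => i; case: i => i lti; exfalso; rewrite n0 in lti.
have ss := standard_perm_T0 s n0; have st := standard_perm_T0 t n0.
have E : column_word ('C(n, 2) + n) (perm_T0 s) = column_word ('C(n, 2) + n) (perm_T0 t).
  apply: (@rect_word_inj 'C(n, 2) n); try exact: lattice_column_word.
  by rewrite !rect_word_perm_T0 // EP EQ.
move: E; rewrite !column_word_perm_T0 // => /eqP.
rewrite eqseq_cat // => /andP[_ /eqP/perm_nat_inj E].
by apply: invg_inj.
Qed.

Lemma restrict_rect n (s : 'S_n) A : 0 < n -> standard ('C(n, 2) + n) A ->
  column_word ('C(n, 2) + n) A =
    rect_word 'C(n, 2) n (column_word ('C(n, 2) + n) (perm_T0 s)) ->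
  restrict n A = rskP s.
Proof.
move=> n0 sA E; have sP : standard n (rskP s) by case/and3P: (std_pair_rsk s).
apply: (column_word_inj (standard_restrict (leq_addl _ _) sA) sP).
rewrite (column_word_restrict (leq_addl _ _) sA) E rect_word_perm_T0 //.
by rewrite take_size_cat // size_column_word.
Qed.

(** * Jucys-Murphy elements and intertwining relations *)

From mathcomp Require Import generic_quotient ring_quotient boolp.
From mathcomp Require Import classical_sets reals complex monalg.
Require Import Defs.

Import GRing.Theory.
Local Open Scope ring_scope.

Section JucysMurphy.
Variables (C : fieldType) (N : nat).
Local Notation A := (gralg C N).
Local Notation g := (@gperm C N).
Local Notation X := (jucys_murphy C N).

Lemma letterS k (i : 'I_N) : k = i.+1 -> letter N k = Some i.
Proof. by move=> ->; rewrite /letter valK. Qed.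

Lemma letterP k : (1 <= k <= N)%N -> exists2 i : 'I_N, letter N k = Some i & k = i.+1.
Proof.
case: k => // k lt; exists (Ordinal lt) => //.
by rewrite (@letterS _ (Ordinal lt)).
Qed.

Lemma transp_ord (i j : 'I_N) : transp N i.+1 j.+1 = tperm i j.
Proof. by rewrite /transp (letterS (erefl i.+1)) (letterS (erefl j.+1)). Qed.

Lemma gperm_mul s t : g s * g t = g (t * s)%g.
Proof. by rewrite -gpermM. Qed.

Lemma gperm_tperm2 (i j : 'I_N) : g (tperm i j) * g (tperm i j) = 1.
Proof. by rewrite gperm_mul tperm2. Qed.

Lemma gperm_conj (i j k l : 'I_N) :
  g (tperm i j) * g (tperm k l) * g (tperm i j) =
  g (tperm (tperm i j k) (tperm i j l)).
Proof. by rewrite !gperm_mul -tpermJ conjgE tpermV. Qed.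

Variables (i j : 'I_N).
Hypothesis ij : j = i.+1 :> nat.
Local Notation s := (g (tperm i j)).

(** Conjugation by (i i+1) maps the summands of X_i to those of X_(i+1),
    except (i i+1) itself. *)
Lemma jm_cross : s * X i.+1 * s + s = X j.+1.
Proof.
have -> : X j.+1 = \sum_(1 <= l < i.+1) g (transp N l j.+1) + s.
  by rewrite /jucys_murphy {1}ij big_nat_recr //= transp_ord.
rewrite /jucys_murphy; congr (_ + _).
rewrite mulr_sumr mulr_suml [LHS]big_nat [RHS]big_nat; apply: eq_bigr => k /andP[k1 ltk].
have [|l _ Ek] := @letterP k; first by have := ltn_ord i; lia.
rewrite Ek !transp_ord gperm_conj tpermL tpermD //.
  by apply/eqP => E; rewrite E -Ek ltnn in ltk.
by apply/eqP => E; rewrite -E ij in Ek; lia.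
Qed.

(** Conjugation by (i i+1) permutes the summands of X_k: it exchanges (i k)
    with (i+1 k) if i+1 < k, and otherwise fixes all of them. *)
Lemma jm_far (k : 'I_N) : k != i -> k != j -> s * X k.+1 = X k.+1 * s.
Proof.
move=> ki kj; suff E : s * X k.+1 * s = X k.+1.
  by rewrite -[in RHS]E -mulrA gperm_tperm2 mulr1.
have term l : (1 <= l <= N)%N ->
    exists2 a : 'I_N, l = a.+1 & g (transp N l k.+1) = g (tperm a k).
  by case/letterP => a _ ->; exists a; rewrite ?transp_ord.
rewrite /jucys_murphy mulr_sumr mulr_suml.
have ltk := ltn_ord k; have lti := ltn_ord i; have ltj := ltn_ord j.
have sk : tperm i j k = k by rewrite tpermD // eq_sym.
have conj l : l != i -> l != j -> s * g (tperm l k) * s = g (tperm l k).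
  by move=> li lj; rewrite gperm_conj sk tpermD // eq_sym.
have same (a b : nat) : (1 <= a)%N -> (b <= N)%N ->
    (forall l : 'I_N, (a <= l.+1 < b)%N -> l != i /\ l != j) ->
    \sum_(a <= l < b) s * g (transp N l k.+1) * s =
    \sum_(a <= l < b) g (transp N l k.+1).
  move=> a1 bN nij; rewrite [LHS]big_nat [RHS]big_nat; apply: eq_bigr => l lab.
  have [|c Ec ->] := term l; first by lia.
  by have [|ci cj] := nij c; rewrite -?Ec //; apply: conj.
have ne (l : 'I_N) : (l : nat) <> i -> (l : nat) <> j -> l != i /\ l != j.
  by move=> li lj; split; apply/eqP => E; rewrite E in li lj.
have [lt|gt] := ltnP k i.
  by apply: same => // l lb; apply: ne; lia.
have gtj : (j < k)%N.
  by have ki' : (k : nat) <> i by [move=> /val_inj E; rewrite E eqxx in ki];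
     have kj' : (k : nat) <> j by [move=> /val_inj E; rewrite E eqxx in kj]; lia.
have split3 F : \sum_(1 <= l < k.+1) F l = \sum_(1 <= l < i.+1) F l +
    (F i.+1 + F j.+1 + \sum_(j.+2 <= l < k.+1) F l) :> A.
  rewrite (big_cat_nat (n := i.+1)) //=; congr (_ + _).
  by rewrite big_ltn; [rewrite -ij big_ltn ?addrA //; lia | lia].
rewrite !split3 !same //; try lia; first last.
- by move=> l lb; apply: ne; lia.
- by move=> l lb; apply: ne; lia.
rewrite !transp_ord !gperm_conj sk tpermL tpermR.
by rewrite [g _ + g _]addrC.
Qed.

End JucysMurphy.

Section Intertwining.
Variables (C : fieldType) (U : lmodType C) (S X1 X2 : {linear U -> U}).
Hypothesis SS : forall u, S (S u) = u.
Hypothesis cross : forall u, S (X1 (S u)) + S u = X2 u.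

Lemma cross1 u : X1 (S u) = S (X2 u) - u.
Proof. by rewrite -cross linearD !SS addrK. Qed.

Lemma cross2 u : X2 (S u) = S (X1 u) + u.
Proof. by rewrite -cross !SS. Qed.

Variables (x1 x2 : C) (u : U).
Hypothesis (wu1 : X1 u = x1 *: u) (wu2 : X2 u = x2 *: u).
Local Notation phi d u := (d *: S u + u).

Lemma phi_weight1 : X1 (phi (x1 - x2) u) = x2 *: phi (x1 - x2) u.
Proof.
rewrite linearD linearZ cross1 wu1 wu2 linearZ /= scalerBr scalerDr !scalerA.
by rewrite [x2 * _]mulrC -!addrA [in LHS]scalerBl opprB subrK.
Qed.

Lemma phi_weight2 : X2 (phi (x1 - x2) u) = x1 *: phi (x1 - x2) u.
Proof.
rewrite linearD linearZ cross2 wu1 wu2 linearZ /= !scalerDr !scalerA.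
by rewrite [x1 * _]mulrC -!addrA; congr (_ + _); rewrite scalerBl subrK.
Qed.

(** The scalar by which phi phi acts; when it does not vanish, phi maps
    eigenvectors to nonzero vectors. *)
Lemma phi_phi d : phi (- d) (phi d u) = (1 - d ^+ 2) *: u.
Proof.
rewrite linearD linearZ SS /= scalerDr scalerA.
rewrite -!addrA [- d *: S u + _]addrA scaleNr addNr add0r.
by rewrite mulNr -expr2 scaleNr scalerBl scale1r addrC.
Qed.

End Intertwining.

(** * Intertwiners on an eigenbasis *)

Definition pack_linear (C : pzRingType) (U V : lmodType C) (f : U -> V) (lf : linear f) :
  {linear U -> V} := HB.pack f (GRing.isLinear.Build C U V *:%R f lf).

Section Eigenbasis.
Variables (C : fieldType) (U : vectType C) (r : nat) (b : r.-tuple U).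
Hypothesis b_basis : basis_of fullv b.

Lemma coord_eigen (f : {linear U -> U}) (e : 'I_r -> C) x u i :
  (forall j : 'I_r, f b`_j = e j *: b`_j) -> f u = x *: u -> coord b i u != 0 -> e i = x.
Proof.
move=> fb fu ci; have ub : u = \sum_j coord b j u *: b`_j.
  by apply: coord_basis b_basis _; apply: memvf.
have E : f u = \sum_j (coord b j u * e j) *: b`_j.
  by rewrite {1}ub linear_sum; apply: eq_bigr => j _; rewrite linearZ /= fb scalerA.
have := congr1 (coord b i) E; rewrite fu linearZ /= coord_sum_free ?(basis_free b_basis) //.
by move/eqP; rewrite mulrC (inj_eq (mulfI ci)) => /eqP.
Qed.

Lemma basis_expand u : u = \sum_j coord b j u *: b`_j.
Proof. by apply: coord_basis b_basis _; apply: memvf. Qed.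

Lemma basis_linear (V : lmodType C) (F : 'I_r -> V) :
  exists f : {linear U -> V}, forall i : 'I_r, f b`_i = F i.
Proof.
have [f fE] := linear_of_free b (codom F).
have free_b := basis_free b_basis.
have := fE free_b; rewrite size_codom card_ord size_tuple => /(_ erefl) E.
exists f => i; have := congr1 (fun s => nth 0 s i) E.
rewrite (nth_map 0) ?size_tuple // => ->.
rewrite (nth_map i) ?size_enum_ord // nth_ord_enum //.
Qed.

End Eigenbasis.

Section Weights.
Variables (C : fieldType) (N : nat) (U : vectType C).
Variable act : gralg C N -> U -> U.
Hypothesis act_linear : forall x, linear (act x).
Local Notation X := (jucys_murphy C N).

Definition has_weight (x : nat -> C) (u : U) : Prop :=
  forall k, (1 <= k <= N)%N -> act (X k) u = x k *: u.

Definition intertwined (k : nat) (d : C) (u : U) : U :=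
  if (d == 1) || (d == -1) then - 2^-1 *: u
  else ((d + 1) * (d - 1))^-1 *: (d *: act (gperm C (simple_transp N k)) u + u).

Lemma intertwined_linear k d : linear (intertwined k d).
Proof.
move=> c x y; rewrite /intertwined; case: ifP => _.
  by rewrite scalerDr !scalerA mulrC.
rewrite act_linear [d *: _]scalerDr [d *: (c *: _)]scalerA [d * c]mulrC -scalerA.
by rewrite addrACA -scalerDr [LHS]scalerDr !scalerA mulrC.
Qed.

Variables (r : nat) (b : r.-tuple U) (e : 'I_r -> nat -> C).
Hypothesis b_basis : basis_of fullv b.
Hypothesis b_weight : forall i : 'I_r, has_weight (e i) b`_i.

(** The prescribed values on joint eigenvectors are consistent: the linear map
    defined by them on an eigenbasis takes them on every joint eigenvector,
    because all the basis vectors involved in it have its weights. *)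
Lemma is_intertwiner_intertwiner k : (1 <= k < N)%N ->
  is_intertwiner act k (intertwiner act k).
Proof.
move=> k1; rewrite /intertwiner; apply: (@xgetPex _ 0 [set f | is_intertwiner act k f]%classic).
have [f fE] := basis_linear b_basis (fun i => intertwined k (e i k - e i k.+1) b`_i).
exists (linfun f) => x u wu.
pose g := pack_linear (intertwined_linear k (x k - x k.+1)).
suff E : f u = g u by rewrite lfunE; exact: E.
rewrite {1 2}(basis_expand b_basis u) !linear_sum.
apply: eq_bigr => i _; rewrite !linearZ /= fE.
have [->|ci] := eqVneq (coord b i u) 0; first by rewrite !scale0r.
have E j : (1 <= j <= N)%N -> e i j = x j.
  move=> jN; apply: (coord_eigen b_basis (f := pack_linear (act_linear (X j)))
    (e := fun i => e i j) (u := u) (i := i)) => //.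
    by move=> i'; apply: b_weight.
  by apply: wu.
by rewrite !E //; lia.
Qed.

End Weights.

Definition char0 (C : fieldType) : Prop := forall n, (n%:R == 0 :> C) = (n == 0%N).

Lemma intr_eq0_char0 (C : fieldType) (a : int) : char0 C ->
  (a%:~R == 0 :> C) = (a == 0).
Proof.
move=> C0; case: a => n; first by rewrite -pmulrn C0.
by rewrite NegzE mulrNz oppr_eq0 oppr_eq0 -pmulrn C0.
Qed.

Lemma intr_inj_char0 (C : fieldType) (a b : int) : char0 C ->
  (a%:~R == b%:~R :> C) = (a == b).
Proof. by move=> C0; rewrite -subr_eq0 -mulrzBr intr_eq0_char0 // subr_eq0. Qed.

(** Both sides of the group algebra are treated at once: act is multiplication
    on one side, Z k multiplication by X_k on the other side, and a basis
    vector is labelled by the tableau l p that act sees and the tableau o p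
    that Z sees. *)
Section LabelledBasis.
Variables (C : fieldType) (N : nat).
Hypothesis C0 : char0 C.
Local Notation A := (gralg C N).
Local Notation X := (jucys_murphy C N).
Local Notation sg k := (gperm C (simple_transp N k)).

Variables (act : A -> A -> A) (Z : nat -> A -> A).
Hypothesis act_linear : forall x, linear (act x).
Hypothesis Z_linear : forall k, linear (Z k).
Hypothesis Z_act : forall k x u, Z k (act x u) = act x (Z k u).
Hypothesis act_inv : forall k u, (1 <= k < N)%N -> act (sg k) (act (sg k) u) = u.
Hypothesis act_cross : forall k u, (1 <= k < N)%N ->
  act (sg k) (act (X k) (act (sg k) u)) + act (sg k) u = act (X k.+1) u.
Hypothesis act_far : forall k j u, (1 <= k < N)%N -> (1 <= j <= N)%N ->
  j != k -> j != k.+1 -> act (X j) (act (sg k) u) = act (sg k) (act (X j) u).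

Variables (vv : tableau * tableau -> A) (l o : tableau * tableau -> tableau).
Hypothesis vv_basis : basis_of fullv [seq vv p | p <- std_pairs N].
Hypothesis vv_act : forall p k, p \in std_pairs N -> (1 <= k <= N)%N ->
  act (X k) (vv p) = (content (l p) k)%:~R *: vv p.
Hypothesis vv_Z : forall p k, p \in std_pairs N -> (1 <= k <= N)%N ->
  Z k (vv p) = (content (o p) k)%:~R *: vv p.
Hypothesis lo_std : forall p, p \in std_pairs N -> standard N (l p) /\ standard N (o p).
Hypothesis lo_inj : {in std_pairs N &, forall p q, l p = l q -> o p = o q -> p = q}.

Let r := size (std_pairs N).
Let label (i : 'I_r) := tnth (in_tuple (std_pairs N)) i.
Let b : r.-tuple A := [tuple of map vv (in_tuple (std_pairs N))].

Let b_basis : basis_of fullv b. Proof. exact: vv_basis. Qed.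

Let bE (i : 'I_r) : b`_i = vv (label i).
Proof. by rewrite -[b`_i]tnth_nth tnth_map. Qed.

Let label_in i : label i \in std_pairs N.
Proof. exact: mem_tnth. Qed.

Let label_inj : injective label.
Proof.
have /map_uniq/uniqP u := free_uniq (basis_free vv_basis).
move=> i j; rewrite /label !(tnth_nth ([::], [::])) /= => E.
by apply: val_inj; apply: u E; rewrite inE.
Qed.

(** Weight spaces for both sides together are lines, because contents
    determine column words. *)
Lemma weight_vector u (w : seq nat) T :
  u != 0 -> lattice w -> size w = N -> standard N T ->
  (forall k, (k < N)%N -> act (X k.+1) u = (word_content w k)%:~R *: u) ->
  (forall k, (k < N)%N -> Z k.+1 u = (content T k.+1)%:~R *: u) ->
  exists2 p, p \in std_pairs N & [/\ column_word N (l p) = w, o p = T &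
    exists2 c, c != 0 & u = c *: vv p].
Proof.
move=> u0 lw szw sT wu zu.
have lab i : coord b i u != 0 -> column_word N (l (label i)) = w /\ o (label i) = T.
  move=> ci; have [sl so] := lo_std (label_in i); split.
    apply: word_content_inj => //; rewrite ?size_column_word //.
      exact: lattice_column_word.
    move=> k ltk; rewrite -content_column_word //; apply/eqP; rewrite -(intr_inj_char0 _ _ C0).
    apply/eqP; apply: (coord_eigen b_basis (f := pack_linear (act_linear (X k.+1)))
      (e := fun i => (content (l (label i)) k.+1)%:~R) _ _ ci).
      by move=> j; rewrite /= bE vv_act.
    exact: wu.
  apply: (column_word_inj so sT); apply: word_content_inj;
    rewrite ?size_column_word //; try exact: lattice_column_word.
  move=> k ltk; rewrite -!content_column_word //; apply/eqP; rewrite -(intr_inj_char0 _ _ C0).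
  apply/eqP; apply: (coord_eigen b_basis (f := pack_linear (Z_linear k.+1))
    (e := fun i => (content (o (label i)) k.+1)%:~R) _ _ ci).
    by move=> j; rewrite /= bE vv_Z.
  exact: zu.
have [i ci] : exists i, coord b i u != 0.
  apply/existsP; apply: contraNT u0; rewrite negb_exists => /forallP c0.
  rewrite (basis_expand b_basis u) big1 // => i _.
  by have := c0 i; rewrite negbK => /eqP->; rewrite scale0r.
have [li oi] := lab i ci; exists (label i) => //; split=> //.
exists (coord b i u) => //; rewrite {1}(basis_expand b_basis u) (bigD1 i) //= bE.
rewrite big1 ?addr0 // => j ji; have [->|cj] := eqVneq (coord b j u) 0.
  by rewrite scale0r.
have [lj oj] := lab j cj; case/eqP: ji; apply: label_inj.
apply: lo_inj; rewrite ?label_in // ?oi //.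
have [sj _] := lo_std (label_in j); have [si _] := lo_std (label_in i).
by apply: (column_word_inj sj si); rewrite lj li.
Qed.

(** If the pair is frozen, phi-tilde_k is the scalar -1/2. Otherwise it is a
    multiple of phi, which exchanges the weights k and k + 1 and does not
    vanish on this vector; the exchanged contents are those of the exchanged
    word. *)
Lemma intertwiner_basis k p : p \in std_pairs N -> (1 <= k < N)%N ->
  exists2 q, q \in std_pairs N &
    [/\ column_word N (l q) = exchange k (column_word N (l p)), o q = o p &
    exists2 c, c != 0 & intertwiner act k (vv p) = c *: vv q].
Proof.
move=> pI kN; have [sl so] := lo_std pI.
pose w := column_word N (l p); have lw : lattice w by apply: lattice_column_word.
have szw : size w = N by apply: size_column_word.
have wE j : (j < N)%N -> act (X j.+1) (vv p) = (word_content w j)%:~R *: vv p.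
  by move=> ltj; rewrite vv_act // -content_column_word.
have zE j : (j < N)%N -> Z j.+1 (vv p) = (content (o p) j.+1)%:~R *: vv p.
  by move=> ltj; rewrite vv_Z.
have vv0 : vv p != 0 by apply: (free_not0 (basis_free vv_basis)); apply: map_f.
have isI : is_intertwiner act k (intertwiner act k).
  apply: (is_intertwiner_intertwiner act_linear (b := b)
    (e := fun i j => (content (l (label i)) j)%:~R)) => //.
  by move=> i j jN; rewrite bE vv_act.
case: k kN isI => // k kN isI.
have := isI (fun j => (word_content w j.-1)%:~R) (vv p).
rewrite /= => -> ; last by case=> // j jN; rewrite wE.
have ltkN : (k.+1 < N)%N by case/andP: kN.
have ltk : (k.+1 < size w)%N by rewrite szw.
rewrite -mulrzBr; set d := word_content w k - _.
have dfr : frozen (height (take k w)) (nth 0%N w k) (nth 0%N w k.+1) = (d == 1) || (d == -1).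
  exact: frozen_content.
have -> : (d%:~R == 1 :> C) || (d%:~R == -1 :> C) = (d == 1) || (d == -1).
  by rewrite -(intr_inj_char0 d 1 C0) -(intr_inj_char0 d (-1) C0) mulrNz.
rewrite -dfr; case: ifPn => fr.
  exists p => //; split=> //.
    by rewrite -/w exchange_frozen.
  by exists (- 2^-1) => //; rewrite oppr_eq0 invr_eq0 C0.
have d1 : (d + 1 != 0) && (d - 1 != 0).
  by move: fr; rewrite dfr negb_or subr_eq0 addr_eq0 andbC.
have dC : ((d%:~R + 1) * (d%:~R - 1) : C) != 0.
  rewrite -[1 in X in X * _]/(1%:~R) -[1 in X in _ * X]/(1%:~R) -mulrzDr -mulrzBr.
  by case/andP: d1 => d1 d2; rewrite mulf_neq0 // intr_eq0_char0.
pose S := pack_linear (act_linear (sg k.+1)).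
pose X1 := pack_linear (act_linear (X k.+1)).
pose X2 := pack_linear (act_linear (X k.+2)).
have SS u : S (S u) = u by apply: act_inv.
have cross u : S (X1 (S u)) + S u = X2 u by apply: act_cross.
set u := _ *: _ + _.
have w1 : X1 (vv p) = (word_content w k)%:~R *: vv p by apply/wE/ltnW.
have w2 : X2 (vv p) = (word_content w k.+1)%:~R *: vv p by apply: wE.
have ud : u = ((word_content w k)%:~R - (word_content w k.+1)%:~R) *: S (vv p) + vv p.
  by rewrite -mulrzBr.
have u0 : u != 0.
  apply/negP => /eqP u0; have := phi_phi SS (vv p) d%:~R.
  rewrite -/u u0 linear0 scaler0 addr0 => /esym/eqP; rewrite scaler_eq0 (negPf vv0) orbF.
  rewrite -opprB oppr_eq0 subr_sqr_1 mulrC.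
  by rewrite (negPf dC).
have [q qI [lq oq [c c0 uE]]] : exists2 q, q \in std_pairs N &
   [/\ column_word N (l q) = exchange k.+1 w, o q = o p & exists2 c, c != 0 & u = c *: vv q].
  apply: weight_vector => //.
  - exact: lattice_exchange.
  - by rewrite size_exchange.
  - move=> j ltj; rewrite word_content_exchange //.
    case: eqP => [->|nek]; first by rewrite ud; exact: (phi_weight1 SS cross w1 w2).
    case: eqP => [->|nek1]; first by rewrite ud; exact: (phi_weight2 SS cross w1 w2).
    have far : act (X j.+1) (S (vv p)) = S (act (X j.+1) (vv p)).
      by apply: act_far => //; rewrite eqSS; apply/eqP.
    pose Y := pack_linear (act_linear (X j.+1)).
    rewrite -[act _ u]/(Y u) linearD linearZ /= -/S far wE // linearZ /= scalerDr !scalerA.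
    by rewrite mulrC.
  - move=> j ltj; pose Y := pack_linear (Z_linear j.+1).
    rewrite -[Z _ u]/(Y u) linearD linearZ /= Z_act zE //.
    by rewrite -[act _ (_ *: _)]/(S _) linearZ /= scalerDr !scalerA mulrC.
exists q => //; split=> //; exists (((d%:~R + 1) * (d%:~R - 1))^-1 * c).
  by rewrite mulf_neq0 ?invr_eq0.
by rewrite uE scalerA.
Qed.

(** The invariant of rectification: up to a nonzero scalar the vector stays in
    the weight basis, with a word that evolves on the acting side and a fixed
    tableau on the other side. *)
Definition carries (T : tableau) (w : seq nat) (u : A) : Prop :=
  exists2 q, q \in std_pairs N & [/\ column_word N (l q) = w, o q = T &
    exists2 c, c != 0 & u = c *: vv q].

Lemma carries_intertwiner T w u k : (1 <= k < N)%N ->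
  carries T w u -> carries T (exchange k w) (intertwiner act k u).
Proof.
move=> kN [p pI [<- <- [c c0 ->]]].
have [q qI [lq oq [d d0 E]]] := intertwiner_basis pI kN.
exists q => //; split=> //; exists (c * d); first by rewrite mulf_neq0.
by rewrite linearZ /= E scalerA.
Qed.

Lemma carries_jdt T n k w u : (1 <= k)%N -> (k + n <= N)%N ->
  carries T w u -> carries T (jdt_word n k w) (jdt act n k u).
Proof.
rewrite /jdt_word /jdt; elim: n k w u => [|n IH] k w u k1 kN uT //.
apply: IH; rewrite ?leqW // ?addSnnS //.
by apply: carries_intertwiner => //; rewrite k1 (leq_trans _ kN) // addnS ltnS leq_addr.
Qed.

Lemma carries_rect T m n w u : (m + n <= N)%N ->
  carries T w u -> carries T (rect_word m n w) (rect act m n u).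
Proof.
rewrite /rect_word /rect; elim: m w u => [|m IH] w u mN uT //.
have -> : iota 1 m.+1 = rcons (iota 1 m) m.+1 by rewrite -[in LHS](addn1 m) iotaD cats1 add1n.
rewrite rev_rcons /=; apply: IH; first exact: ltnW.
exact: carries_jdt.
Qed.

End LabelledBasis.

(** * Rectification of weight vectors *)

Section TwoSided.
Variables (C : fieldType) (N : nat).
Hypothesis C0 : char0 C.
Local Notation A := (gralg C N).
Local Notation X := (jucys_murphy C N).
Local Notation sg k := (gperm C (simple_transp N k)).

Lemma left_act_linear x : linear (@left_act C N x).
Proof. by move=> c u w; rewrite /left_act mulrDr scalerAr. Qed.

Lemma right_act_linear x : linear (@right_act C N x).
Proof. by move=> c u w; rewrite /right_act mulrDl scalerAl. Qed.

Lemma simple_transp_ord k : (1 <= k < N)%N -> exists i j : 'I_N,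
  [/\ k = i.+1, j = i.+1 :> nat & simple_transp N k = tperm i j].
Proof.
case: k => // k ltk; have ltk' : (k < N)%N := ltnW ltk.
exists (Ordinal ltk'), (Ordinal (ltk : (k.+1 < N)%N)); split=> //.
by rewrite /simple_transp (transp_ord (Ordinal ltk') (Ordinal ltk)).
Qed.

Lemma sg_inv k : (1 <= k < N)%N -> sg k * sg k = 1.
Proof. by case/simple_transp_ord => i [j [_ _ ->]]; apply: gperm_tperm2. Qed.

Lemma sg_cross k : (1 <= k < N)%N -> sg k * X k * sg k + sg k = X k.+1.
Proof.
by case/simple_transp_ord => i [j [-> ij ->]]; rewrite -{2}ij; apply: jm_cross.
Qed.

Lemma sg_far k j : (1 <= k < N)%N -> (1 <= j <= N)%N -> j != k -> j != k.+1 ->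
  sg k * X j = X j * sg k.
Proof.
case/simple_transp_ord => i [i' [-> ii' ->]]; case: j => // j ltj ji ji'.
apply: (@jm_far C N i i' ii' (Ordinal (ltj : (j < N)%N))); apply/eqP => /(congr1 val) /= E.
  by rewrite E eqxx in ji.
by rewrite E ii' eqxx in ji'.
Qed.

Variable v : tableau -> tableau -> A.
Hypothesis wb : weight_basis v.
Let vv (p : tableau * tableau) := v p.1 p.2.

Lemma std_pairs_std p : p \in std_pairs N ->
  [/\ standard N p.1, standard N p.2 & std_pair N p.1 p.2].
Proof. by case: p => T T'; rewrite mem_std_pairs => sp; case/and3P: (sp). Qed.

Let wbl p k : p \in std_pairs N -> (1 <= k <= N)%N ->
  X k * vv p = (content p.1 k)%:~R *: vv p.
Proof. by case/std_pairs_std=> _ _ sp kN; have [] := wb.2 _ _ sp k kN. Qed.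

Let wbr p k : p \in std_pairs N -> (1 <= k <= N)%N ->
  vv p * X k = (content p.2 k)%:~R *: vv p.
Proof. by case/std_pairs_std=> _ _ sp kN; have [] := wb.2 _ _ sp k kN. Qed.

Lemma left_carries_rect T m n w u : (m + n <= N)%N ->
  carries vv fst snd T w u ->
  carries vv fst snd T (rect_word m n w) (rect (@left_act C N) m n u).
Proof.
apply: (@carries_rect _ _ C0 (@left_act C N) (fun k => right_act (X k))) => //.
- exact: left_act_linear.
- by move=> k; apply: right_act_linear.
- by move=> k x y; rewrite /left_act /right_act mulrA.
- by move=> k y kN; rewrite /left_act mulrA sg_inv ?mul1r.
- by move=> k y kN; rewrite /left_act !mulrA -mulrDl sg_cross.
- by move=> k j y kN jN jk jk'; rewrite /left_act !mulrA sg_far.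
- exact: wb.1.
- by move=> p /std_pairs_std[].
- by move=> [? ?] [? ?] _ _ /= -> ->.
Qed.

Lemma right_carries_rect T m n w u : (m + n <= N)%N ->
  carries vv snd fst T w u ->
  carries vv snd fst T (rect_word m n w) (rect (@right_act C N) m n u).
Proof.
apply: (@carries_rect _ _ C0 (@right_act C N) (fun k => left_act (X k))) => //.
- exact: right_act_linear.
- by move=> k; apply: left_act_linear.
- by move=> k x y; rewrite /left_act /right_act mulrA.
- by move=> k y kN; rewrite /right_act -mulrA sg_inv ?mulr1.
- by move=> k y kN; rewrite /right_act -!mulrA -mulrDr mulrA sg_cross.
- by move=> k j y kN jN jk jk'; rewrite /right_act -!mulrA sg_far.
- exact: wb.1.
- by move=> p /std_pairs_std[].
- by move=> [? ?] [? ?] _ _ /= -> ->.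
Qed.

End TwoSided.

Section Rectify.
Variables (C : fieldType) (n : nat).
Hypothesis C0 : char0 C.
Local Notation m := 'C(n, 2).
Variable vN : tableau -> tableau -> gralg C (m + n).
Hypothesis wb : weight_basis vN.

(** The left factor changes the first tableau and keeps the second, the right
    factor does the opposite. *)
Lemma rectify_basis A B : std_pair (m + n) A B ->
  exists A' B' : tableau, [/\ std_pair (m + n) A' B', shape A' = shape A,
    column_word (m + n) A' = rect_word m n (column_word (m + n) A),
    column_word (m + n) B' = rect_word m n (column_word (m + n) B) &
    exists2 c, c != 0 & rectify (vN A B) = c *: vN A' B'].
Proof.
move=> sp; have pI : (A, B) \in std_pairs (m + n) by rewrite mem_std_pairs.
pose vv (p : tableau * tableau) := vN p.1 p.2.
have st : carries vv fst snd B (column_word (m + n) A) (vN A B).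
  by exists (A, B) => //; split=> //; exists 1; rewrite ?oner_eq0 // scale1r.
have [[A1 B1] qI [/= cA EB [c c0 Ec]]] := left_carries_rect C0 wb (leqnn _) st.
subst B1.
have st2 : carries vv snd fst A1 (column_word (m + n) B)
    (rect (@left_act C (m + n)) m n (vN A B)).
  by exists (A1, B) => //; split=> //; exists c.
have [[A2 B2] q2I [/= cB EA [d d0 Ed]]] := right_carries_rect C0 wb (leqnn _) st2.
subst A2; exists A1, B2; rewrite mem_std_pairs in q2I; split=> //.
  rewrite mem_std_pairs in qI; case/and3P: qI => _ _ /eqP ->.
  by case/and3P: sp => _ _ /eqP.
by exists d.
Qed.

Lemma std_pair_perm_T0 (s t : 'S_n) : (0 < n)%N ->
  std_pair (m + n) (perm_T0 s) (perm_T0 t).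
Proof.
by move=> n0; rewrite /std_pair !standard_perm_T0 //= !shape_perm_T0.
Qed.

(** Rectifying the second tableau, that of sigma^-1, yields P(sigma^-1), which
    is Q(sigma). *)
Lemma rectify_perm (s : 'S_n) : (0 < n)%N ->
  exists A B : tableau, [/\ (A, B) \in D_pairs n, restrict n A = rskP s,
    restrict n B = rskQ s &
    exists2 c, c != 0 & rectify (vN (perm_T0 s) (perm_T0 s^-1%g)) = c *: vN A B].
Proof.
move=> n0; have sp := std_pair_perm_T0 s s^-1%g n0.
have [A [B [sAB shA cA cB E]]] := rectify_basis sp.
have [stA stB _] := and3P sAB.
have rA : restrict n A = rskP s := restrict_rect n0 stA cA.
have rB : restrict n B = rskQ s by rewrite rskQE; apply: restrict_rect n0 stB cB.
exists A, B; split=> //; rewrite mem_filter mem_std_pairs sAB andbT /=.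
rewrite shA shape_perm_T0 // eqxx /= rA rB.
by case/and3P: (std_pair_rsk s).
Qed.

End Rectify.

(** * Reduced words, joint eigenvectors and transfer of bases *)

Section Words.
Variable n : nat.

Lemma word_perm_cat (w1 w2 : seq nat) :
  word_perm n (w1 ++ w2) = Defs.pcomp (word_perm n w1) (word_perm n w2).
Proof.
elim: w1 => [|i w1 IH] /=; first by rewrite /Defs.pcomp mulg1.
by rewrite IH /Defs.pcomp mulgA.
Qed.

Definition has_word (s : 'S_n) : Prop := exists w, is_word_of s w.

Lemma has_word_mul (s t : 'S_n) : has_word s -> has_word t -> has_word (s * t)%g.
Proof.
move=> [w1 [a1 E1]] [w2 [a2 E2]]; exists (w2 ++ w1); split.
  by rewrite all_cat a1 a2.
by rewrite word_perm_cat E1 E2.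
Qed.

Lemma has_word_tperm (i j : 'I_n) : (i < j)%N -> has_word (tperm i j).
Proof.
move Ed: (j - i)%N => d; elim: d j Ed => [|d IH] j Ed ltij; first by lia.
have lti := ltn_ord j; have ltj' : (j.-1 < n)%N by lia.
pose j' := Ordinal ltj'.
have adj : has_word (tperm j' j).
  exists [:: (j : nat)]; split; first by rewrite /= andbT; lia.
  rewrite /= /Defs.pcomp mul1g /simple_transp.
  have -> : (j : nat) = j'.+1 by rewrite /=; lia.
  have -> : tperm j' j = transp n j'.+1 j.+1 by rewrite transp_ord.
  by congr transp; rewrite /=; lia.
case: (eqVneq i j') => [->//|ne].
have lt' : (i < j')%N.
  have ne' : (i : nat) <> j' by move=> /val_inj E; rewrite E eqxx in ne.
  by move: ne' => /=; lia.
(* (i j) is (i j-1) conjugated by the simple transposition (j-1 j) *)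
have -> : tperm i j = (tperm j' j * (tperm i j' * tperm j' j))%g.
  rewrite -[X in (X * _)%g](tpermV j' j) -conjgE tpermJ tpermL tpermD //.
    by rewrite eq_sym.
  by apply/eqP => E; rewrite E ltnn in ltij.
by do !apply: has_word_mul => //; apply: IH => //=; lia.
Qed.

Lemma has_word_all (s : 'S_n) : has_word s.
Proof.
have [ts -> _] := prod_tpermP s; elim: ts => [|[i j] ts IH].
  by rewrite big_nil; exists [::].
rewrite big_cons; apply: has_word_mul IH => /=.
case: (ltngtP i j) => [lt|gt|/val_inj ->].
- exact: has_word_tperm.
- by rewrite tpermC; apply: has_word_tperm.
- by rewrite tperm1; exists [::].
Qed.

Lemma some_reduced_wordP (s : 'S_n) : is_word_of s (some_reduced_word s).
Proof.
suff /(xgetPex [::]) [] : exists w, [set w | reduced_word s w]%classic w by [].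
have [w sw] := has_word_all s.
pose P k := `[< exists2 w', is_word_of s w' & size w' = k >].
have exP : exists k, P k by exists (size w); apply/asboolP; exists w.
case: (ex_minnP exP) => k /asboolP[w' sw' <-] mink; exists w'; split=> // w2 sw2.
by apply: mink; apply/asboolP; exists w2.
Qed.

End Words.

Section Shift.
Variables (m n : nat).

Definition shift_fun (s : 'S_n) (x : 'I_(m + n)) : 'I_(m + n) :=
  match split x with inl j => lshift n j | inr k => rshift m (s k) end.

Lemma shift_funK (s t : 'S_n) : cancel s t -> cancel (shift_fun s) (shift_fun t).
Proof.
move=> K x; rewrite /shift_fun; case E: (split x) => [j|k].
  by rewrite (unsplitK (inl j : 'I_m + 'I_n)) -[RHS]splitK E.
by rewrite (unsplitK (inr (s k) : 'I_m + 'I_n)) K -[RHS]splitK E.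
Qed.

(** S_n acting on the last n of m + n letters. *)
Definition shift (s : 'S_n) : 'S_(m + n) :=
  perm (can_inj (shift_funK (permK s))).

Lemma shift_r s k : shift s (rshift m k) = rshift m (s k).
Proof. by rewrite permE /shift_fun (unsplitK (inr k : 'I_m + 'I_n)). Qed.

Lemma shift_l s j : shift s (lshift n j) = lshift n j.
Proof. by rewrite permE /shift_fun (unsplitK (inl j : 'I_m + 'I_n)). Qed.

Lemma shift_ext (p q : 'S_(m + n)) :
  (forall j, p (lshift n j) = q (lshift n j)) ->
  (forall k, p (rshift m k) = q (rshift m k)) -> p = q.
Proof.
move=> El Er; apply/permP => x; rewrite -[x]splitK.
by case: (split x) => [j|k] /=.
Qed.

Lemma shift1 : shift 1%g = 1%g.
Proof. by apply: shift_ext => k; rewrite ?shift_l ?shift_r !perm1. Qed.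

Lemma shiftM s t : shift (s * t)%g = (shift s * shift t)%g.
Proof. by apply: shift_ext => k; rewrite permM ?shift_l ?shift_r ?permM. Qed.

Lemma shift_tperm i j : shift (tperm i j) = tperm (rshift m i) (rshift m j).
Proof.
apply: shift_ext => k; rewrite ?shift_l ?shift_r.
  by rewrite tpermD // eq_rlshift.
by rewrite (inj_tperm _ _ _ (@rshift_inj m n)).
Qed.

End Shift.

Section JointEigenvectors.
Variables (C : fieldType) (I : finType) (K : Type) (U : lmodType C).
Variables (X : K -> {linear U -> U}) (e : I -> K -> C) (u : I -> U).
Hypothesis weight : forall i k, X k (u i) = e i k *: u i.
Hypothesis separated : forall i j, i != j -> exists k, e i k != e j k.
Hypothesis nonzero : forall i, u i != 0.

(** From a relation with c i nonzero, the operators X k - e j k remove the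
    other vectors one by one and keep a nonzero coefficient at i. *)
Lemma joint_eigenvectors_free (c : I -> C) :
  \sum_i c i *: u i = 0 -> forall i, c i = 0.
Proof.
move=> c0 i; apply/eqP; apply/negPn/negP => ci.
suff [c' [ci' c'0 cE]] : exists c' : I -> C,
    [/\ c' i != 0, forall j, j \in enum (predC1 i) -> c' j = 0 &
        \sum_j c' j *: u j = 0].
  move/eqP: cE; rewrite (bigD1 i) //= big1 ?addr0 => [|j ji].
    by rewrite scaler_eq0 (negPf ci') (negPf (nonzero i)).
  by rewrite c'0 ?scale0r // mem_enum.
have : all (predC1 i) (enum (predC1 i)) by apply/allP => j; rewrite mem_enum.
elim: (enum _) => [_|j s IH /= /andP[ji /IH [c' [ci' c's cE]]]]; first by exists c.
have [k ek] := separated ji.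
(* the coefficients after applying [X k - e j k] *)
exists (fun l => c' l * (e l k - e j k)); split.
- by rewrite mulf_neq0 // subr_eq0 eq_sym.
- by move=> l; rewrite inE => /predU1P[->|/c's ->]; rewrite ?subrr ?mulr0 ?mul0r.
have E1 : \sum_l (c' l * e l k) *: u l = 0.
  have := congr1 (X k) cE; rewrite linear0 linear_sum => E; rewrite -[RHS]E.
  apply: eq_bigr => l _.
  by rewrite linearZ /= weight scalerA.
have E2 : \sum_l (c' l * e j k) *: u l = 0.
  have := congr1 ( *:%R (e j k)) cE; rewrite scaler0 scaler_sumr => E.
  rewrite -[RHS]E; apply: eq_bigr => l _.
  by rewrite scalerA mulrC.
transitivity (\sum_l (c' l * e l k) *: u l - \sum_l (c' l * e j k) *: u l).
  by rewrite -sumrB; apply: eq_bigr => l _; rewrite mulrBr scalerBl.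
by rewrite E1 E2 subrr.
Qed.

End JointEigenvectors.

(** A space G of dimension #|I| maps onto V by p, and the images under q of a
    family vs indexed by I are independent. Lifts of the vs along p are then a
    basis of G, hence p is injective and the vs are a basis of V. *)
Section Transfer.
Variables (C : fieldType) (I : finType) (G : vectType C) (V M : lmodType C).
Variables (p : {linear G -> V}) (q : {linear V -> M}) (vs : I -> V).
Hypothesis p_surj : forall x, exists y, p y = x.
Hypothesis dimG : \dim {:G} = #|I|.
Hypothesis free_vs : forall c : I -> C,
  \sum_i c i *: q (vs i) = 0 -> forall i, c i = 0.

Lemma transfer_preimages : exists x : I -> G,
  [/\ forall i, p (x i) = vs i,
      forall y, exists c : I -> C, y = \sum_i c i *: x i &
      forall (W : lmodType C) (F : I -> W),
        exists f : {linear G -> W}, forall i, f (x i) = F i].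
Proof.
pose x i := projT1 (cid (p_surj (vs i))).
have px i : p (x i) = vs i by rewrite /x; case: cid.
pose b : #|I|.-tuple G := [tuple x (enum_val i) | i < #|I|].
have bE (i : 'I_#|I|) : b`_i = x (enum_val i) by rewrite -tnth_nth tnth_mktuple.
have bI (i : I) : b`_(enum_rank i) = x i by rewrite bE enum_rankK.
have reI (W : zmodType) (F : 'I_#|I| -> W) : \sum_i F i = \sum_i F (enum_rank i).
  by rewrite (reindex (@enum_rank I)) //; apply: onW_bij; apply: enum_rank_bij.
have free_b : free b.
  apply/freeP => k k0 i; rewrite -(enum_valK i).
  apply: (@free_vs (fun j => k (enum_rank j))).
  have := congr1 (q \o p) k0; rewrite /= !linear_sum !linear0 reI => E; rewrite -[RHS]E.
  by apply: eq_bigr => j _; rewrite bI !linearZ /= px.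
have b_basis : basis_of fullv b.
  by rewrite basisEfree free_b subvf size_tuple dimG leqnn.
exists x; split=> // [y|W F].
  exists (fun i => coord b (enum_rank i) y).
  rewrite {1}(basis_expand b_basis y) reI.
  by apply: eq_bigr => i _; rewrite bI.
have [f fE] := basis_linear b_basis (fun i => F (enum_val i)).
by exists f => i; have := fE (enum_rank i); rewrite bE enum_rankK.
Qed.

Lemma transfer_span (y : V) : exists c : I -> C, y = \sum_i c i *: vs i.
Proof.
have [x [px span _]] := transfer_preimages; have [z <-] := p_surj y.
have [c ->] := span z; exists c; rewrite linear_sum; apply: eq_bigr => i _.
by rewrite linearZ /= px.
Qed.

Lemma transfer_linear (W : lmodType C) (F : I -> W) :
  exists f : V -> W, linear f /\ forall i, f (vs i) = F i.
Proof.
have [x [px span ext]] := transfer_preimages.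
have [f fE] := ext W F.
have p0 y : p y = 0 -> y = 0.
  have [c ->] := span y => E; rewrite big1 // => i _.
  rewrite (free_vs (c := c)) ?scale0r //.
  have := congr1 q E; rewrite linear0 !linear_sum => E2; rewrite -[RHS]E2.
  by apply: eq_bigr => j _; rewrite !linearZ /= px.
have p_inj y z : p y = p z -> y = z.
  by move=> E; apply/eqP; rewrite -subr_eq0; apply/eqP/p0; rewrite linearB E subrr.
pose pinv z := projT1 (cid (p_surj z)).
have pK z : p (pinv z) = z by rewrite /pinv; case: cid.
exists (f \o pinv); split=> [c y z|i] /=.
  rewrite -linearP; congr (f _); apply: p_inj.
  by rewrite linearP !pK.
by rewrite -fE; congr (f _); apply: p_inj; rewrite pK px.
Qed.

End Transfer.

(** * The induced module maps to the group algebra *)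

Section HeckeAction.
Local Open Scope quotient_scope.
Variables (C : fieldType) (m n : nat).
Local Notation M := (gralg C (m + n)).
Local Notation X := (jucys_murphy C (m + n)).
Local Notation FM := {fmonom ('S_n + 'I_n)%type}.
Local Notation F := {malg C[{fmonom ('S_n + 'I_n)%type}]}.
Hypothesis X_comm : forall i j, (1 <= i <= m + n)%N -> (1 <= j <= m + n)%N ->
  X i * X j = X j * X i.

(** S_n goes to the permutations of the last n letters, and Y_i to X_(m +
    i). *)
Definition gen_image (g : ('S_n + 'I_n)%type) : M :=
  match g with
  | inl s => gperm C (shift m s)
  | inr i => X (m + i).+1
  end.

Definition word_image (w : FM) : M := \prod_(g <- (w : seq _)) gen_image g.

Lemma word_image_morph : mmorphism word_image.
Proof.
split=> [x y|]; rewrite /word_image; last by rewrite fm1 big_nil.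
by rewrite fmM big_cat.
Qed.
HB.instance Definition _ := isMultiplicative.Build _ _ word_image word_image_morph.

Definition free_image (x : F) : M := mmap (in_alg M) word_image x.

Lemma free_imageM : {morph free_image : x y / x * y}.
Proof.
have comm (g : F) (w w' : FM) : GRing.comm (in_alg M g@_w) (word_image w').
  by rewrite /GRing.comm /= mulr_algl mulr_algr.
by have [] := commr_mmap_is_multiplicative comm.
Qed.

Lemma free_imageD : {morph free_image : x y / x + y}. Proof. exact: mmapD. Qed.
Lemma free_imageB : {morph free_image : x y / x - y}. Proof. exact: mmapB. Qed.
Lemma free_image1 : free_image 1 = 1. Proof. exact: mmap1. Qed.
Lemma free_image0 : free_image 0 = 0. Proof. exact: mmap0. Qed.
Lemma free_imageZ c x : free_image (c *: x) = c *: free_image x.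
Proof. by rewrite /free_image mmapZ /= mulr_algl. Qed.

Lemma free_image_gen g : free_image << fmu g >> = gen_image g.
Proof. by rewrite /free_image mmapU /= scale1r mul1r /word_image fmuE big_seq1. Qed.

(** The three shapes of relators are evaluated on abstract arguments, so that
    no step computes a product in the free algebra. *)
Lemma free_image_mulB x y z x' y' z' :
  free_image x = x' -> free_image y = y' -> free_image z = z' ->
  x' * y' = z' -> free_image (x * y - z) = 0.
Proof. by move=> Ex Ey Ez E; rewrite free_imageB free_imageM Ex Ey Ez E subrr. Qed.

Lemma free_image_comm x y x' y' :
  free_image x = x' -> free_image y = y' ->
  x' * y' = y' * x' -> free_image (x * y - y * x) = 0.
Proof.
move=> Ex Ey E; apply: etrans (free_imageB _ _) _; apply/eqP; rewrite subr_eq0.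
apply/eqP; apply: etrans (free_imageM x y) _.
by apply: etrans _ (esym (free_imageM y x)); rewrite Ex Ey.
Qed.

Lemma free_image_cross x y z x' y' z' :
  free_image x = x' -> free_image y = y' -> free_image z = z' ->
  x' * y' * x' + x' = z' -> free_image (x * y * x + x - z) = 0.
Proof.
move=> Ex Ey Ez E; apply: etrans (free_imageB _ _) _; rewrite Ez -E.
apply/eqP; rewrite subr_eq0; apply/eqP; apply: etrans (free_imageD _ _) _.
rewrite Ex; congr (_ + _); apply: etrans (free_imageM _ _) _; rewrite Ex.
by congr (_ * _); apply: etrans (free_imageM _ _) _; rewrite Ex Ey.
Qed.

Lemma free_image_perm s : free_image (free_perm C s) = gperm C (shift m s).
Proof. exact: free_image_gen. Qed.

Lemma free_image_Y i : free_image (free_Y C i) = X (m + i).+1.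
Proof. exact: free_image_gen. Qed.

Lemma free_image_ideal x : in_hecke_ideal x -> free_image x = 0.
Proof.
have rsh (i j : 'I_n) : j = i.+1 :> nat -> rshift m j = (rshift m i).+1 :> nat.
  by move=> ij; rewrite /= ij addnS.
elim=> {x} [x|| x y _ hx _ hy|a x _ hx|a x _ hx].
- case=> [|s t|i j|i j ij|i j k ij ki kj].
  + by rewrite free_imageB (free_image_perm 1%g) free_image1 shift1 subrr.
  + apply: (free_image_mulB (free_image_perm _) (free_image_perm _) (free_image_perm _)).
    by rewrite gperm_mul -shiftM.
  + apply: (free_image_comm (free_image_Y _) (free_image_Y _)).
    by apply: X_comm; [have := ltn_ord i | have := ltn_ord j]; lia.
  + apply: (free_image_cross (free_image_perm _) (free_image_Y _) (free_image_Y _)).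
    by rewrite shift_tperm (jm_cross C (rsh _ _ ij)).
  + apply: (free_image_comm (free_image_perm _) (free_image_Y _)).
    rewrite shift_tperm (@jm_far C _ _ _ (rsh _ _ ij) (rshift m k)) //.
      by rewrite (inj_eq (@rshift_inj m n)).
    by rewrite (inj_eq (@rshift_inj m n)).
- exact: free_image0.
- by rewrite free_imageD hx hy addr0.
- by rewrite free_imageM hx mulr0.
- by rewrite free_imageM hx mul0r.
Qed.

Local Notation H := (hecke C n).

Definition hecke_image (h : H) : M := free_image (repr h).

Lemma hecke_image_class x : hecke_image (hecke_class x) = free_image x.
Proof.
apply/eqP; rewrite -subr_eq0 -free_imageB; apply/eqP/free_image_ideal/hecke_classP.
by rewrite hecke_classK.
Qed.

Lemma hecke_imageM h k : hecke_image (h * k) = hecke_image h * hecke_image k.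
Proof.
rewrite -(hecke_classK h) -(hecke_classK k) -hecke_class_mul.
by rewrite !hecke_image_class free_imageM.
Qed.

Lemma hecke_imageD h k : hecke_image (h + k) = hecke_image h + hecke_image k.
Proof.
rewrite -(hecke_classK h) -(hecke_classK k) -hecke_classD.
by rewrite !hecke_image_class free_imageD.
Qed.

Lemma hecke_imageZ c h : hecke_image (c *: h) = c *: hecke_image h.
Proof.
by rewrite -(hecke_classK h) -hecke_classZ !hecke_image_class free_imageZ.
Qed.

Lemma hecke_image1 : hecke_image 1 = 1.
Proof. by rewrite -free_image1 -hecke_image_class. Qed.

Lemma hecke_image0 : hecke_image 0 = 0.
Proof. by rewrite -(scale0r (1 : H)) hecke_imageZ scale0r. Qed.

Lemma hecke_imageB h k : hecke_image (h - k) = hecke_image h - hecke_image k.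
Proof. by rewrite -scaleN1r hecke_imageD hecke_imageZ scaleN1r. Qed.

Lemma hecke_image_Y k : (1 <= k <= n)%N -> hecke_image (hecke_Y C n k) = X (m + k).
Proof.
case/letterP => i E ->; rewrite /hecke_Y; move: E; rewrite (letterS (erefl i.+1)) => _.
by rewrite hecke_image_class free_image_gen /= addnS.
Qed.

Variables (a : nat -> C) (u0 : M).
Hypothesis u0_weight : forall k, (1 <= k <= n)%N -> X (m + k) * u0 = a k *: u0.
Local Notation VM := (ind_module n a).

Lemma weight_ideal_image h : in_weight_ideal a h -> hecke_image h * u0 = 0.
Proof.
elim=> {h} [k kn||x y _ hx _ hy|h x _ hx].
- rewrite hecke_imageB hecke_image_Y // hecke_imageZ hecke_image1 mulrBl.
  by rewrite u0_weight // mulr_algl subrr.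
- by rewrite hecke_image0 mul0r.
- by rewrite hecke_imageD mulrDl hx hy addr0.
- by rewrite hecke_imageM -mulrA hx mulr0.
Qed.

(** The module map from the induced module to the group algebra that sends the
    generator v to u0; it exists because u0 has the weights of v. *)
Definition ind_image (x : VM) : M := hecke_image (repr x) * u0.

Lemma ind_classK (x : VM) : ind_class a (repr x) = x.
Proof. exact: reprK. Qed.

Lemma ind_image_class h : ind_image (ind_class a h) = hecke_image h * u0.
Proof.
apply/eqP; rewrite -subr_eq0 -mulrBl -hecke_imageB.
apply/eqP/weight_ideal_image/asboolP.
rewrite -[X in is_true X]/(_ \in weight_ideal a) Quotient.idealrBE.
by rewrite -[\pi_(Quotient.quot (weight_ideal a)) _]/(ind_class a _) ind_classK.
Qed.

Lemma ind_classZ c (h : H) : ind_class a (c *: h) = c *: ind_class a h.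
Proof. exact/esym/(pi_scale (weight_ideal_scale (a := a))). Qed.

Lemma ind_classD (h k : H) : ind_class a (h + k) = ind_class a h + ind_class a k.
Proof. by rewrite /ind_class raddfD. Qed.

Lemma ind_image_linear : linear ind_image.
Proof.
move=> c x y; rewrite -(ind_classK x) -(ind_classK y) -ind_classZ -ind_classD.
by rewrite !ind_image_class hecke_imageD hecke_imageZ mulrDl scalerAl.
Qed.

Lemma ind_image_basis s : ind_image (ind_basis a s) =
  hecke_image (hecke_phi_perm C s) * u0.
Proof. by rewrite /ind_basis ind_actE mulr1 ind_image_class. Qed.

End HeckeAction.

(** * The permutations span the induced module *)

Section Spanning.
Variables (C : fieldType) (n : nat).
Local Notation H := (hecke C n).

Lemma hecke_permM (s t : 'S_n) :
  hecke_perm C s * hecke_perm C t = hecke_perm C (t * s)%g.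
Proof.
rewrite /hecke_perm -hecke_class_mul; apply/eqP/hecke_classP/IdealRel.
exact: RelMul.
Qed.

Lemma hecke_perm1 : hecke_perm C (1%g : 'S_n) = 1.
Proof. by apply/eqP/hecke_classP/IdealRel; apply: RelOne. Qed.

Lemma hecke_Y_ord (i : 'I_n) : hecke_Y C n i.+1 = hecke_class (free_Y C i).
Proof. by rewrite /hecke_Y (letterS (erefl i.+1)). Qed.

Lemma hecke_cross (i j : 'I_n) : j = i.+1 :> nat ->
  hecke_perm C (tperm i j) * hecke_Y C n i.+1 * hecke_perm C (tperm i j) +
  hecke_perm C (tperm i j) = hecke_Y C n j.+1.
Proof.
move=> ij; rewrite !hecke_Y_ord /hecke_perm -!hecke_class_mul -hecke_classD.
by apply/eqP/hecke_classP/IdealRel; apply: RelCross.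
Qed.

Lemma hecke_far (i j k : 'I_n) : j = i.+1 :> nat -> k != i -> k != j ->
  hecke_perm C (tperm i j) * hecke_Y C n k.+1 =
  hecke_Y C n k.+1 * hecke_perm C (tperm i j).
Proof.
move=> ij ki kj; rewrite !hecke_Y_ord /hecke_perm -!hecke_class_mul.
by apply/eqP/hecke_classP/IdealRel; apply: RelFar.
Qed.

Lemma hecke_tperm2 (i j : 'I_n) :
  hecke_perm C (tperm i j) * hecke_perm C (tperm i j) = 1.
Proof. by rewrite hecke_permM tperm2 hecke_perm1. Qed.

Variable a : nat -> C.
Local Notation V := (ind_module n a).

(** The map from the group algebra of S_n to the induced module that sends
    sigma to sigma v. *)
Definition perm_span (y : gralg C n) : V :=
  \sum_s (y s : C) *: ind_class a (hecke_perm C s).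

Lemma perm_span_linear : linear perm_span.
Proof.
move=> c x y; rewrite /perm_span scaler_sumr -big_split /=; apply: eq_bigr => s _.
by rewrite !ffunE scalerDl scalerA.
Qed.

Definition in_span (x : V) : Prop := exists y, perm_span y = x.

Lemma in_spanD x y : in_span x -> in_span y -> in_span (x + y).
Proof.
move=> [u <-] [v <-]; exists (u + v).
by have := perm_span_linear 1 u v; rewrite !scale1r.
Qed.

Lemma in_span0 : in_span 0.
Proof. by exists 0; rewrite /perm_span big1 // => s _; rewrite ffunE scale0r. Qed.

Lemma in_spanZ c x : in_span x -> in_span (c *: x).
Proof.
move=> [u <-]; exists (c *: u).
by rewrite /perm_span scaler_sumr; apply: eq_bigr => s _; rewrite ffunE scalerA.
Qed.

Lemma in_span_perm s : in_span (ind_class a (hecke_perm C s)).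
Proof.
exists (gperm C s); rewrite /perm_span (bigD1 s) //= big1 => [|t ts].
  by rewrite ffunE eqxx scale1r addr0.
by rewrite ffunE (negPf ts) scale0r.
Qed.

Lemma ind_actD h x y : ind_act h (x + y) = ind_act h x + ind_act h y :> V.
Proof.
rewrite -(ind_classK x) -(ind_classK y) -ind_classD !ind_actE mulrDr.
exact: ind_classD.
Qed.

Lemma ind_actZ h c x : ind_act h (c *: x) = c *: ind_act h x :> V.
Proof.
by rewrite -(ind_classK x) -ind_classZ !ind_actE -scalerAr ind_classZ.
Qed.

Lemma ind_act_span h : (forall s, in_span (ind_act h (ind_class a (hecke_perm C s)))) ->
  forall x, in_span x -> in_span (ind_act h x).
Proof.
move=> hs x [y <-]; rewrite /perm_span.
elim/big_rec: _ => [|s z _ IH].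
  by rewrite -(scale0r (0 : V)) ind_actZ scale0r; apply: in_span0.
rewrite ind_actD ind_actZ; apply: in_spanD IH; apply: in_spanZ; exact: hs.
Qed.

Lemma act_perm_span s x : in_span x -> in_span (ind_act (hecke_perm C s) x).
Proof.
apply: ind_act_span => t; rewrite ind_actE hecke_permM; exact: in_span_perm.
Qed.

Lemma ind_actM h k x : ind_act (h * k) x = ind_act h (ind_act k x) :> V.
Proof. by rewrite -(ind_classK x) !ind_actE mulrA. Qed.

Lemma ind_actDl h k x : ind_act (h + k) x = ind_act h x + ind_act k x :> V.
Proof.
by rewrite -(ind_classK x) !ind_actE mulrDl ind_classD.
Qed.

Lemma ind_actBl h k x : ind_act (h - k) x = ind_act h x - ind_act k x :> V.
Proof.
rewrite -(ind_classK x) !ind_actE mulrBl -!scaleN1r ind_classD.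
by rewrite -[- 1 *: _]/(- 1 *: _) -ind_classZ.
Qed.

(** Induction on the word: Y_k s_i differs from s_i Y_(s_i k) by a constant,
    and Y_k v is a multiple of v. *)
Lemma act_Y_word w : all (fun i => 0 < i < n)%N w -> forall k : 'I_n,
  in_span (ind_act (hecke_Y C n k.+1) (ind_class a (hecke_perm C (word_perm n w)))).
Proof.
elim: w => [_ k|l w IH /= /andP[ln /IH {}IH] k].
  rewrite /= hecke_perm1 -[ind_class a 1]/(ind_vector n a) ind_weight ?ltn_ord //.
  by rewrite -[ind_vector n a]/(ind_class a 1) -hecke_perm1; apply/in_spanZ/in_span_perm.
have [i [j [_ ij Es]]] := simple_transp_ord ln.
rewrite Es /Defs.pcomp -hecke_permM -[ind_class a (_ * _)]ind_actE -ind_actM.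
set x := ind_class a _ in IH *.
have px : in_span x by apply: in_span_perm.
case: (eqVneq k i) => [->|ki].
  have -> : hecke_Y C n i.+1 * hecke_perm C (tperm i j) =
      hecke_perm C (tperm i j) * hecke_Y C n j.+1 - 1.
    by rewrite -(hecke_cross ij) mulrDr !mulrA hecke_tperm2 mul1r addrK.
  rewrite ind_actBl ind_actM -scaleN1r -[ind_act 1 x](_ : x = _).
    by apply: in_spanD; [apply: act_perm_span | apply: in_spanZ].
  by rewrite -(ind_classK x) ind_actE mul1r.
case: (eqVneq k j) => [->|kj].
  have -> : hecke_Y C n j.+1 * hecke_perm C (tperm i j) =
      hecke_perm C (tperm i j) * hecke_Y C n i.+1 + 1.
    by rewrite -(hecke_cross ij) mulrDl -!mulrA hecke_tperm2 mulr1.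
  rewrite ind_actDl ind_actM -[ind_act 1 x](_ : x = _).
    by apply: in_spanD; [apply: act_perm_span | apply: px].
  by rewrite -(ind_classK x) ind_actE mul1r.
by rewrite -(hecke_far ij) // ind_actM; apply: act_perm_span.
Qed.

Lemma act_Y_span (k : 'I_n) x : in_span x -> in_span (ind_act (hecke_Y C n k.+1) x).
Proof.
apply: ind_act_span => s; have [w [wn <-]] := has_word_all s.
exact: act_Y_word.
Qed.

Lemma monalg_cons (g : ('S_n + 'I_n)%type) w :
  << FMonom (g :: w) >> = << fmu g >> * << FMonom w >>
    :> {malg C[{fmonom ('S_n + 'I_n)%type}]}.
Proof.
rewrite malgM_def fgmulUU mulr1; congr << _ >>.
by apply/eqP; rewrite fmP fmM fmU.
Qed.

Lemma act_word_span (g : {fmonom ('S_n + 'I_n)%type}) x :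
  in_span x -> in_span (ind_act (hecke_class << g >>) x).
Proof.
case: g => w; elim: w => [|g w IH] px.
  rewrite -fmoneE -[hecke_class _]/(1 : H) -(ind_classK x) ind_actE mul1r.
  by rewrite ind_classK.
rewrite monalg_cons hecke_class_mul ind_actM; have {IH px} := IH px.
case: g => [s|i] px; first exact: act_perm_span.
by have := act_Y_span i px; rewrite hecke_Y_ord.
Qed.

Lemma ind_actZl c h x : ind_act (c *: h) x = c *: ind_act h x :> V.
Proof. by rewrite -(ind_classK x) !ind_actE -scalerAl ind_classZ. Qed.

(** The span contains v and is stable under the generators of the Hecke
    algebra. *)
Lemma perm_span_surj x : in_span x.
Proof.
have v_span : in_span (ind_class a 1) by rewrite -hecke_perm1; apply: in_span_perm.
rewrite -(ind_classK x) -[repr x]mulr1 -ind_actE -(hecke_classK (repr x)).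
move: (repr (repr x)) => y; rewrite [y]monalgE.
elim/big_rec: _ => [|g z _ IH].
  have -> : hecke_class (0 : {malg C[{fmonom ('S_n + 'I_n)%type}]}) = 0 :> H.
    by rewrite /hecke_class raddf0.
  by rewrite -(scale0r (0 : H)) ind_actZl scale0r; apply: in_span0.
rewrite hecke_classD ind_actDl; apply: in_spanD IH.
have -> : << y@_g *g g >> = y@_g *: << g >> :> {malg C[{fmonom ('S_n + 'I_n)%type}]}.
  by apply/malgP => k; rewrite mcoeffZ !mcoeffU mulrnAr mulr1.
by rewrite hecke_classZ ind_actZl; apply: in_spanZ; apply: act_word_span.
Qed.

End Spanning.

(** * The weight basis of the induced module *)

Lemma dim_gralg (C : fieldType) N : \dim {:gralg C N} = #|'S_N|.
Proof. by rewrite dimvf /dim /= muln1. Qed.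

(** They are diagonal in the weight basis, and 1 is a combination of the
    vectors of that basis. *)
Lemma jucys_murphy_comm (C : fieldType) N (v : tableau -> tableau -> gralg C N) :
  weight_basis v -> forall i j, (1 <= i <= N)%N -> (1 <= j <= N)%N ->
  jucys_murphy C N i * jucys_murphy C N j = jucys_murphy C N j * jucys_murphy C N i.
Proof.
move=> wb i j iN jN; set Xi := jucys_murphy C N i; set Xj := jucys_murphy C N j.
pose b := in_tuple [seq v p.1 p.2 | p <- std_pairs N].
rewrite -[LHS]mulr1 -[RHS]mulr1 (basis_expand (b := b) wb.1 1) [LHS]mulr_sumr [RHS]mulr_sumr.
apply: eq_bigr => k _; rewrite -!scalerAr; congr (_ *: _).
have kS : (k < size (std_pairs N))%N by rewrite -(size_map (fun p => v p.1 p.2)) ltn_ord.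
rewrite /= (nth_map ([::], [::])) //; set p := nth _ _ _.
have [_ _ sp] := std_pairs_std (mem_nth ([::], [::]) kS : p \in std_pairs N).
have [Ei _] := wb.2 _ _ sp i iN; have [Ej _] := wb.2 _ _ sp j jN.
by rewrite -!mulrA Ei Ej -!scalerAr Ei Ej !scalerA mulrC.
Qed.

Lemma height_stair_word k j : height (stair_word k) j = (k - j)%N.
Proof.
by elim: k => [|k IH] //; rewrite height_cat IH height_iota0; lia.
Qed.

(** The outer corners of the staircase have contents 1 - n, 3 - n, ..., n - 1,
    which are the weights a_i. *)
Lemma content_T0 n b : (b < n)%N ->
  content (perm_T0 (1%g : 'S_n)) ('C(n, 2) + b).+1 = b%:Z *+ 2 - (n.-1)%:Z.
Proof.
move=> ltb; have n0 : (0 < n)%N by case: n ltb.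
have ltN : ('C(n, 2) + b < 'C(n, 2) + n)%N by rewrite ltn_add2l.
rewrite (content_column_word (standard_perm_T0 1%g n0) ltN).
rewrite column_word_perm_T0 // invg1; set w := _ ++ _.
have szs : size (stair_word n.-1) = 'C(n, 2) by rewrite size_stair_word prednK.
have idE : mkseq (perm_nat (1%g : 'S_n)) n = iota 0 n.
  rewrite -[RHS](map_id (iota 0 n)); apply/eq_in_map => j; rewrite mem_iota => /andP[_ ltj].
  by rewrite (perm_natE 1%g (Ordinal ltj)) perm1.
have nb : nth 0%N w ('C(n, 2) + b) = b.
  by rewrite /w nth_cat szs ltnNge leq_addr addnC addnK idE nth_iota.
have tk : take ('C(n, 2) + b) w = stair_word n.-1 ++ iota 0 b.
  by rewrite /w take_cat szs ltnNge leq_addr addnC addnK idE take_iota (minn_idPl (ltnW ltb)).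
rewrite /word_content nb tk height_cat height_stair_word height_iota0; lia.
Qed.

Section WeightVectors.
Variables (C : fieldType) (n : nat).
Hypothesis C0 : char0 C.
Hypothesis n0 : (0 < n)%N.
Local Notation m := 'C(n, 2).
Local Notation N := (m + n)%N.
Local Notation M := (gralg C N).
Local Notation X := (jucys_murphy C N).
Local Notation a := (@weights C n).
Variable vN : tableau -> tableau -> M.
Hypothesis wb : weight_basis vN.

Let X_comm := jucys_murphy_comm wb.

Lemma weightsE p : a p = ((2 * p)%:Z - n%:Z - 1)%:~R.
Proof. by rewrite !mulrzBr -!pmulrn. Qed.

Lemma weightsB p q : a p - a q = ((p%:Z - q%:Z) *+ 2)%:~R.
Proof. by rewrite !weightsE -mulrzBr; congr (_%:~R); lia. Qed.

Lemma weights_neq p q : p != q -> a p != a q.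
Proof.
move=> pq; rewrite -subr_eq0 weightsB intr_eq0_char0 //.
by apply/eqP; move: pq => /eqP; lia.
Qed.

(** The differences of the weights are even. *)
Lemma weights_sq p q : 1 - (a p - a q) ^+ 2 != 0.
Proof.
rewrite weightsB expr2 -[1]/(1%:~R) -intrM -mulrzBr intr_eq0_char0 //.
set z := (p%:Z - q%:Z); have -> : (z *+ 2) * (z *+ 2) = (z * z) *+ 4.
  by rewrite mulrnAl mulrnAr -mulrnA.
by apply/eqP; lia.
Qed.

Definition u0 : M := vN (perm_T0 (1%g : 'S_n)) (perm_T0 (1%g : 'S_n)).

Lemma std_pair_T0 : std_pair N (perm_T0 (1%g : 'S_n)) (perm_T0 (1%g : 'S_n)).
Proof. exact: std_pair_perm_T0. Qed.

Lemma u0_neq0 : u0 != 0.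
Proof.
apply: (free_not0 (basis_free wb.1)); apply/mapP.
exists (perm_T0 (1%g : 'S_n), perm_T0 (1%g : 'S_n)) => //.
by rewrite mem_std_pairs std_pair_T0.
Qed.

Lemma u0_weight k : (1 <= k <= n)%N -> X (m + k) * u0 = a k *: u0.
Proof.
case: k => // k ltk; have mk : (1 <= m + k.+1 <= N)%N by lia.
have [-> _] := wb.2 _ _ std_pair_T0 _ mk; congr (_ *: _).
rewrite addnS content_T0 // weightsE.
by congr (_%:~R); lia.
Qed.

(** Each phi_l exchanges the weights l and l + 1, and it maps the vector to a
    nonzero one since the square of its difference of weights is not 1. *)
Lemma phi_word_image w : all (fun i => 0 < i < n)%N w ->
  let u := hecke_image m (\prod_(i <- w) hecke_phi C n i) * u0 in
  u != 0 /\ forall k : 'I_n, X (m + k.+1) * u = a ((word_perm n w)^-1%g k).+1 *: u.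
Proof.
elim: w => [_|l w IH /= /andP[ln /IH {IH}]].
  rewrite /= big_nil (hecke_image1 X_comm) mul1r; split=> [|k]; first exact: u0_neq0.
  by rewrite invg1 perm1 u0_weight // ltn_ord.
rewrite big_cons (hecke_imageM X_comm) -mulrA; set u := _ * u0 => -[un0 wu].
have [i [j [lE ij Es]]] := simple_transp_ord ln.
set S := gperm C (tperm (rshift m i) (rshift m j)).
have rij : rshift m j = (rshift m i).+1 :> nat by rewrite /= ij addnS.
pose fS := pack_linear (left_act_linear S).
pose fX k := pack_linear (left_act_linear (X k)).
have SS x : fS (fS x) = x by rewrite /= /left_act mulrA gperm_tperm2 mul1r.
have cross x : fS (fX (m + i).+1 (fS x)) + fS x = fX (m + j).+1 x.
  by rewrite /= /left_act !mulrA -mulrDl -(jm_cross C rij).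
set d := a ((word_perm n w)^-1%g i).+1 - a ((word_perm n w)^-1%g j).+1.
have w1 : fX (m + i).+1 u = a ((word_perm n w)^-1%g i).+1 *: u.
  by rewrite -wu addnS.
have w2 : fX (m + j).+1 u = a ((word_perm n w)^-1%g j).+1 *: u.
  by rewrite -wu addnS.
have uE : hecke_image m (hecke_phi C n l) * u = d *: fS u + u.
  have ln1 : (1 <= l <= n)%N by lia.
  have ln2 : (1 <= l.+1 <= n)%N by lia.
  rewrite /hecke_phi (hecke_imageD X_comm) (hecke_imageM X_comm) (hecke_imageB X_comm).
  rewrite (hecke_image1 X_comm) (hecke_image_Y X_comm ln1) (hecke_image_Y X_comm ln2).
  rewrite /hecke_perm (hecke_image_class X_comm) free_image_perm Es.
  have -> : l.+1 = j.+1 by rewrite lE ij.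
  rewrite lE shift_tperm -/S mulrDl mul1r; congr (_ + _).
  by rewrite -mulrA mulrBl !wu -scalerBl -/d -scalerAr.
rewrite uE; split.
  apply/negP => /eqP E; have := phi_phi SS u d; rewrite E linear0 scaler0 addr0.
  move/esym/eqP; rewrite scaler_eq0 (negPf un0) orbF.
  by rewrite (negPf (weights_sq _ _)).
move=> k; rewrite /Defs.pcomp invMg permM Es tpermV.
have [->|ki] := eqVneq k i.
  rewrite tpermL addnS; exact: (phi_weight1 SS cross w1 w2).
have [->|kj] := eqVneq k j.
  rewrite tpermR addnS; exact: (phi_weight2 SS cross w1 w2).
rewrite tpermD 1?eq_sym //.
have far : X (m + k.+1) * fS u = fS (X (m + k.+1) * u).
  rewrite /= /left_act !mulrA addnS.
  by rewrite -(@jm_far C N _ _ rij (rshift m k)) ?(inj_eq (@rshift_inj m n)).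
by rewrite mulrDr -scalerAr far wu linearZ /= scalerDr !scalerA mulrC.
Qed.

Lemma ind_image_free (c : 'S_n -> C) :
  \sum_s c s *: ind_image u0 (ind_basis a s) = 0 -> forall s, c s = 0.
Proof.
pose u s := ind_image u0 (ind_basis a s).
have uP s : u s != 0 /\ forall k : 'I_n, X (m + k.+1) * u s = a (s^-1%g k).+1 *: u s.
  have [ws Es] := some_reduced_wordP s; rewrite /u ind_image_basis //; last exact: u0_weight.
  by have := phi_word_image ws; rewrite Es.
apply: (@joint_eigenvectors_free C _ 'I_n M
  (fun k => pack_linear (left_act_linear (X (m + k.+1))))
  (fun (s : 'S_n) k => a (s^-1%g k).+1) u).
- by move=> s k; apply: (uP s).2.
- move=> s t st; have : s^-1%g != t^-1%g by rewrite (inj_eq invg_inj).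
  move/eqP => ne; have /existsP[k sk] : [exists k, s^-1%g k != t^-1%g k].
    apply/existsP; apply: contra_notP ne => nk; apply/permP => k; apply/eqP/negPn/negP => E.
    by apply: nk; exists k.
  by exists k; apply: weights_neq; rewrite eqSS.
- by move=> s; apply: (uP s).1.
Qed.

Lemma ind_basis_span (x : V C n) : exists c : 'S_n -> C, x = \sum_s c s *: v_ C s.
Proof.
apply: (transfer_span (p := pack_linear (@perm_span_linear C n a))
  (q := pack_linear (ind_image_linear X_comm u0_weight))).
- exact: perm_span_surj.
- by rewrite dim_gralg.
- exact: ind_image_free.
Qed.

Lemma ind_basis_linear (W : lmodType C) (F : 'S_n -> W) :
  exists f : V C n -> W, linear f /\ forall s, f (v_ C s) = F s.
Proof.
apply: (transfer_linear (p := pack_linear (@perm_span_linear C n a))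
  (q := pack_linear (ind_image_linear X_comm u0_weight))).
- exact: perm_span_surj.
- by rewrite dim_gralg.
- exact: ind_image_free.
Qed.

End WeightVectors.

(** * The isomorphism *)

Section WeightBasis.
Variables (C : fieldType) (N : nat) (v : tableau -> tableau -> gralg C N).
Hypothesis wb : weight_basis v.

Lemma weight_basis_linear (W : lmodType C) (F : tableau -> tableau -> W) :
  exists f : {linear gralg C N -> W},
    forall T T', std_pair N T T' -> f (v T T') = F T T'.
Proof.
pose b := in_tuple [seq v p.1 p.2 | p <- std_pairs N].
pose l i := nth ([::], [::]) (std_pairs N) i.
have [f fE] := basis_linear (b := b) wb.1 (fun i => F (l i).1 (l i).2).
exists f => T T'; rewrite -mem_std_pairs => pI.
have lti : (index (T, T') (std_pairs N) < size (std_pairs N))%N by rewrite index_mem.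
have lti' : (index (T, T') (std_pairs N) < size [seq v p.1 p.2 | p <- std_pairs N])%N.
  by rewrite size_map.
have := fE (Ordinal lti').
by rewrite /= (nth_map ([::], [::])) // /l /= nth_index.
Qed.

Lemma weight_basis_ext (W : lmodType C) (f g : {linear gralg C N -> W}) :
  (forall T T', std_pair N T T' -> f (v T T') = g (v T T')) -> f =1 g.
Proof.
move=> fg x; pose b := in_tuple [seq v p.1 p.2 | p <- std_pairs N].
rewrite (basis_expand (b := b) wb.1 x) !linear_sum; apply: eq_bigr => i _.
rewrite !linearZ /=; congr (_ *: _).
have : b`_i \in [seq v p.1 p.2 | p <- std_pairs N] by apply: mem_nth; apply: ltn_ord.
by case/mapP => p /std_pairs_std[_ _ sp] ->; apply: fg.
Qed.

(** The linear form that is 1 at v T T' and 0 at the other basis vectors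
    separates them. *)
Lemma weight_basis_scale_inj T T' U U' c d : std_pair N T T' -> std_pair N U U' ->
  c != 0 -> c *: v T T' = d *: v U U' -> T = U /\ T' = U'.
Proof.
move=> sT sU c0 E.
have [f fE] := weight_basis_linear (fun A B => ((A, B) == (T, T'))%:R : C^o).
have := congr1 f E; rewrite !linearZ /= !fE // eqxx.
case: eqP => [[-> ->] //|_]; rewrite mulr1n mulr0n scaler0 => /eqP.
by rewrite scaler_eq0 (negPf c0) oner_eq0.
Qed.

Lemma size_std_pairs : size (std_pairs N) = #|'S_N|.
Proof.
have := size_basis (X := in_tuple [seq v p.1 p.2 | p <- std_pairs N]) wb.1.
by rewrite dim_gralg size_map.
Qed.

(** RSK is injective into the pairs of tableaux, and there are n! of these
    since they index a basis of the group algebra. *)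
Lemma rsk_surj T T' : std_pair N T T' -> exists s : 'S_N, rskP s = T /\ rskQ s = T'.
Proof.
move=> sp; pose f (s : 'S_N) := (rskP s, rskQ s).
have uf : uniq [seq f s | s <- enum 'S_N].
  by rewrite map_inj_uniq ?enum_uniq // => s t [] /rsk_inj/[apply].
have sub : {subset [seq f s | s <- enum 'S_N] <= std_pairs N}.
  by move=> p /mapP[s _ ->]; rewrite mem_std_pairs std_pair_rsk.
have [|_ E] := uniq_min_size uf sub.
  by rewrite size_map -cardE size_std_pairs.
have : (T, T') \in [seq f s | s <- enum 'S_N] by rewrite E mem_std_pairs.
by case/mapP => s _ [-> ->]; exists s.
Qed.

End WeightBasis.

Section Rectification.
Variables (C : fieldType) (n : nat).
Hypothesis C0 : char0 C.
Hypothesis n0 : (0 < n)%N.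
Local Notation m := 'C(n, 2).
Variables (vN : tableau -> tableau -> gralg C (m + n)).
Variables (vn : tableau -> tableau -> gralg C n).
Hypotheses (wbN : weight_basis vN) (wbn : weight_basis vn).

Lemma etaP : linear (eta vN) /\
  forall s : 'S_n, eta vN (v_ C s) = vN (perm_T0 s) (perm_T0 s^-1%g).
Proof.
have [f fP] := ind_basis_linear C0 n0 wbN (fun s => vN (perm_T0 s) (perm_T0 s^-1%g)).
exact: (@xgetPex _ (fun=> 0) [set f : V C n -> gralg C (m + n) | linear f /\
    forall s, f (v_ C s) = vN (perm_T0 s) (perm_T0 s^-1%g)]%classic (ex_intro _ f fP)).
Qed.

Lemma foldl_linear (K : Type) (U : lmodType C) (F : U -> K -> U) s :
  (forall k, linear (F^~ k)) -> linear (fun u => foldl F u s).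
Proof. by move=> lF c x y; elim: s x y => [|k s IH] x y //=; rewrite lF IH. Qed.

Lemma rect_linear N (U : vectType C) (act : gralg C N -> U -> U) a b :
  linear (rect act a b).
Proof. by apply: foldl_linear => k; apply: foldl_linear => i; apply: linearP. Qed.

Lemma rectify_linear : linear (@rectify C n).
Proof. by move=> c x y; rewrite /rectify !rect_linear. Qed.

Lemma rectify_eta s : exists A B : tableau, [/\ (A, B) \in D_pairs n,
    restrict n A = rskP s, restrict n B = rskQ s &
    exists2 c, c != 0 & rectify (eta vN (v_ C s)) = c *: vN A B].
Proof. by rewrite etaP.2; apply: rectify_perm. Qed.

Lemma vN_in_D A B : (A, B) \in D_pairs n -> vN A B \in D vN.
Proof. by move=> AB; apply: memv_span; apply/mapP; exists (A, B). Qed.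

Lemma rectify_eta_in_D x : rectify (eta vN x) \in D vN.
Proof.
have [c ->] := ind_basis_span C0 n0 wbN x.
pose f := pack_linear rectify_linear; pose g := pack_linear etaP.1.
rewrite -[eta vN _]/(g _) -[rectify _]/(f _) !linear_sum rpred_sum // => s _.
rewrite !linearZ rpredZ //=.
by have [A [B [AB _ _ [d _ ->]]]] := rectify_eta s; rewrite rpredZ // vN_in_D.
Qed.

(** The map from v A B to the vector of the restricted tableaux extends to the
    whole group algebra, so its restriction to D is a witness. *)
Lemma forgetP A B : (A, B) \in D_pairs n ->
  forget vN vn (vsproj (D vN) (vN A B)) = vn (restrict n A) (restrict n B).
Proof.
have [g gE] := weight_basis_linear wbN (fun A B => vn (restrict n A) (restrict n B)).
pose f : 'Hom(subvs_of (D vN), gralg C n) := linfun (g \o vsval).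
have fP : forall A B, (A, B) \in D_pairs n ->
    f (vsproj (D vN) (vN A B)) = vn (restrict n A) (restrict n B).
  move=> {}A {}B AB; rewrite lfunE /= vsprojK ?vN_in_D // gE //.
  by move: AB; rewrite mem_filter => /andP[_]; rewrite mem_std_pairs.
exact: (@xgetPex _ 0 [set f : 'Hom(subvs_of (D vN), gralg C n) |
  forall A B, (A, B) \in D_pairs n -> f (vsproj (D vN) (vN A B)) =
    vn (restrict n A) (restrict n B)]%classic (ex_intro _ f fP)).
Qed.

Lemma Phi_linear : linear (Phi vN vn).
Proof. by move=> c x y; rewrite /Phi etaP.1 rectify_linear !linearP. Qed.

Lemma Phi_basis s : exists2 c, c != 0 &
  Phi vN vn (v_ C s) = c *: vn (rskP s) (rskQ s).
Proof.
have [A [B [AB <- <- [c c0 E]]]] := rectify_eta s; exists c => //.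
by rewrite /Phi E !linearZ /= forgetP.
Qed.

Lemma Phi_bijective : bijective (Phi vN vn).
Proof.
pose c s := s2val (cid2 (Phi_basis s)).
have c0 s : c s != 0 := s2valP (cid2 (Phi_basis s)).
have cE s : Phi vN vn (v_ C s) = c s *: vn (rskP s) (rskQ s) := s2valP' (cid2 (Phi_basis s)).
pose F T T' : V C n :=
  if [pick s : 'S_n | (rskP s == T) && (rskQ s == T')] is Some s
  then (c s)^-1 *: v_ C s else 0.
have FE s : F (rskP s) (rskQ s) = (c s)^-1 *: v_ C s.
  rewrite /F; case: pickP => [t /andP[/eqP EP /eqP EQ]|/(_ s)]; last by rewrite !eqxx.
  by rewrite (rsk_inj EP EQ).
have [g gE] := weight_basis_linear wbn F.
pose f := pack_linear Phi_linear.
have gf s : g (f (v_ C s)) = v_ C s.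
  apply: (etrans (congr1 g (cE s))); rewrite linearZ /= (gE _ _ (std_pair_rsk s)) FE.
  by rewrite scalerA mulfV // scale1r.
have fg (s : 'S_n) : f (g (vn (rskP s) (rskQ s))) = vn (rskP s) (rskQ s).
  rewrite (gE _ _ (std_pair_rsk s)) FE linearZ.
  by apply: (etrans (congr1 _ (cE s))); rewrite /= scalerA mulVf // scale1r.
exists g => [x|y].
  have [d ->] := ind_basis_span C0 n0 wbN x.
  pose gf' : {linear V C n -> V C n} := g \o f.
  rewrite -[LHS]/(gf' _) linear_sum; apply: eq_bigr => s _.
  by rewrite linearZ; congr (_ *: _); apply: gf.
apply: (weight_basis_ext wbn (f := f \o g) (g := idfun)) => T T' sp.
by have [s [<- <-]] := rsk_surj wbn sp; apply: fg.
Qed.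

Lemma Phi_preimage T T' : std_pair n T T' ->
  exists! s : 'S_n, exists2 c, c != 0 & Phi vN vn (v_ C s) = c *: vn T T'.
Proof.
move=> sp; have [s [EP EQ]] := rsk_surj wbn sp; exists s; split.
  by rewrite -EP -EQ; apply: Phi_basis.
move=> t [c c0 Et]; have [d d0 Ed] := Phi_basis t; rewrite Et in Ed.
have [E1 E2] := weight_basis_scale_inj wbn sp (std_pair_rsk t) c0 Ed.
by apply: rsk_inj; rewrite ?EP ?EQ.
Qed.

End Rectification.

Theorem theorem4p1 (R : realType) (n : nat) (n_ge1 : (1 <= n)%N)
    (vN : tableau -> tableau -> gralg R[i] ('C(n, 2) + n))
    (vn : tableau -> tableau -> gralg R[i] n)
    (vN_basis : weight_basis vN) (vn_basis : weight_basis vn) :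
  [/\ linear (eta vN) /\
        (forall s : 'S_n, eta vN (v_ R[i] s) = vN (perm_T0 s) (perm_T0 s^-1%g)),
      forall x : V R[i] n, rectify (eta vN x) \in D vN,
      linear (Phi vN vn) /\ bijective (Phi vN vn),
      forall T T' : tableau, std_pair n T T' ->
        exists! s : 'S_n, exists2 c : R[i], c != 0 &
          Phi vN vn (v_ R[i] s) = c *: vn T T'
    & forall s : 'S_n, std_pair n (rskP s) (rskQ s) /\
        exists2 c : R[i], c != 0 &
          Phi vN vn (v_ R[i] s) = c *: vn (rskP s) (rskQ s)].
Proof.
have C0 : char0 R[i] by move=> k; apply: Num.Theory.pnatr_eq0.
split.
- exact: etaP.
- exact: rectify_eta_in_D.
- by split; [apply: Phi_linear | apply: Phi_bijective].
- exact: Phi_preimage.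
- by move=> s; split; [apply: std_pair_rsk | apply: Phi_basis].
Qed.
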